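(* Fix $0<q<1$ and a prime $p$. Let $G$ be a finite abelian $p$-group equipped with a duality pairing $\langle\cdot,\cdot\rangle_G$. For each $n$, let $\Gamma\in G(n,q)$ be an Erdős–Rényi random graph, let $S$ be its sandpile group, let $S_p$ be the Sylow $p$-subgroup of $S$, and let $\langle\cdot,\cdot\rangle_{S,p}$ be the restriction to $S_p$ of the canonical (Bosch–Lorenzini) duality pairing on the torsion subgroup of $S$. Then \[\lim_{n\to\infty}\Pr\big((S_p,\langle\cdot,\cdot\rangle_{S,p})\simeq(G,\langle\cdot,\cdot\rangle_G)\big)=\frac{\prod_{k=1}^{\infty}(1-p^{1-2k})}{|G|\,|\mathrm{Aut}(G,\langle\cdot,\cdot\rangle_G)|}.\]
   Context: $G(n,q)$: random simple graph on vertex set $\{1,\dots,n\}$, each of the $\binom n2$ possible edges present independently with probability $q$. The Laplacian $L=L_\Gamma$ is the $n\times n$ integer matrix with $L_{ij}=1$ if $i\ne j$ and $\{i,j\}$ is an edge, $L_{ij}=0$ if $i\neq j$ and $\{i,j\}$ is not an edge, and $L_{ii}=-\deg(i)$. With $Z\subset\mathbb Z^n$ the subgroup of vectors whose coordinates sum to $0$, the sandpile group is $S=Z/\mathrm{col}(L)$, where $\mathrm{col}(L)=L\mathbb Z^n$. A pairing on an abelian group $A$ is a bilinear map $A\times A\to\mathbb Q/\mathbb Z$; a duality pairing is a symmetric pairing for which $a\mapsto\langle a,\cdot\rangle$ is an isomorphism $A\to\mathrm{Hom}(A,\mathbb Q/\mathbb Z)$. For a symmetric $M\in M_n(\mathbb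 Z)$, the torsion subgroup of $\mathrm{cok}(M)=\mathbb Z^n/\mathrm{col}(M)$ equals $\ker(M)^\perp/\mathrm{col}(M)$ ($\perp$ w.r.t. the standard dot product), and its Bosch–Lorenzini pairing is defined as follows: for torsion elements $\tau,\tau'$ choose lifts $T,T'\in\ker(M)^\perp$, positive integers $k,k'$ and $S_0,S_0'\in\mathbb Z^n$ with $MS_0=kT$, $MS_0'=k'T'$, and set $\langle\tau,\tau'\rangle=S_0^tMS_0'/(kk')\bmod\mathbb Z$; it is a well-defined duality pairing. The torsion subgroup of the sandpile group $S$ equals the torsion subgroup of $\mathrm{cok}(L)$, and its canonical duality pairing is this pairing for $M=L$. An isomorphism $(A,\langle\cdot,\cdot\rangle_A)\simeq(B,\langle\cdot,\cdot\rangle_B)$ is a group isomorphism $f$ with $\langle f(a),f(a')\rangle_B=\langle a,a'\rangle_A$; $\mathrm{Aut}(G,\langle\cdot,\cdot\rangle_G)$ is the group of automorphisms of $G$ preserving the pairing. *)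

(* Defs.v *)
From HB Require Import structures.
From mathcomp Require Import all_boot all_order all_fingroup all_algebra.
From mathcomp Require Import all_solvable.
From mathcomp Require Import generic_quotient ring_quotient.
From mathcomp Require Import ring zify.
From mathcomp Require Import all_classical all_reals all_analysis.

Set Implicit Arguments.
Unset Strict Implicit.
Unset Printing Implicit Defensive.

Import Order.TTheory GRing.Theory Num.Theory.
Import numFieldNormedType.Exports.

Local Open Scope ring_scope.
Local Open Scope quotient_scope.

Definition int_rat : {pred rat} := fun x => x \is a Num.int.

Lemma int_rat_zmod_closed : zmod_closed int_rat.
Proof. by split=> [|x y]; [exact: rpred0 | exact: rpredB]. Qed.

HB.instance Definition _ :=
  GRing.isZmodClosed.Build rat int_rat int_rat_zmod_closed.

Definition QZ : zmodType := Quotient.quot int_rat.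

Definition modZ (x : rat) : QZ := \pi_QZ x.

Definition bilinear (A : zmodType) (b : A -> A -> QZ) : Prop :=
  (forall x y z, b (x + y) z = b x z + b y z) /\
  (forall x y z, b x (y + z) = b x y + b x z).

(* The last clause is the bijectivity of a |-> b a _ onto Hom(A, Q/Z); that
   this map is a group morphism is part of bilinearity. *)
Definition duality_pairing (A : zmodType) (b : A -> A -> QZ) : Prop :=
  [/\ bilinear b,
      forall x y, b x y = b y x &
      forall phi : {additive A -> QZ}, exists! a, forall x, b a x = phi x].

Definition pairing_iso (A B : zmodType) (bA : A -> A -> QZ) (bB : B -> B -> QZ)
    : Prop :=
  exists f : {additive A -> B},
    bijective f /\ forall x y, bB (f x) (f y) = bA x y.

Definition pairing_Aut (G : finZmodType) (b : G -> G -> QZ) : {set {perm G}} :=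
  [set s in Aut [set: G] | [forall x, forall y, b (s x) (s y) == b x y]].

(* The elements of p-power order. For finite A this is the usual Sylow
   p-subgroup; for infinite A (the sandpile group of a disconnected graph) it
   is the Sylow p-subgroup of the torsion subgroup. *)
Definition ppower_torsion (p : nat) (A : zmodType) : {pred A} :=
  fun x => `[< exists k : nat, x *+ (p ^ k) = 0 >].

Lemma ppower_torsion_zmod_closed p A : zmod_closed (@ppower_torsion p A).
Proof.
split=> [|x y /asboolP[k xk] /asboolP[l yl]].
  by apply/asboolP; exists 0; rewrite mul0rn.
apply/asboolP; exists (k + l)%N.
by rewrite mulrnBl expnD {1}mulrnA xk mulnC mulrnA yl !mul0rn subr0.
Qed.

HB.instance Definition _ p A :=
  GRing.isZmodClosed.Build A (@ppower_torsion p A)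
    (ppower_torsion_zmod_closed p A).

Record Sylow_subgroup (p : nat) (A : zmodType) := SylowSubgroup {
  Sylow_val : A;
  _ : Sylow_val \in @ppower_torsion p A
}.

HB.instance Definition _ p A := [isSub for @Sylow_val p A].
HB.instance Definition _ p A := [Choice of Sylow_subgroup p A by <:].
HB.instance Definition _ p A :=
  [SubChoice_isSubZmodule of Sylow_subgroup p A by <:].

Definition col_image n (M : 'M[int]_n) : {pred 'cV[int]_n} :=
  fun v => `[< exists x : 'cV[int]_n, v = M *m x >].

Lemma col_image_zmod_closed n (M : 'M[int]_n) : zmod_closed (col_image M).
Proof.
split=> [|u v /asboolP[x ->] /asboolP[y ->]].
  by apply/asboolP; exists 0; rewrite mulmx0.
by apply/asboolP; exists (x - y); rewrite mulmxBr.
Qed.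

HB.instance Definition _ n (M : 'M[int]_n) :=
  GRing.isZmodClosed.Build _ (col_image M) (col_image_zmod_closed M).

Definition cok n (M : 'M[int]_n) : zmodType := Quotient.quot (col_image M).

Definition dot n (u v : 'cV[int]_n) : int := \sum_i u i 0 * v i 0.

Definition ker_perp n (M : 'M[int]_n) (T : 'cV[int]_n) : Prop :=
  forall v : 'cV[int]_n, M *m v = 0 -> dot T v = 0.

Definition BL_value n (M : 'M[int]_n) (t t' : cok M) (r : QZ) : Prop :=
  exists (T T' S S' : 'cV[int]_n) (k k' : nat),
    [/\ ker_perp M T /\ ker_perp M T',
        \pi_(cok M) T = t /\ \pi_(cok M) T' = t',
        (0 < k)%N /\ (0 < k')%N,
        M *m S = T *+ k /\ M *m S' = T' *+ k' &
        r = modZ (((S^T *m M *m S') 0 0)%:~R / (k * k')%:R)].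

(* The Bosch-Lorenzini pairing. For symmetric M and torsion t, t' the value is
   the one characterised by BL_value (see BL_pairingP and BL_value_unique);
   it is the junk value 0 when t or t' is not torsion. *)
Definition BL_pairing n (M : 'M[int]_n) (t t' : cok M) : QZ :=
  xget 0 (BL_value t t').

Lemma dotE n (u v : 'cV[int]_n) : dot u v = (u^T *m v) 0 0.
Proof. by rewrite /dot mxE; apply: eq_bigr => i _; rewrite mxE. Qed.

Lemma dotC n (u v : 'cV[int]_n) : dot u v = dot v u.
Proof. by apply: eq_bigr => i _; rewrite mulrC. Qed.

Lemma dotDl n (u v w : 'cV[int]_n) : dot (u + v) w = dot u w + dot v w.
Proof. by rewrite -big_split; apply: eq_bigr => i _; rewrite mxE mulrDl. Qed.

Lemma dotMnl n (u v : 'cV[int]_n) k : dot (u *+ k) v = dot u v *+ k.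
Proof.
by elim: k => [|k IH]; [rewrite /dot big1 // => i _; rewrite mxE mul0r
                       | rewrite !mulrS dotDl IH].
Qed.

Lemma dot_sym n (M : 'M[int]_n) (u v : 'cV[int]_n) :
  M^T = M -> dot u (M *m v) = dot (M *m u) v.
Proof. by move=> sM; rewrite !dotE trmx_mul sM mulmxA. Qed.

Lemma pi_cok_eq n (M : 'M[int]_n) (u v : 'cV[int]_n) :
  \pi_(cok M) u = \pi_(cok M) v <-> exists w, u = v + M *m w.
Proof.
split=> [/eqP|[w ->]].
  rewrite -Quotient.idealrBE => /asboolP[w uv]; exists w.
  by rewrite -uv addrC subrK.
apply/eqP; rewrite -Quotient.idealrBE addrAC subrr add0r.
by apply/asboolP; exists w.
Qed.

Lemma modZ_eq (x y : rat) : x - y \is a Num.int -> modZ x = modZ y.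
Proof. by move=> xy; apply/eqP; rewrite /modZ -Quotient.idealrBE. Qed.

Lemma BL_value_exists n (M : 'M[int]_n) (t t' : cok M) (k k' : nat) :
  M^T = M -> (0 < k)%N -> (0 < k')%N -> t *+ k = 0 -> t' *+ k' = 0 ->
  exists r, BL_value t t' r.
Proof.
move=> sM k0 k'0 tk t'k'.
have lift (u : cok M) l : (0 < l)%N -> u *+ l = 0 ->
    exists T S, [/\ ker_perp M T, \pi_(cok M) T = u & M *m S = T *+ l].
  move=> l0 ul; pose T : 'cV[int]_n := repr u.
  have piT : \pi_(cok M) T = u by rewrite reprK.
  have : \pi_(cok M) (T *+ l) = \pi_(cok M) 0.
    rewrite [LHS]raddfMn [RHS]raddf0 -ul; congr (_ *+ _); exact: piT.
  case/pi_cok_eq => S; rewrite add0r => TS.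
  exists T, S; split=> // v Mv; apply/eqP.
  have: dot T v *+ l == 0.
    by rewrite -dotMnl TS -dot_sym // Mv dotC /dot big1 // => i _; rewrite mxE mul0r.
  by rewrite mulrn_eq0 eqn0Ngt l0.
have [T [S [? ? ?]]] := lift _ _ k0 tk.
have [T' [S' [? ? ?]]] := lift _ _ k'0 t'k'.
by eexists; exists T, T', S, S', k, k'; split.
Qed.

Lemma BL_value_unique n (M : 'M[int]_n) (t t' : cok M) (r1 r2 : QZ) :
  M^T = M -> BL_value t t' r1 -> BL_value t t' r2 -> r1 = r2.
Proof.
move=> sM [T1 [T1' [S1 [S1' [k1 [k1' [_ [e1 e1'] [p1 p1'] [E1 E1'] ->]]]]]]].
move=> [T2 [T2' [S2 [S2' [k2 [k2' [_ [e2 e2'] [p2 p2'] [E2 E2'] ->]]]]]]].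
have /pi_cok_eq[w Tw] : \pi_(cok M) T1 = \pi_(cok M) T2 by rewrite e1 e2.
have /pi_cok_eq[u Tu] : \pi_(cok M) T1' = \pi_(cok M) T2' by rewrite e1' e2'.
apply: modZ_eq; rewrite -!mulmxA -!dotE.
have nz (k : nat) : (0 < k)%N -> (k%:R : rat) != 0.
  by rewrite pnatr_eq0 -lt0n.
have cast (x : int) k : (x *+ k)%:~R = x%:~R * k%:R :> rat.
  by rewrite raddfMn /= mulr_natr.
have A : (dot S1 (M *m S1'))%:~R / (k1 * k1')%:R =
         (dot S1 T2')%:~R / k1%:R + (dot T1 u)%:~R :> rat.
  rewrite E1' dotC dotMnl Tu dotC dotC dotDl [dot (M *m u) _]dotC dot_sym //.
  rewrite E1 dotMnl [dot T2' _]dotC !cast intrD cast natrM.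
  by field; rewrite !nz.
have B : (dot S1 T2')%:~R / k1%:R = (dot T1 S2')%:~R / k2'%:R :> rat.
  apply/eqP; rewrite eqr_div ?nz //; apply/eqP.
  have := dot_sym S1 S2' sM.
  rewrite E2' E1 dotC !dotMnl [dot T2' _]dotC => /(congr1 (fun z : int => z%:~R : rat)).
  by rewrite !cast.
have C : (dot S2 (M *m S2'))%:~R / (k2 * k2')%:R = (dot T2 S2')%:~R / k2'%:R :> rat.
  rewrite dot_sym // E2 dotMnl cast natrM.
  by field; rewrite !nz.
have D : (dot T1 S2')%:~R / k2'%:R
         = (dot T2 S2')%:~R / k2'%:R + (dot w T2')%:~R :> rat.
  rewrite Tw dotDl -dot_sym // E2' [dot w (_ *+ _)]dotC dotMnl [dot T2' w]dotC.
  rewrite intrD cast.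
  by field; rewrite nz.
rewrite A B C D [X in X \is a _](_ : _ = (dot w T2' + dot T1 u)%:~R).
  exact: intr_int.
by rewrite intrD; ring.
Qed.

Lemma BL_pairingP n (M : 'M[int]_n) (t t' : cok M) (k k' : nat) :
  M^T = M -> (0 < k)%N -> (0 < k')%N -> t *+ k = 0 -> t' *+ k' = 0 ->
  BL_value t t' (BL_pairing t t').
Proof.
move=> sM k0 k'0 tk t'k'; have [r rP] := BL_value_exists sM k0 k'0 tk t'k'.
exact: xgetI rP.
Qed.

Definition sum_zero_pred n : {pred 'cV[int]_n} := fun v => \sum_i v i 0 == 0.

Lemma sum_zero_zmod_closed n : zmod_closed (@sum_zero_pred n).
Proof.
split=> [|u v /eqP u0 /eqP v0]; apply/eqP.
  by apply: big1 => i _; rewrite mxE.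
under eq_bigr do rewrite !mxE.
by rewrite sumrB u0 v0 subr0.
Qed.

HB.instance Definition _ n :=
  GRing.isZmodClosed.Build _ (@sum_zero_pred n) (@sum_zero_zmod_closed n).

Record sum_zero n := SumZero {
  sum_zero_val :> 'cV[int]_n;
  _ : sum_zero_val \in @sum_zero_pred n
}.

HB.instance Definition _ n := [isSub for @sum_zero_val n].
HB.instance Definition _ n := [Choice of sum_zero n by <:].
HB.instance Definition _ n := [SubChoice_isSubZmodule of sum_zero n by <:].

Definition edge n := {e : {set 'I_n} | #|e| == 2}.

Definition graph n := {set edge n}.

Definition adjacent n (E : graph n) (i j : 'I_n) : bool :=
  [exists e in E, val e == [set i; j]].

Definition degree n (E : graph n) (i : 'I_n) : nat := #|[set j | adjacent E i j]|.

Definition laplacian n (E : graph n) : 'M[int]_n :=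
  \matrix_(i, j) if i == j then - (degree E i)%:Z else (adjacent E i j)%:Z.

Lemma laplacian_sym n (E : graph n) : (laplacian E)^T = laplacian E.
Proof.
apply/matrixP => i j; rewrite !mxE eq_sym; case: eqP => [->//|_].
by rewrite /adjacent finset.setUC.
Qed.

Definition laplacian_image n (E : graph n) : {pred sum_zero n} :=
  fun z => sum_zero_val z \in col_image (laplacian E).

Lemma laplacian_image_zmod_closed n (E : graph n) :
  zmod_closed (laplacian_image E).
Proof.
split=> [|x y xL yL]; first exact: (rpred0 (col_image (laplacian E))).
exact: (rpredB (S := col_image (laplacian E)) xL yL).
Qed.

HB.instance Definition _ n (E : graph n) :=
  GRing.isZmodClosed.Build _ (laplacian_image E)
    (laplacian_image_zmod_closed E).

Definition sandpile n (E : graph n) : zmodType :=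
  Quotient.quot (laplacian_image E).

Definition sandpile_to_cok n (E : graph n) (s : sandpile E) :
    cok (laplacian E) :=
  \pi_(cok (laplacian E)) (sum_zero_val (repr s)).

Lemma sandpile_to_cokE n (E : graph n) (z : sum_zero n) :
  sandpile_to_cok (\pi_(sandpile E) z)
  = \pi_(cok (laplacian E)) (sum_zero_val z).
Proof.
apply/eqP; rewrite /sandpile_to_cok -Quotient.idealrBE.
have := reprK (\pi_(sandpile E) z) => /eqP.
by rewrite -Quotient.idealrBE.
Qed.

Lemma sandpile_to_cok_inj n (E : graph n) : injective (@sandpile_to_cok n E).
Proof.
move=> s s' /eqP; rewrite -Quotient.idealrBE => ss'.
rewrite -[s]reprK -[s']reprK; apply/eqP.
by rewrite -Quotient.idealrBE.
Qed.

(* The pairing on the torsion of Z / col L, through the identification of this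
   torsion with that of cok L. *)
Definition sandpile_pairing n (E : graph n) (s s' : sandpile E) : QZ :=
  BL_pairing (sandpile_to_cok s) (sandpile_to_cok s').

Definition sandpile_Sylow_pairing (p n : nat) (E : graph n)
    (s s' : Sylow_subgroup p (sandpile E)) : QZ :=
  sandpile_pairing (Sylow_val s) (Sylow_val s').

Definition ER_prob (R : realType) (n : nat) (q : R) (A : graph n -> Prop) : R :=
  \sum_(E : graph n | `[< A E >])
    \prod_(e : edge n) (if e \in E then q else 1 - q).

Lemma ER_prob_total (R : realType) n (q : R) :
  ER_prob q (fun _ : graph n => True) = 1.
Proof.
transitivity (\prod_(e : edge n) (q + (1 - q))).
  by rewrite bigA_distr; apply: eq_bigl => E; apply/asboolP.
by rewrite big1 // => e _; rewrite addrC subrK.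
Qed.

Lemma sandpile_prod_cvg (R : realType) (p : nat) : prime p ->
  cvgn (fun m : nat =>
    \prod_(1 <= k < m.+1) (1 - (p%:R : R) ^ (1 - 2 * k%:Z))).
Proof.
move=> p_pr.
have F01 (k : nat) : (0 < k)%N -> 0 <= 1 - (p%:R : R) ^ (1 - 2 * k%:Z) <= 1.
  case: k => // k _.
  have -> : 1 - 2 * k.+1%:Z = - (2 * k + 1)%N%:Z by lia.
  rewrite -invr_expz -exprnP subr_ge0 gerBl invr_ge0 exprn_ge0 // andbT.
  by rewrite invf_le1 ?exprn_gt0 ?exprn_ege1 // ?ler1n ?ltr0n prime_gt0.
have prod_ge0 m : 0 <= \prod_(1 <= k < m.+1) (1 - (p%:R : R) ^ (1 - 2 * k%:Z)).
  rewrite big_nat; apply: prodr_ge0 => k /andP[k0 _].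
  by case/andP: (F01 k k0).
apply: nonincreasing_is_cvgn; last by exists 0 => _ [m _ <-].
apply/nonincreasing_seqP => m.
rewrite [leLHS]big_nat_recr //=; exact: ler_piMr.
Qed.

(* Main.v *)
(* A surjection of the Sylow subgroup of the sandpile group onto G respecting
   the pairings is a function F from the vertices to G (up to constants) with
   F L = 0 that is a left inverse of its own adjoint b |-> T(b), where T(b) is
   the image under L of a rational lift of the character <b, F _>. Such
   "embeddings" split G off orthogonally, and F is an isomorphism exactly when
   the space U of the psi in F_p^n with psi L = 0 and psi T(b) = 0 for all b
   consists of constants; the graph then carries |G| |Aut(G)| such F. Put
   y = |U| / p.

   Counting F together with k vectors of U independent modulo constants
   computes the moments of prod_(i < k) (y - p^i). Lifting to Z/p^N, this is
   the number of matrices F with F L in a prescribed set. For fixed F the law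
   of F L is nearly uniform on its possible values, by a Fourier estimate that
   requires every nontrivial affine combination of the rows of F to have
   linearly many nonzero entries; the other F are harmless on the event, of
   probability tending to 1, that L kills no sparse vector modulo p^N. The
   k-th moment tends to p^(k(k-1)/2).

   The moments determine the expected number of F with y = 1 through the
   alternating sums over k of prod_(i < k) (y - p^i) / prod_(i <= k) (p^i - 1),
   whose truncations are 1 at y = 1 and of alternating sign for y > 1. The
   resulting series is evaluated by Euler's identities for q-products. *)

Require Import Defs.
From HB Require Import structures.
From mathcomp Require Import all_boot all_order all_fingroup all_algebra.
From mathcomp Require Import all_solvable.
From mathcomp Require Import all_field.
From mathcomp Require Import generic_quotient ring_quotient.
From mathcomp Require Import complex.
From mathcomp Require Import ring lra zify.
From mathcomp Require Import all_classical all_reals all_analysis.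

Set Implicit Arguments.
Unset Strict Implicit.
Unset Printing Implicit Defensive.

Import Order.TTheory GRing.Theory Num.Theory.
Import numFieldNormedType.Exports.

Local Open Scope ring_scope.
Import Defs.

(** * Fourier analysis of the Laplacian *)

(** For a fixed matrix [F] the Laplacian forces nothing on [F L] beyond the symmetry of [F L F^T]
    and [L 1 = 0]; the second relation is why the row of ones is adjoined to [F] throughout and only
    affine combinations matter. The obstacle is the sum over exponentially many [F]: those with a
    sparse combination of rows may contribute too much through rare graphs. Discarding the graphs
    that kill a sparse vector removes them but distorts the probabilities of the remaining [F]. A
    second, larger sparsity threshold controls this: above it the distortion is negligible, and
    below it there are few [F], so that crude bounds suffice. The moments grow like p^(k(k-1)/2),
    yet no limit is exchanged with an infinite sum: for each fixed length finitely many moments are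
    used, and two consecutive truncations bound the count from both sides. These bounds meet because
    p^(k(k-1)/2) / prod_(i <= k) (p^i - 1) equals p^(-k) / prod_(i <= k) (1 - p^(-i)). Finally,
    isomorphisms are detected by such [F] only on connected graphs, so disconnected graphs are shown
    to be negligible separately. *)

Definition graph_weight (T : comPzRingType) n (q : T) (E : graph n) : T :=
  \prod_(e : edge n) (if e \in E then q else 1 - q).

Lemma prod_edges (T : comPzRingType) n (h : {set 'I_n} -> T) :
  \prod_(e : edge n) h (val e) = \prod_(i < n) \prod_(j < n | (i < j)%N) h [set i; j].
Proof.
rewrite -(@big_sub _ _ _ _ (fun s : {set 'I_n} => #|s| == 2) h) /=.
rewrite pair_big_dep /=.
pose P := [set u : 'I_n * 'I_n | (u.1 < u.2)%N].
pose f (u : 'I_n * 'I_n) := [set u.1; u.2].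
transitivity (\prod_(s in f @: P) h s).
  apply: eq_bigl => s; apply/idP/imsetP => [/cards2P[x [y [xy ->]]]|[[i j]]].
    case: (ltngtP x y) => lt_xy.
    - by exists (x, y); rewrite ?inE.
    - by exists (y, x); rewrite ?inE // /f finset.setUC.
    - by rewrite (ord_inj lt_xy) eqxx in xy.
  rewrite inE /= => lt_ij ->; rewrite unfold_in /f /= cards2.
  by rewrite neq_ltn lt_ij.
rewrite big_imset /=; last first.
  move=> [i j] [i' j']; rewrite !inE /f /= => lt_ij lt_ij' eq_s.
  have : i \in [set i'; j'] by rewrite -eq_s !inE eqxx.
  have : j \in [set i'; j'] by rewrite -eq_s !inE eqxx orbT.
  rewrite !inE => /orP[]/eqP ej /orP[]/eqP ei; subst => //;
    by [rewrite ltnn in lt_ij | have := ltn_trans lt_ij lt_ij'; rewrite ltnn].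
by apply: eq_bigl => u; rewrite inE.
Qed.

Lemma sum_ordered_pairs (V : nmodType) n (f : 'I_n -> 'I_n -> V) :
  \sum_(i < n) \sum_(j < n) f i j =
  \sum_(i < n) f i i + \sum_(i < n) \sum_(j < n | (i < j)%N) (f i j + f j i).
Proof.
have -> : \sum_(i < n) \sum_(j < n) f i j = \sum_(i < n) (f i i +
    (\sum_(j < n | (i < j)%N) f i j + \sum_(j < n | (j < i)%N) f i j)).
  apply: eq_bigr => i _.
  rewrite (bigD1 i) //=; congr (_ + _).
  rewrite (bigID (fun j : 'I_n => (i < j)%N)) /=; congr (_ + _); apply: eq_bigl => j.
    by rewrite -val_eqE /=; lia.
  by rewrite -val_eqE /=; lia.
rewrite big_split /=; congr (_ + _).
rewrite big_split /= [X in _ + X](exchange_big_dep predT) //= -big_split /=.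
by apply: eq_bigr => i _; rewrite big_split.
Qed.

Lemma edge_in_adjacent n (E : graph n) (e : edge n) (i j : 'I_n) :
  val e = [set i; j] -> adjacent E i j = (e \in E).
Proof.
move=> eij; apply/existsP/idP => [[e' /andP[e'E /eqP e'ij]]|eE].
  by rewrite (_ : e = e') //; apply: val_inj; rewrite /= eij e'ij.
by exists e; rewrite eE eij eqxx.
Qed.

Lemma adjacentC n (E : graph n) i j : adjacent E i j = adjacent E j i.
Proof. by rewrite /adjacent finset.setUC. Qed.

Lemma adjacentii n (E : graph n) i : adjacent E i i = false.
Proof.
apply/existsP => -[e /andP[_ /eqP ei]].
by have := valP e; rewrite /= ei finset.setUid cards1.
Qed.

(** Independence of the edges: expanding the product on the right gives one term for each graph. *)
Lemma sum_graph_weight (T : comPzRingType) n (q : T) (h : 'I_n -> 'I_n -> bool -> T) :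
  \sum_(E : graph n) graph_weight q E *
     \prod_(i < n) \prod_(j < n | (i < j)%N) h i j (adjacent E i j) =
  \prod_(i < n) \prod_(j < n | (i < j)%N) (q * h i j true + (1 - q) * h i j false).
Proof.
(* [H g s] is [g i j] for the ordered pair i < j underlying [s]; written as a product over all such
   pairs, it needs no choice of endpoints. *)
pose H (g : 'I_n -> 'I_n -> T) (s : {set 'I_n}) : T :=
  \prod_(i < n) \prod_(j < n | (i < j)%N && ([set i; j] == s)) g i j.
have Hpair g (x y : 'I_n) : (x < y)%N -> H g [set x; y] = g x y.
  move=> lt_xy.
  have eqs (i' j' : 'I_n) :
      ((i' < j')%N && ([set i'; j'] == [set x; y])) = ((i' == x) && (j' == y)).
    apply/andP/andP => [[lt' /eqP es]|[/eqP-> /eqP->]]; last by split.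
    have : i' \in [set x; y] by rewrite -es !inE eqxx.
    have : j' \in [set x; y] by rewrite -es !inE eqxx orbT.
    have : x \in [set i'; j'] by rewrite es !inE eqxx.
    rewrite !inE => /orP[]/eqP e1 /orP[]/eqP e2 /orP[]/eqP e3; subst; rewrite ?eqxx //;
      by [rewrite ltnn in lt' | rewrite ltnn in lt_xy
         | have := ltn_trans lt' lt_xy; rewrite ltnn].
  rewrite /H (bigD1 x) //= [X in _ * X]big1 ?mulr1.
    by rewrite (big_pred1 y) // => j'; rewrite eqs eqxx.
  by move=> i' ne; rewrite big_pred0 // => j'; rewrite eqs (negPf ne).
have HE g : \prod_(i < n) \prod_(j < n | (i < j)%N) g i j = \prod_(e : edge n) H g (val e).
  by rewrite prod_edges; apply: eq_bigr => i _; apply: eq_bigr => j ij; rewrite Hpair.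
rewrite HE.
transitivity (\sum_(E : graph n) \prod_(e : edge n)
   (if e \in E then q * H (fun i j => h i j true) (val e)
    else (1 - q) * H (fun i j => h i j false) (val e))).
  apply: eq_bigr => E _; rewrite HE -big_split /=; apply: eq_bigr => e _.
  have -> : H (fun i j => h i j (adjacent E i j)) (val e) =
            H (fun i j => h i j (e \in E)) (val e).
    apply: eq_bigr => i _; apply: eq_bigr => j /andP[_ /eqP eij].
    by rewrite (@edge_in_adjacent _ _ e).
  by case: (e \in E).
rewrite -bigA_distr /=; apply: eq_bigr => -[s /= s2] _.
have /cards2P[x [y [xy ->]]] := s2.
case: (ltngtP x y) => lxy; first by rewrite !Hpair.
  by rewrite finset.setUC !Hpair.
by rewrite (ord_inj lxy) eqxx in xy.
Qed.

Lemma ER_probE (R : realType) n (q : R) (A : graph n -> Prop) :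
  ER_prob q A = \sum_(E : graph n | `[< A E >]) graph_weight q E.
Proof. by []. Qed.

Lemma graph_weight_ge0 (R : numDomainType) n (q : R) (E : graph n) :
  0 <= q -> q <= 1 -> 0 <= graph_weight q E.
Proof.
by move=> q0 q1; apply: prodr_ge0 => e _; case: ifP => // _; rewrite subr_ge0.
Qed.

Definition lapmx (A : pzRingType) n (E : graph n) : 'M[A]_n :=
  map_mx intr (laplacian E).

Lemma lapmx_sym (A : pzRingType) n (E : graph n) : (lapmx A E)^T = lapmx A E.
Proof. by rewrite /lapmx map_trmx laplacian_sym. Qed.

Lemma degreeE (A : pzRingType) n (E : graph n) i :
  (degree E i)%:~R = \sum_j (adjacent E i j)%:R :> A.
Proof.
rewrite -pmulrn /degree -sum1_card natr_sum [RHS](bigID (adjacent E i)) /=.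
rewrite [X in _ + X]big1 ?addr0 => [|j /negPf-> //].
by apply: eq_big => j; rewrite inE // => ->.
Qed.

(* [kap Z i j] is the coefficient of the edge [{i, j}] in [\tr (Z *m L)]. *)
Definition kap (A : zmodType) n (Z : 'M[A]_n) (i j : 'I_n) : A :=
  Z i j + Z j i - Z i i - Z j j.

(** The diagonal entries [- degree] spread over the incident edges, so the edge {i, j} collects two
    off-diagonal entries of [Z] minus two diagonal ones. *)
Lemma trace_lapmx (A : comPzRingType) n (Z : 'M[A]_n) (E : graph n) :
  \tr (Z *m lapmx A E) =
  \sum_(i < n) \sum_(j < n | (i < j)%N) kap Z i j *+ adjacent E i j.
Proof.
have -> : \tr (Z *m lapmx A E) = \sum_i \sum_j (Z i j - Z i i) *+ adjacent E i j.
  apply: eq_bigr => i _; rewrite !mxE.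
  under [RHS]eq_bigr do rewrite mulrnBl.
  rewrite sumrB (bigD1 i) //= [RHS]addrC [X in _ = _ + X](bigD1 i) //= adjacentii addrA.
  congr (_ + _).
    rewrite !mxE eqxx mulr0n addr0 /= mulrNz mulrN degreeE mulr_sumr; congr (- _).
    by apply: eq_bigr => j _; rewrite mulr_natr.
  apply: eq_bigr => j ne; rewrite !mxE (negPf ne) adjacentC.
  by rewrite /= -pmulrn mulr_natr.
rewrite sum_ordered_pairs big1 ?add0r => [|i _]; last by rewrite adjacentii.
apply: eq_bigr => i _; apply: eq_bigr => j _.
rewrite [adjacent E j i]adjacentC -mulrnDl /kap; congr (_ *+ _).
by rewrite addrACA addrA.
Qed.

Lemma const_lapmx (A : pzRingType) n m (a : 'cV[A]_m) (E : graph n) :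
  a *m const_mx (m := 1) 1 *m lapmx A E = 0.
Proof.
rewrite -mulmxA; suff -> : const_mx (m := 1) 1 *m lapmx A E = 0 by rewrite mulmx0.
apply/rowP => j; rewrite !mxE.
under eq_bigr do rewrite !mxE mul1r.
rewrite (bigD1 j) //= eqxx mulrNz degreeE.
rewrite [X in - X + _](bigD1 j) //= adjacentii add0r addrC; apply/eqP.
rewrite subr_eq0; apply/eqP; apply: eq_bigr => i ne.
by rewrite (negPf ne) adjacentC -pmulrn.
Qed.

Definition inj_rows (A : nzRingType) m n (F : 'M[A]_(m, n)) : Prop :=
  forall l : 'rV[A]_m, l *m F = 0 -> l = 0.

Definition augment (A : pzRingType) m n (F : 'M[A]_(m, n)) : 'M[A]_(m + 1, n) :=
  col_mx F (const_mx 1).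

Definition kap_support (A : zmodType) n (Z : 'M[A]_n) : nat :=
  #|[set u : 'I_n * 'I_n | kap Z u.1 u.2 != 0]|.

(* The possible values of [F *m L] for a Laplacian [L]. *)
Definition lap_range (A : finComNzRingType) m n (F : 'M[A]_(m, n)) :=
  [set c : 'M[A]_(m, n) | ((c *m F^T)^T == c *m F^T) &&
                          (c *m const_mx (n := 1) 1 == 0)].

(** The dual directions that see nothing of [F L]: their characters are constantly 1, and they
    supply the main term of the Fourier sum. Writing [U - U^T] forces a zero diagonal, also when 2
    is not invertible. *)
Definition special (A : finComNzRingType) m n (F : 'M[A]_(m, n)) : {pred 'M[A]_(n, m)} :=
  fun Y => [exists U : 'M[A]_m, exists k : 'rV[A]_m,
    Y == F^T *m (U - U^T) + const_mx (n := 1) 1 *m k].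

Lemma kapD (A : comNzRingType) n (Y Z : 'M[A]_n) i j :
  kap (Y + Z) i j = kap Y i j + kap Z i j.
Proof. by rewrite /kap !mxE; ring. Qed.

Lemma kapC (A : zmodType) n (Z : 'M[A]_n) i j : kap Z i j = kap Z j i.
Proof. by rewrite /kap [Z j i + _]addrC addrAC. Qed.

Lemma kapii (A : zmodType) n (Z : 'M[A]_n) i : kap Z i i = 0.
Proof. by rewrite /kap addrK subrr. Qed.

Lemma special_kap (A : finComNzRingType) m n (F : 'M[A]_(m, n)) Y :
  Y \in special F -> forall i j, kap (Y *m F) i j = 0.
Proof.
move=> /existsP[U /existsP[k /eqP->]] i j.
rewrite mulmxDl kapD.
have -> : F^T *m (U - U^T) *m F = (F^T *m U *m F) - (F^T *m U *m F)^T.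
  by rewrite !trmx_mul trmxK mulmxBr mulmxBl mulmxA.
have kW (W : 'M[A]_n) : kap (W - W^T) i j = 0 by rewrite /kap !mxE; ring.
have k1 (w : 'rV[A]_n) : kap (const_mx 1 *m w) i j = 0.
  by rewrite /kap !mxE !big_ord1 !mxE; ring.
by rewrite kW -mulmxA k1 addr0.
Qed.

Lemma special_sub (A : finComNzRingType) m n (F : 'M[A]_(m, n)) Y c :
  Y \in special F -> c \in lap_range F -> \tr (Y *m c) = 0.
Proof.
move=> /existsP[U /existsP[k /eqP->]]; rewrite inE => /andP[/eqP sc /eqP c1].
rewrite mulmxDl mxtraceD [X in _ + X]mxtrace_mulC mulmxA c1 mul0mx mxtrace0 addr0.
rewrite -mulmxA mxtrace_mulC -mulmxA mulmxBl raddfB /=.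
by rewrite -[X in _ - X]mxtrace_tr trmx_mul trmxK sc [X in _ - X]mxtrace_mulC subrr.
Qed.

Lemma lap_in_range (A : finComNzRingType) m n (F : 'M[A]_(m, n)) (E : graph n) :
  F *m lapmx A E \in lap_range F.
Proof.
rewrite inE; apply/andP; split; apply/eqP.
  by rewrite !trmx_mul trmxK lapmx_sym mulmxA.
have := const_lapmx (1%:M : 'cV[A]_1) E; rewrite mul1mx => /(congr1 trmx).
rewrite trmx_mul lapmx_sym trmx0 trmx_const -mulmxA => ->.
by rewrite mulmx0.
Qed.

(** [e] is a faithful additive character. The contraction is stated with [rho ^+ 2] because
    [kap_support] counts ordered pairs, hence every edge twice. *)
Definition fourier_setup (A : finComNzRingType) (R : realType) (e : A -> R[i])
    (q rho : R) : Prop :=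
  [/\ forall a b, e (a + b) = e a * e b,
      forall a, e a = 1 -> a = 0,
      forall a, `|e a| = 1,
      0 < q < 1 /\ 0 < rho < 1 &
      forall a, a != 0 -> `|q%:C%C * e a + (1 - q%:C%C)| <= (rho ^+ 2)%:C%C].

Lemma normr_real_complex (R : realType) (x : R) : `|x%:C%C| = `|x|%:C%C.
Proof.
by rewrite normc_def /= expr0n /= addr0 sqrtr_sqr.
Qed.

Section Fourier.
Variables (A : finComNzRingType) (R : realType) (e : A -> R[i]) (q rho : R).
Hypothesis fs : fourier_setup e q rho.

Let eD : forall a b, e (a + b) = e a * e b. Proof. by case: fs. Qed.
Let e_inj : forall a, e a = 1 -> a = 0. Proof. by case: fs. Qed.
Let e_norm : forall a, `|e a| = 1. Proof. by case: fs. Qed.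
Let q0 : 0 < q. Proof. by case: fs => _ _ _ [/andP[]]. Qed.
Let q1 : q < 1. Proof. by case: fs => _ _ _ [/andP[]]. Qed.
Let rho0 : 0 < rho. Proof. by case: fs => _ _ _ [_ /andP[]]. Qed.
Let rho1 : rho < 1. Proof. by case: fs => _ _ _ [_ /andP[]]. Qed.
Let e_rho : forall a, a != 0 ->
  `|q%:C%C * e a + (1 - q%:C%C)| <= (rho ^+ 2)%:C%C.
Proof. by case: fs. Qed.

Lemma char0 : e 0 = 1.
Proof.
have e00 : e 0 != 0 by rewrite -normr_eq0 e_norm oner_neq0.
by apply: (mulfI e00); rewrite -eD addr0 mulr1.
Qed.

Lemma char_sum (I : Type) (r : seq I) (P : pred I) (f : I -> A) :
  e (\sum_(i <- r | P i) f i) = \prod_(i <- r | P i) e (f i).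
Proof. exact: (big_morph e eD char0). Qed.

Lemma sum_char_mx m n (Y : 'M[A]_(m, n)) :
  \sum_(X : 'M[A]_(n, m)) e (\tr (Y *m X)) =
  if Y == 0 then (#|A| ^ (n * m))%:R else 0.
Proof.
case: eqVneq => [->|Y0].
  under eq_bigr do rewrite mul0mx mxtrace0 char0.
  by rewrite sumr_const card_mx.
have [i [j Yij]] : exists i j, Y i j != 0.
  exact/matrix0Pn.
set S := \sum_X _.
(* Translating [X] by a matrix unit multiplies the sum by [e (Y i j)], which is not 1 by
   faithfulness. *)
have : S = e (Y i j) * S.
  rewrite {1}/S (reindex_inj (addIr (delta_mx j i))) mulr_sumr /=.
  apply: eq_bigr => X _; rewrite mulmxDr mxtraceD mulrC eD; congr (_ * e _).
  rewrite -(mul_delta_mx (n := 1) 0) mulmxA mxtrace_mulC mulmxA -colE -rowE.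
  by rewrite /mxtrace big_ord1 !mxE.
move/eqP; rewrite -subr_eq0 -{1}[S]mul1r -mulrBl mulf_eq0 subr_eq0 => /orP[]/eqP //.
by move/esym/e_inj => Y0'; rewrite Y0' eqxx in Yij.
Qed.

(** Independence of the rows gives surjectivity with equal fibres because of the faithful character:
    a [Y] that survives orthogonality satisfies [Y F = 0], hence is zero. *)
Lemma card_fiber_mulmx r n m (F : 'M[A]_(r, n)) (B : 'M[A]_(r, m)) : inj_rows F ->
  (#|[set X : 'M[A]_(n, m) | F *m X == B]| * #|A| ^ (r * m) = #|A| ^ (n * m))%N.
Proof.
move=> injF; apply/eqP; rewrite -(eqr_nat R[i]) natrM; apply/eqP.
rewrite -sum1_card natr_sum mulr_suml.
transitivity (\sum_(X : 'M[A]_(n, m)) \sum_(Y : 'M[A]_(m, r)) e (\tr (Y *m (F *m X - B)))).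
  rewrite [RHS](bigID (fun X => F *m X == B)) /= [X in _ + X]big1 ?addr0.
    apply: eq_big => [X|X]; rewrite inE // => /eqP->.
    rewrite mul1r; under eq_bigr do rewrite subrr mulmx0 mxtrace0 char0.
    by rewrite sumr_const card_mx mulnC.
  move=> X neq; under eq_bigr do rewrite mxtrace_mulC.
  by rewrite sum_char_mx subr_eq0 (negPf neq).
rewrite exchange_big /= (bigD1 0) //= [X in _ + X]big1 ?addr0.
  under eq_bigr do rewrite mul0mx mxtrace0 char0.
  by rewrite sumr_const card_mx.
move=> Y Y0; under eq_bigr do rewrite mulmxBr raddfB /= eD mulmxA.
rewrite -mulr_suml sum_char_mx; case: eqP => [YF|]; last by rewrite mul0r.
case/eqP: Y0; apply/row_matrixP => i; rewrite row0; apply: injF.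
by rewrite -row_mul YF row0.
Qed.

Lemma exists_mulmx_eq r n m (F : 'M[A]_(r, n)) (B : 'M[A]_(r, m)) : inj_rows F ->
  exists X : 'M[A]_(n, m), F *m X = B.
Proof.
move=> injF; have := card_fiber_mulmx B injF.
case: (pickP (mem [set X : 'M[A]_(n, m) | F *m X == B])) => [X|none].
  by rewrite /= inE => /eqP; exists X.
move: (eq_card0 none) => ->; rewrite mul0n => /esym/eqP; rewrite expn_eq0.
by rewrite -leqn0 leqNgt => /andP[/negP[]]; apply/card_gt0P; exists 0.
Qed.

Lemma Ex_char n (Z : 'M[A]_n) :
  \sum_(E : graph n) (graph_weight q E)%:C%C * e (\tr (Z *m lapmx A E)) =
  \prod_(i < n) \prod_(j < n | (i < j)%N) (q%:C%C * e (kap Z i j) + (1 - q%:C%C)).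
Proof.
have := sum_graph_weight q%:C%C (fun i j b => if b then e (kap Z i j) else 1 : R[i]).
under [X in _ = X]eq_bigr do under eq_bigr do rewrite mulr1.
move=> <-; apply: eq_bigr => E _; congr (_ * _).
  rewrite /graph_weight rmorph_prod; apply: eq_bigr => d _.
  by case: ifP => // _; rewrite rmorphB rmorph1.
rewrite trace_lapmx char_sum; apply: eq_bigr => i _.
rewrite char_sum; apply: eq_bigr => j _.
by case: (adjacent E i j) => //; rewrite mulr0n char0.
Qed.

Lemma prod_pairs_norm n (b : 'I_n -> 'I_n -> bool) (f : 'I_n -> 'I_n -> R[i]) :
  (forall i j, b i j = b j i) -> (forall i, b i i = false) ->
  (forall i j, `|f i j| <= (if b i j then rho ^+ 2 else 1)%:C%C) ->
  `|\prod_(i < n) \prod_(j < n | (i < j)%N) f i j| <=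
  (rho ^+ #|[set u : 'I_n * 'I_n | b u.1 u.2]|)%:C%C.
Proof.
move=> bC bii fb.
have -> : (rho ^+ #|[set u : 'I_n * 'I_n | b u.1 u.2]|)%:C%C =
    \prod_(i < n) \prod_(j < n | (i < j)%N) (if b i j then rho ^+ 2 else 1)%:C%C.
  rewrite -[RHS]/(\prod_(i < n) \prod_(j < n | (i < j)%N) (real_complex_def (Phant R) (if b i j then rho ^+ 2 else 1))).
  have -> : #|[set u : 'I_n * 'I_n | b u.1 u.2]| =
      (\sum_(i < n) \sum_(j < n | (i < j)%N) 2 * b i j)%N.
    rewrite -sum1_card.
    transitivity (\sum_(i < n) \sum_(j < n) (b i j : nat))%N.
      rewrite pair_big /= big_mkcond /=; apply: eq_bigr => u _.
      by rewrite inE; case: (b _ _).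
    have := @sum_ordered_pairs nat n (fun i j => b i j : nat).
    rewrite /= => ->; rewrite [X in (X + _)%R]big1 ?add0r => [|i _]; last by rewrite bii.
    by apply: eq_bigr => i _; apply: eq_bigr => j _; rewrite [b j i]bC; lia.
  rewrite -prodrXr rmorph_prod /=; apply: eq_bigr => i _.
  rewrite -prodrXr rmorph_prod /=; apply: eq_bigr => j _.
  by case: (b i j).
rewrite normr_prod; apply: ler_prod => i _; rewrite normr_ge0 /= normr_prod.
by apply: ler_prod => j _; rewrite normr_ge0 fb.
Qed.

Lemma Ex_char_le n (Z : 'M[A]_n) :
  `|\sum_(E : graph n) (graph_weight q E)%:C%C * e (\tr (Z *m lapmx A E))| <=
  (rho ^+ kap_support Z)%:C%C.
Proof.
rewrite Ex_char; apply: (@prod_pairs_norm _ (fun i j => kap Z i j != 0)) => [i j|i|i j].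
- by rewrite kapC.
- by rewrite kapii eqxx.
case: eqVneq => [->|k0] /=; last exact: e_rho.
by rewrite char0 mulr1 addrC subrK normr1.
Qed.

Definition prob n (P : pred (graph n)) : R := \sum_(E : graph n | P E) graph_weight q E.

Lemma prob_ge0 n (P : pred (graph n)) : 0 <= prob P.
Proof. by apply: sumr_ge0 => E _; apply: graph_weight_ge0; apply: ltW. Qed.

(** Fourier inversion: averaging the characters of [F L - c] over all [Y] detects [F L = c]. *)
Lemma prob_lap_eq n m (F c : 'M[A]_(m, n)) :
  (prob (fun E => F *m lapmx A E == c))%:C%C * (#|A| ^ (n * m))%:R =
  \sum_(Y : 'M[A]_(n, m)) e (- \tr (Y *m c)) *
     \sum_(E : graph n) (graph_weight q E)%:C%C * e (\tr (Y *m F *m lapmx A E)).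
Proof.
under eq_bigr do rewrite mulr_sumr.
rewrite exchange_big /= rmorph_sum mulr_suml big_mkcond /=.
apply: eq_bigr => E _.
transitivity ((graph_weight q E)%:C%C * \sum_(Y : 'M[A]_(n, m)) e (\tr (Y *m (F *m lapmx A E - c)))).
  under [X in _ = _ * X]eq_bigr do rewrite mxtrace_mulC.
  by rewrite sum_char_mx subr_eq0; case: ifP; rewrite ?mulr0.
rewrite mulr_sumr; apply: eq_bigr => Y _.
by rewrite mulmxBr raddfB /= eD mulmxA mulrA mulrC.
Qed.

Lemma prob_lap_special n m (F c : 'M[A]_(m, n)) : c \in lap_range F ->
  `|prob (fun E => F *m lapmx A E == c) * (#|A| ^ (n * m))%:R
     - #|special F|%:R| <=
  \sum_(Y : 'M[A]_(n, m) | Y \notin special F) rho ^+ kap_support (Y *m F).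
Proof.
move=> cF; rewrite -lecR -normr_real_complex rmorphB rmorphM !rmorph_nat prob_lap_eq.
rewrite (bigID (mem (special F))) /= [X in X + _ - _](_ : _ = #|special F|%:R); last first.
  rewrite -sum1_card natr_sum; apply: eq_bigr => Y sY.
  rewrite (special_sub sY cF) oppr0 (char0) mul1r Ex_char.
  apply: big1 => i _; apply: big1 => j _.
  by rewrite special_kap // char0 mulr1 addrC subrK.
rewrite addrAC subrr add0r.
apply: (le_trans (ler_norm_sum _ _ _)); rewrite rmorph_sum; apply: ler_sum => Y _.
by rewrite normrM e_norm mul1r; exact: Ex_char_le.
Qed.

(** The dual variables are [Y] for the first condition and the column [w] for the second. [P] will
    discard the coordinates in the support of [v], which weakens the second condition and so only
    enlarges the event. *)
Lemma prob_lap_sparse n m (F c : 'M[A]_(m, n)) (v : 'rV[A]_n) (P : 'M[A]_n) :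
  prob (fun E => (F *m lapmx A E == c) && (v *m lapmx A E *m P == 0)) *
    (#|A| ^ (n * m))%:R * (#|A| ^ n)%:R <=
  \sum_(Y : 'M[A]_(n, m)) \sum_(w : 'cV[A]_n)
    rho ^+ kap_support (Y *m F + P *m w *m v).
Proof.
apply: (le_trans (ler_norm _)); rewrite -lecR -normr_real_complex.
have -> : (prob (fun E => (F *m lapmx A E == c) && (v *m lapmx A E *m P == 0)) *
    (#|A| ^ (n * m))%:R * (#|A| ^ n)%:R)%:C%C =
  \sum_(Y : 'M[A]_(n, m)) \sum_(w : 'cV[A]_n) e (- \tr (Y *m c)) *
     \sum_(E : graph n) (graph_weight q E)%:C%C *
         e (\tr ((Y *m F + P *m w *m v) *m lapmx A E)).
  under [RHS]eq_bigr do under eq_bigr do rewrite mulr_sumr.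
  under [RHS]eq_bigr do rewrite exchange_big /=.
  rewrite exchange_big /= !rmorphM !rmorph_nat rmorph_sum !mulr_suml big_mkcond /=.
  apply: eq_bigr => E _.
  transitivity ((graph_weight q E)%:C%C *
     (\sum_(Y : 'M[A]_(n, m)) e (\tr (Y *m (F *m lapmx A E - c)))) *
     (\sum_(w : 'cV[A]_n) e (\tr (v *m lapmx A E *m P *m w)))).
    under [X in _ = _ * X * _]eq_bigr do rewrite mxtrace_mulC.
    rewrite !sum_char_mx subr_eq0; case: eqP; case: eqP; rewrite /= ?mulr0 ?mul0r //.
    by rewrite muln1.
  rewrite -mulrA big_distrlr /= mulr_sumr; apply: eq_bigr => Y _.
  rewrite mulr_sumr; apply: eq_bigr => w _.
  have -> : \tr (v *m lapmx A E *m P *m w) = \tr (P *m w *m v *m lapmx A E).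
    by rewrite -mulmxA mxtrace_mulC mulmxA.
  rewrite mulmxDl mxtraceD mulmxBr raddfB /= mulmxA !eD.
  by rewrite [e _ * e (- _)]mulrC -mulrA mulrCA.
apply: (le_trans (ler_norm_sum _ _ _)); rewrite rmorph_sum; apply: ler_sum => Y _.
apply: (le_trans (ler_norm_sum _ _ _)); rewrite rmorph_sum; apply: ler_sum => w _.
by rewrite normrM e_norm mul1r; exact: Ex_char_le.
Qed.

End Fourier.

(** * Matrices with few nonzero edge coefficients are nearly special *)

Definition vsupport (A : zmodType) n (v : 'rV[A]_n) : {set 'I_n} :=
  [set i | v 0 i != 0].

Definition rsupport (A : zmodType) n m (Y : 'M[A]_(n, m)) : {set 'I_n} :=
  [set i | row i Y != 0].

(* The affine span of the columns of [F] is the whole module, robustly: no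
   nonzero affine function vanishes on all but [d] of them. *)
Definition code (A : finComNzRingType) d m n (F : 'M[A]_(m, n)) : bool :=
  [forall l : 'rV[A]_(m + 1), (l != 0) ==> (d < #|vsupport (l *m augment F)|)%N].

Lemma codeP (A : finComNzRingType) d m n (F : 'M[A]_(m, n)) (l : 'rV[A]_(m + 1)) :
  code d F -> l != 0 -> (d < #|vsupport (l *m augment F)|)%N.
Proof. by move=> /forallP/(_ l)/implyP. Qed.

Lemma code_inj_rows (A : finComNzRingType) d m n (F : 'M[A]_(m, n)) :
  code d F -> inj_rows (augment F).
Proof.
move=> cF l lF; apply/eqP; apply/negPn/negP => /(codeP cF); rewrite lF.
by rewrite (_ : vsupport _ = finset.set0) ?cards0 //; apply/setP => i; rewrite !inE mxE eqxx.
Qed.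

Lemma alternating_decomp (A : comNzRingType) n (X : 'M[A]_n) :
  (forall i, X i i = 0) -> (forall i j, X i j + X j i = 0) ->
  exists W : 'M[A]_n, X = W - W^T.
Proof.
move=> X0 XC; exists (\matrix_(i, j) if (i < j)%N then X i j else 0).
apply/matrixP => i j; rewrite !mxE.
case: (ltngtP i j) => ij; rewrite ?subr0 //.
  by rewrite sub0r; apply/eqP; rewrite -addr_eq0 XC.
by rewrite (ord_inj ij) X0.
Qed.

Section NearSpecial.
Variables (A : finComNzRingType) (R : realType) (e : A -> R[i]) (q rho : R).
Hypothesis fs : fourier_setup e q rho.
Variables (n m d g tau : nat) (F : 'M[A]_(m, n)) (Y : 'M[A]_(n, m)).
Hypothesis cF : code d F.
Local Notation B := (#|A| ^ (m + 1))%N.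
Hypothesis ltd : (g + B * tau <= d)%N.

Let Z := Y *m F.
Let bad i := [set j | kap Z i j != 0].
Let calm := [set i | (#|bad i| <= tau)%N].
Let ann (s : seq 'I_n) : {set 'rV[A]_(m + 1)} :=
  [set l | all (fun i => (l *m augment F) 0 i == 0) s].
Let bads (s : seq 'I_n) : {set 'I_n} := [set i | has (fun j => i \in bad j) s].
Let clique (s : seq 'I_n) :=
  all (mem calm) s /\ {in s &, forall i j, kap Z i j = 0}.

Lemma card_bads s : all (mem calm) s -> (#|bads s| <= size s * tau)%N.
Proof.
elim: s => [|i s IH] /=.
  by rewrite /bads (_ : [set _ | _] = finset.set0) ?cards0 //; apply/setP => j; rewrite !inE.
move=> /andP[ci cs]; rewrite mulSn.
have -> : bads (i :: s) = bad i :|: bads s.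
  by apply/setP => j; rewrite [in LHS]inE /= [in RHS]finset.in_setU [j \in bads s]inE.
apply: leq_trans (leq_card_setU _ _) _; apply: leq_add; last exact: IH.
by move: ci; rewrite inE.
Qed.

Lemma card_not_calm : (kap_support Z < g.+1 * tau.+1)%N -> (#|~: calm| <= g)%N.
Proof.
move=> lt_kap; rewrite -ltnS -(ltn_pmul2r (ltn0Sn tau)); apply: leq_ltn_trans lt_kap.
have -> : kap_support Z = (\sum_(i < n) #|bad i|)%N.
  rewrite /kap_support -sum1_card (eq_bigl (fun u : 'I_n * 'I_n => true && (u.2 \in bad u.1))).
    rewrite -(pair_big_dep predT (fun i j => j \in bad i) (fun _ _ => 1%N)) /=.
    by apply: eq_bigr => i _; rewrite sum1_card.
  by move=> u; rewrite !inE.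
rewrite (bigID (fun i => i \in ~: calm)) /= -sum_nat_const.
apply: leq_trans (leq_addr _ _); apply: leq_sum => i.
by rewrite !inE -ltnNge.
Qed.

(** Greedy choice: a nonzero [l] annihilating the columns chosen so far has more than [d] nonzero
    places by the code property, and [ltd] leaves one that is calm and outside all bad sets. Adding
    it shrinks [ann s] strictly, so [size s + #|ann s| <= B] persists. *)
Lemma exists_clique : (#|~: calm| <= g)%N ->
  exists s, [/\ clique s, ann s = [set 0] & (size s <= B)%N].
Proof.
move=> lecalm.
suff H k s : (#|ann s| <= k)%N -> clique s -> (size s + #|ann s| <= B)%N ->
    exists s, [/\ clique s, ann s = [set 0] & (size s <= B)%N].
  apply: (H _ [::] (leqnn _)) => //.
  by rewrite add0n; apply: leq_trans (max_card _) _; rewrite card_mx mul1n.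
elim: k s => [|k IH] s leann cls lesz.
  have : (0 : 'rV[A]_(m + 1)) \in ann s.
    by rewrite inE; apply/allP => i _; rewrite mul0mx mxE.
  by move: leann; rewrite leqn0 cards_eq0 => /eqP->; rewrite inE.
have [/existsP[l /andP[lann l0]]|/existsPn ann0] := boolP [exists l, (l \in ann s) && (l != 0)];
  last first.
  exists s; split=> //; last by apply: leq_trans (leq_addr _ _) lesz.
  apply/setP => l; rewrite [RHS]inE; apply/idP/eqP => [ls|->].
    by apply/eqP; have := ann0 l; rewrite ls /= negbK.
  by rewrite inE; apply/allP => i _; rewrite mul0mx mxE.
have [i ils] : exists i, i \in vsupport (l *m augment F) :\: (~: calm :|: bads s).
  apply/card_gt0P; rewrite cardsD subn_gt0.
  apply: leq_ltn_trans (codeP cF l0).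
  apply: leq_trans (subset_leq_card (subsetIr _ _)) _.
  apply: leq_trans (leq_card_setU _ _) _; apply: leq_trans ltd.
  apply: leq_add => //; case: cls => cs _; apply: leq_trans (card_bads cs) _.
  by rewrite leq_mul2r (leq_trans (leq_addr _ _) lesz) orbT.
move: ils; rewrite inE finset.in_setU negb_or finset.in_setC negbK => /andP[/andP[icalm ibad] isupp].
have kis j : j \in s -> kap Z j i = 0.
  move=> js; apply/eqP; apply/negPn/negP => kji; case/negP: ibad.
  by rewrite inE; apply/hasP; exists j => //; rewrite inE.
have lt_ann : (#|ann (i :: s)| < #|ann s|)%N.
  apply: proper_card; apply/properP; split.
    by apply/fintype.subsetP => l'; rewrite !inE /= => /andP[].
  exists l => //; rewrite inE /= negb_and; apply/orP; left.
  by move: isupp; rewrite inE.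
apply: (IH (i :: s)).
- by rewrite -ltnS; apply: leq_trans lt_ann leann.
- case: cls => cs ks; split; first by rewrite /= icalm.
  move=> a b; rewrite !inE => /orP[/eqP->|aS] /orP[/eqP->|bs].
  + by rewrite kapii.
  + by rewrite kapC kis.
  + by rewrite kis.
  + exact: ks.
- by apply: leq_trans lesz; rewrite /= addSnnS leq_add2l.
Qed.

Lemma clique_special s : clique s -> ann s = [set 0] ->
  exists2 Y0, Y0 \in special F & rsupport (Y - Y0) \subset bads s.
Proof.
move=> [_ cls] anns.
pose V := tnth (in_tuple s).
pose one k : 'rV[A]_k := const_mx 1.
have injV : inj_rows (colsub V (augment F)).
  move=> l lV; apply/eqP; have : l \in ann s.
    rewrite inE; apply/allP => i /(tnthP (in_tuple s))[t ->].
    by have /rowP/(_ t) := lV; rewrite !mxE => /eqP; apply: etrans; congr (_ == _);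
      apply: eq_bigr => a _; rewrite !mxE.
  by rewrite anns inE.
(* A right inverse [(Y1 Y2)] of the augmented clique columns: [FV Y1 = 1] and [FV Y2 = 0], while the
   row of ones gives 0 on [Y1] and 1 on [Y2]. *)
have [Yi FYi] := exists_mulmx_eq fs 1%:M injV.
pose FV := colsub V F; pose YV := rowsub V Y; pose ZV := YV *m FV.
have augV : colsub V (augment F) = col_mx FV (one _).
  by apply/matrixP => i j; rewrite !mxE; case: splitP => k _; rewrite !mxE.
pose Y1 := lsubmx Yi; pose Y2 := rsubmx Yi.
have := FYi; rewrite augV -[Yi]hsubmxK -/Y1 -/Y2 mul_col_row.
rewrite scalar_mx_block => /eq_block_mx[FY1 FY2 oY1 oY2].
pose h : 'cV[A]_(size s) := \col_t ZV t t.
have ZVE t u : ZV t u = Z (V t) (V u).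
  by rewrite !mxE; apply: eq_bigr => a _; rewrite !mxE.
have kV t u : kap Z (V t) (V u) = 0.
  by apply: cls; rewrite mem_tnth.
have hone t u : (h *m one _) t u = ZV t t.
  by rewrite mxE big_ord1 [h _ _]mxE [one _ _ _]mxE mulr1.
(* Vanishing of [kap] on the clique says that [ZV] is alternating up to the rank-one term
   [h *m one], where [h] is its diagonal. *)
have ZVT : ZV = h *m one _ + (h *m one _)^T - ZV^T.
  apply/matrixP => t u; have := kV t u; rewrite /kap -!ZVE => k0.
  rewrite [RHS]mxE [X in _ = X + _]mxE [(- ZV^T) t u]mxE [ZV^T t u]mxE.
  rewrite [((h *m one _)^T) t u]mxE !hone.
  by apply/eqP; rewrite -subr_eq0 -[X in _ == X]k0; apply/eqP; ring.
have [W XW] : exists W, ZV - h *m one _ = W - W^T.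
  apply: alternating_decomp => [t|t u].
    by rewrite [LHS]mxE [(- (h *m one _)) _ _]mxE hone subrr.
  have := kV t u; rewrite /kap -!ZVE => k0; rewrite -[RHS]k0.
  rewrite [(ZV - _) t u]mxE [(ZV - _) u t]mxE ![(- (h *m one _)) _ _]mxE.
  rewrite !hone.
  by ring.
(* This makes [U - U^T = Y1^T YV], so the special matrix has row [z^T YV] at [j], where [z]
   expresses the augmented column [j] through clique columns. *)
pose U := Y1^T *m W *m Y1; pose k := Y2^T *m YV.
exists (F^T *m (U - U^T) + const_mx 1 *m k).
  by apply/existsP; exists U; apply/existsP; exists k.
have Ueq : U - U^T = Y1^T *m YV.
  rewrite /U !trmx_mul trmxK -mulmxA -mulmxBr -mulmxBl -XW mulmxBl.
  by rewrite -[h *m _ *m _]mulmxA oY1 mulmx0 subr0 -[ZV *m _]mulmxA FY1 mulmx1.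
apply/fintype.subsetP => j; rewrite !inE => /eqP ne; apply/negPn/negP => nb; apply: ne.
have kj t : kap Z (V t) j = 0.
  apply/eqP; apply/negPn/negP => kj; case/negP: nb; apply/hasP; exists (V t).
    exact: mem_tnth.
  by rewrite inE.
pose z := Y1 *m col j F + Y2.
have Fz : FV *m z = col j F by rewrite mulmxDr mulmxA FY1 mul1mx FY2 addr0.
have oz : one _ *m z = 1%:M by rewrite mulmxDr mulmxA oY1 mul0mx add0r oY2.
have rowY0 : row j (F^T *m (U - U^T) + const_mx 1 *m k) = z^T *m YV.
  rewrite Ueq linearD /= !row_mul row_const -tr_col /k /z.
  rewrite linearD /= mulmxDl trmx_mul !mulmxA; congr (_ + _).
  by rewrite (_ : const_mx 1 = 1%:M) ?mul1mx //; apply/matrixP => a b; rewrite !mxE !ord1.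
rewrite linearB /= rowY0.
(* Vanishing of [kap] between [j] and the clique makes [D FV] a constant [c]; then [(D, -c)]
   annihilates the augmented clique columns and is zero. *)
pose D := row j Y - z^T *m YV.
have [c Dc] : exists c : 'M[A]_1, D *m FV = c *m one _.
  have r1 : row j Y *m FV = (Z j j)%:M *m one _ + h^T - (YV *m col j F)^T.
    apply/rowP => t; have := kj t; rewrite /kap => k0.
    have -> : (row j Y *m FV) 0 t = Z j (V t).
      by rewrite !mxE; apply: eq_bigr => a _; rewrite !mxE.
    rewrite [RHS]mxE [(_ + h^T) 0 t]mxE [(- (YV *m col j F)^T) 0 t]mxE
      [(YV *m col j F)^T 0 t]mxE [h^T 0 t]mxE.
    have -> : (YV *m col j F) t 0 = Z (V t) j.
      by rewrite !mxE; apply: eq_bigr => a _; rewrite !mxE.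
    rewrite [((Z j j)%:M *m _) _ _]mxE big_ord1 [(one _) _ _]mxE mulr1 [_%:M _ _]mxE eqxx mulr1n.
    rewrite [h _ _]mxE ZVE.
    by apply/eqP; rewrite -subr_eq0 -[X in _ == X]k0; apply/eqP; ring.
  have r2 : z^T *m YV *m FV = (z^T *m h) *m one _ + h^T - (YV *m col j F)^T.
    rewrite -mulmxA -/ZV ZVT mulmxBr mulmxDr mulmxA; congr (_ + _ - _).
      by rewrite -trmx_mul -mulmxA oz mulmx1.
    by rewrite -trmx_mul -mulmxA Fz.
  exists ((Z j j)%:M - z^T *m h).
  rewrite mulmxBl r1 r2 mulmxBl.
  have gen (a b c d' : 'rV[A]_(size s)) : a + b - c - (d' + b - c) = a - d'.
    by rewrite -[a + b - c]addrA -[d' + b - c]addrA opprD addrACA subrr addr0.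
  exact: gen.
have : row_mx D (- c) *m colsub V (augment F) = 0.
  by rewrite augV mul_row_col mulNmx Dc subrr.
by move/injV; rewrite -row_mx0 => /eq_row_mx[].
Qed.

(** If few [kap] are nonzero, most vertices are calm. Calm vertices with mutually vanishing [kap]
    are collected until their columns have no common affine annihilator; outside their few bad
    neighbours the rows of [Y] must then agree with those of a special matrix. *)
Lemma near_special :
  (g.+1 * tau.+1 <= kap_support Z)%N \/
  exists2 Y0, Y0 \in special F & (#|rsupport (Y - Y0)| <= B * tau)%N.
Proof.
have [le|lt] := leqP (g.+1 * tau.+1) (kap_support Z); [by left | right].
have [s [cls anns szs]] := exists_clique (card_not_calm lt).
have [Y0 sY0 sub] := clique_special cls anns; exists Y0 => //.
apply: leq_trans (subset_leq_card sub) _; case: cls => cs _.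
by apply: leq_trans (card_bads cs) _; rewrite leq_mul2r szs orbT.
Qed.

End NearSpecial.

Lemma sum_prod_rows (T : comPzRingType) (A : finComNzRingType) n m
    (h : 'I_n -> 'rV[A]_m -> T) :
  \sum_(Y : 'M[A]_(n, m)) \prod_(i < n) h i (row i Y) =
  \prod_(i < n) \sum_(y : 'rV[A]_m) h i y.
Proof.
rewrite bigA_distr_bigA /=.
rewrite (reindex (fun f : {ffun 'I_n -> 'rV[A]_m} => \matrix_(i < n) f i)) /=.
  by apply: eq_bigr => f _; apply: eq_bigr => i _; rewrite rowK.
exists (fun Y => [ffun i => row i Y]) => [f _|Y _].
  by apply/ffunP => i; rewrite ffunE rowK.
by apply/row_matrixP => i; rewrite rowK ffunE.
Qed.

Definition sparse_card (A : finComNzRingType) n m t : nat :=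
  #|[set Y : 'M[A]_(n, m) | (#|rsupport Y| <= t)%N]|.

(** Markov's inequality: weigh a matrix by [z] to the number of its nonzero rows; the total weight
    factors over the rows. *)
Lemma sparse_card_le (R : realType) (A : finComNzRingType) n m t (z : R) :
  0 < z -> z <= 1 ->
  z ^+ t * (sparse_card A n m t)%:R <= (1 + (#|A| ^ m)%:R * z) ^+ n.
Proof.
move=> z0 z1.
have -> : (1 + (#|A| ^ m)%:R * z) ^+ n = \prod_(i < n) (1 + (#|A| ^ m)%:R * z).
  by rewrite prodr_const card_ord.
apply: (@le_trans _ _ (\prod_(i < n) \sum_(y : 'rV[A]_m) (if y == 0 then 1 else z))).
  rewrite -(sum_prod_rows (fun i y => if y == 0 then 1 else z)).
  rewrite [leRHS](bigID (mem [set Y : 'M[A]_(n, m) | (#|rsupport Y| <= t)%N])) /=.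
  rewrite -[leLHS]addr0; apply: lerD; last first.
    by apply: sumr_ge0 => Y _; apply: prodr_ge0 => i _; case: ifP => // _; apply: ltW.
  rewrite /sparse_card -sum1_card natr_sum mulr_sumr; apply: ler_sum => Y.
  rewrite inE mulr1 => sY.
  have -> : \prod_(i < n) (if row i Y == 0 then 1 else z) = z ^+ #|rsupport Y|.
    rewrite -prodr_const [RHS]big_mkcond /=; apply: eq_bigr => i _.
    by rewrite inE; case: eqP.
  by apply: ler_wiXn2l => //; apply: ltW.
apply: ler_prod => i _; apply/andP; split.
  by apply: sumr_ge0 => y _; case: ifP => // _; apply: ltW.
rewrite (bigD1 0) //= eqxx lerD2l.
apply: (@le_trans _ _ (\sum_(y : 'rV[A]_m) z)).
  rewrite [leRHS](bigD1 0) //= -[leLHS]add0r; apply: lerD; first exact: ltW.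
  by apply: ler_sum => y /negPf ->.
by rewrite sumr_const card_mx mul1n mulr_natl.
Qed.

Lemma card_half (T : finZmodType) (S : {set T}) (x : T) :
  (forall y, y \in S -> y + x \notin S) -> (2 * #|S| <= #|T|)%N.
Proof.
move=> H; rewrite mul2n -addnn -[X in (X + _)%N](card_imset S (addIr x)).
rewrite -cardsUI [X in (_ + X)%N](_ : _ = 0%N) ?addn0 ?max_card //.
apply/eqP; rewrite cards_eq0; apply/eqP/setP => y; rewrite !inE.
by apply/negP => /andP[/imsetP[u uS ->]]; apply/negP/H.
Qed.

Section Estimates.
Variables (A : finComNzRingType) (R : realType) (e : A -> R[i]) (q rho : R).
Hypothesis fs : fourier_setup e q rho.
Variables (n m : nat).
Implicit Types (F c : 'M[A]_(m, n)) (Y : 'M[A]_(n, m)) (d tau t : nat).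
Local Notation a := #|A|.
Local Notation B := (a ^ (m + 1))%N.

Let rho0 : 0 < rho. Proof. by case: fs => _ _ _ [_ /andP[]]. Qed.
Let rho1 : rho < 1. Proof. by case: fs => _ _ _ [_ /andP[]]. Qed.
Let rho_ge0 := ltW rho0.
Let rho_le1 := ltW rho1.

Let a_gt0 : (0 < a)%N. Proof. by apply/card_gt0P; exists 0. Qed.

Lemma row_mul_entry F Y i j : (Y *m F) i j = (row i Y *m F) 0 j.
Proof. by rewrite -row_mul [RHS]mxE. Qed.

(** Subtracting [Y0] does not change [kap]. A nonzero row [i0] of the difference gives a nonzero
    affine function of the columns of [F], nonzero at more than [d] columns; at a column [j] whose
    own row vanishes, its value is [kap i0 j], and at most [t] columns are lost. *)
Lemma nonspecial_near F d t Y Y0 : code d F -> Y \notin special F ->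
  Y0 \in special F -> (#|rsupport (Y - Y0)| <= t)%N ->
  (d - t <= kap_support (Y *m F))%N.
Proof.
move=> cF nsY sY0 sup.
pose Y' := Y - Y0.
have kE i j : kap (Y *m F) i j = kap (Y' *m F) i j.
  by rewrite -[Y](subrK Y0) -/Y' mulmxDl kapD (special_kap sY0) addr0.
have [i0 ni0] : exists i0, row i0 Y' != 0.
  apply/existsP; rewrite -negb_forall; apply/negP => /forallP all0.
  case/negP: nsY; rewrite (_ : Y = Y0) //; apply/eqP; rewrite -subr_eq0; apply/eqP/row_matrixP => i.
  by rewrite row0; apply/eqP; rewrite all0.
pose l : 'rV[A]_(m + 1) := row_mx (row i0 Y') (- (Y' *m F) i0 i0)%:M.
have l0 : l != 0.
  by apply/eqP; rewrite /l -row_mx0 => /eq_row_mx[/eqP]; rewrite (negPf ni0).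
have := codeP cF l0; set V := vsupport _ => ltV.
apply: (@leq_trans #|V :\: rsupport Y'|).
  rewrite cardsD.
  have := leq_trans (subset_leq_card (subsetIr V (rsupport Y'))) sup.
  by move: ltV; lia.
rewrite -(card_imset (mem (V :\: rsupport Y')) (f := fun j => (i0, j))); last by move=> j j' [].
apply: subset_leq_card; apply/fintype.subsetP => u /imsetP[j jV ->].
move: jV; rewrite !inE /= kE negbK => /andP[/eqP rj0 lj].
have zj k : (Y' *m F) j k = 0 by rewrite row_mul_entry rj0 mul0mx mxE.
rewrite /kap !zj addr0 subr0.
move: lj; rewrite /l /augment mul_row_col !mxE big_ord1 !mxE mulr1 eqxx mulr1n.
have -> : \sum_(k < m) row i0 Y' 0 k * F k j = \sum_(k < m) Y' i0 k * F k j.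
  by apply: eq_bigr => k _; rewrite mxE.
by [].
Qed.

Lemma card_special F : (#|special F| <= a ^ (m * m + m))%N.
Proof.
have -> : #|special F| = #|[set Y | Y \in special F]| by rewrite cardsE.
apply: (@leq_trans #|(fun u : 'M[A]_m * 'rV[A]_m =>
   F^T *m (u.1 - u.1^T) + const_mx (n := 1) 1 *m u.2) @: [set: 'M[A]_m * 'rV[A]_m]|).
  apply: subset_leq_card; apply/fintype.subsetP => Y; rewrite inE.
  move=> /existsP[U /existsP[k /eqP->]]; apply/imsetP; by exists (U, k); rewrite ?inE.
apply: leq_trans (leq_imset_card _ _) _.
by rewrite cardsT card_prod !card_mx mul1n -expnD.
Qed.

Definition near_bound d tau : R :=
  (a ^ (n * m))%:R * rho ^+ ((d - B * tau).+1 * tau.+1).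

Lemma exp_le (x y : nat) : (x <= y)%N -> rho ^+ y <= rho ^+ x.
Proof. by move=> xy; apply: ler_wiXn2l. Qed.

Lemma sum_near_special F t : \sum_(Y : 'M[A]_(n, m))
    \sum_(Y0 | Y0 \in special F) ((#|rsupport (Y - Y0)| <= t)%N)%:R
  <= (a ^ (m * m + m))%:R * (sparse_card A n m t)%:R :> R.
Proof.
rewrite exchange_big /=.
have -> : \sum_(Y0 | Y0 \in special F) \sum_(Y : 'M[A]_(n, m))
     ((#|rsupport (Y - Y0)| <= t)%N)%:R = \sum_(Y0 | Y0 \in special F) (sparse_card A n m t)%:R :> R.
  apply: eq_bigr => Y0 _; rewrite (reindex_inj (addIr Y0)) /=.
  under eq_bigr do rewrite addrK.
  rewrite -natr_sum /sparse_card -sum1_card [in RHS]big_mkcond /=; congr (_%:R).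
  by apply: eq_bigr => Y _; rewrite inE; case: leqP.
by rewrite sumr_const -[leLHS]mulr_natl ler_wpM2r // ler_nat card_special.
Qed.

(** Either [Y] has so many nonzero coefficients that the exponent beats the number of all matrices,
    or it is close to a special matrix; the latter are few and still have at least [d - B * tau]
    nonzero coefficients. *)
Lemma nonspecial_sum F d tau : code d F -> (B * tau <= d)%N ->
  \sum_(Y | Y \notin special F) rho ^+ kap_support (Y *m F) <=
  near_bound d tau +
  (a ^ (m * m + m))%:R * (sparse_card A n m (B * tau))%:R * rho ^+ (d - B * tau).
Proof.
move=> cF le_d.
apply: (@le_trans _ _ (\sum_(Y : 'M[A]_(n, m)) (rho ^+ ((d - B * tau).+1 * tau.+1) +
   (\sum_(Y0 | Y0 \in special F) ((#|rsupport (Y - Y0)| <= B * tau)%N)%:R) * rho ^+ (d - B * tau)))).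
  rewrite big_mkcond /=; apply: ler_sum => Y _.
  have s0 : 0 <= \sum_(Y0 | Y0 \in special F) ((#|rsupport (Y - Y0)| <= B * tau)%N)%:R :> R.
    by apply: sumr_ge0.
  have [nsY|_] := ifP; last first.
    by rewrite addr_ge0 ?exprn_ge0 // mulr_ge0 // exprn_ge0.
  have := @near_special _ _ _ _ _ fs n m d (d - B * tau) tau F Y cF.
  rewrite subnK // => /(_ (leqnn _)) [big|[Y0 sY0 near]].
    by rewrite ler_wpDr ?exp_le // mulr_ge0 // exprn_ge0.
  rewrite ler_wpDl ?exprn_ge0 //.
  apply: (@le_trans _ _ (rho ^+ (d - B * tau))).
    by apply: exp_le; apply: (nonspecial_near cF nsY sY0 near).
  rewrite ler_peMl ?exprn_ge0 // (bigD1 Y0) //= near lerDl.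
  by apply: sumr_ge0.
rewrite big_split /= sumr_const card_mx -[X in X + _]mulr_natl lerD2l.
rewrite -mulr_suml ler_wpM2r ?exprn_ge0 //; exact: sum_near_special.
Qed.

(** Special [Y] are included here, and [t] coefficients are given away: they will be the pairs that
    touch the support of a sparse vector. *)
Lemma shifted_sum F d tau t : code d F -> (B * tau <= d)%N ->
  \sum_Y rho ^+ (kap_support (Y *m F) - t) <=
  (a ^ (n * m))%:R * rho ^+ ((d - B * tau).+1 * tau.+1 - t) +
  (a ^ (m * m + m))%:R * (sparse_card A n m (B * tau))%:R.
Proof.
move=> cF le_d.
apply: (@le_trans _ _ (\sum_(Y : 'M[A]_(n, m)) (rho ^+ ((d - B * tau).+1 * tau.+1 - t) +
   \sum_(Y0 | Y0 \in special F) ((#|rsupport (Y - Y0)| <= B * tau)%N)%:R))).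
  apply: ler_sum => Y _.
  have s0 : 0 <= \sum_(Y0 | Y0 \in special F) ((#|rsupport (Y - Y0)| <= B * tau)%N)%:R :> R.
    by apply: sumr_ge0.
  have := @near_special _ _ _ _ _ fs n m d (d - B * tau) tau F Y cF.
  rewrite subnK // => /(_ (leqnn _)) [big|[Y0 sY0 near]].
    by rewrite ler_wpDr // exp_le // leq_sub2r.
  rewrite ler_wpDl ?exprn_ge0 //.
  apply: (@le_trans _ _ 1); first by apply: exprn_ile1.
  rewrite (bigD1 Y0) //= near lerDl.
  by apply: sumr_ge0.
rewrite big_split /= sumr_const card_mx -[X in X + _]mulr_natl lerD2l.
exact: sum_near_special.
Qed.

(** Projection onto the coordinates outside [V], the support of [v]. With it, [P w v] does not
    affect [kap] on pairs outside [V], and for [i0] in [V] and [j] outside it changes [kap i0 j] by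
    [w j * v i0] alone. *)
Definition off_diag (V : {set 'I_n}) : 'M[A]_n := diag_mx (\row_j (j \notin V)%:R).

Lemma kap_sparse_ge F Y (v : 'rV[A]_n) (w : 'cV[A]_n) i0 :
  v 0 i0 != 0 ->
  (kap_support (Y *m F) - 2 * n * #|vsupport v| +
   #|[set j | (j \notin vsupport v) && ((kap (Y *m F) i0 j + w j 0 * v 0 i0)%R != 0%R)]|
   <= kap_support (Y *m F + off_diag (vsupport v) *m w *m v))%N.
Proof.
move=> v0; set V := vsupport v; set Z := Y *m F; set P := off_diag V.
have Pw j : (P *m w) j 0 = (j \notin V)%:R * w j 0.
  rewrite mul_diag_mx mxE [(\row__ _) _ _]mxE //.
have Pwv i j : (P *m w *m v) i j = (i \notin V)%:R * w i 0 * v 0 j.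
  by rewrite mxE big_ord1 Pw.
have vj j : j \notin V -> v 0 j = 0 by rewrite inE negbK => /eqP.
pose T1 := [set u : 'I_n * 'I_n | [&& kap Z u.1 u.2 != 0, u.1 \notin V & u.2 \notin V]].
pose T2 := [set (i0, j) | j in [set j | (j \notin V) && (kap Z i0 j + w j 0 * v 0 i0 != 0)]].
have i0V : i0 \in V by rewrite inE.
have T12 : T1 :&: T2 = finset.set0.
  apply/setP => u; rewrite !inE; apply/negP => /andP[/and3P[_ u1 _] /imsetP[j _ uE]].
  by move: u1; rewrite uE /= v0.
have -> : #|[set j | (j \notin V) && (kap Z i0 j + w j 0 * v 0 i0 != 0)]| = #|T2|.
  by rewrite card_imset // => j j' [].
apply: (@leq_trans (#|T1| + #|T2|)).
  rewrite leq_add2r leq_subLR.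
  have -> : (2 * n * #|V| = #|finset.setX V [set: 'I_n]| + #|finset.setX [set: 'I_n] V|)%N.
    by rewrite !cardsX cardsT card_ord; lia.
  rewrite -addnA [X in (_ <= _ + X)%N]addnC addnA.
  apply: leq_trans (leq_add (leq_card_setU _ _) (leqnn _)).
  rewrite [X in (_ <= X)%N]addnC.
  apply: leq_trans (leq_card_setU _ _).
  apply: subset_leq_card; apply/fintype.subsetP => u.
  by rewrite !inE /= => ->; rewrite andbT /=; case: (v 0 u.1 == 0); case: (v 0 u.2 == 0).
rewrite -cardsUI T12 cards0 addn0.
apply: subset_leq_card; apply/fintype.subsetP => u; rewrite finset.in_setU => /orP[].
  rewrite [u \in T1]inE => /and3P[kz u1 u2]; rewrite inE kapD.
  by rewrite {2}/kap !Pwv !vj // !mulr0 !subr0 !addr0.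
move=> /imsetP[j]; rewrite inE => /andP[jV kj] ->; rewrite inE /= kapD.
by rewrite {2}/kap !Pwv i0V jV (vj j) // !mul0r !mulr0 add0r mul1r !subr0.
Qed.

(** Each coordinate [w j] outside the support enters the bound only through [kap i0 j + w j * v i0],
    nonzero for at least half of its values; averaging gives a factor at most [(1 + rho) / 2] per
    coordinate. *)
Lemma sum_sparse_char F Y (v : 'rV[A]_n) i0 : v 0 i0 != 0 ->
  \sum_(w : 'cV[A]_n) rho ^+ kap_support (Y *m F + off_diag (vsupport v) *m w *m v)
  <= rho ^+ (kap_support (Y *m F) - 2 * n * #|vsupport v|) *
     ((a ^ n)%:R * ((1 + rho) / 2) ^+ (n - #|vsupport v|)).
Proof.
move=> v0; set V := vsupport v; set Z := Y *m F.
apply: (@le_trans _ _ (\sum_(w : 'cV[A]_n) rho ^+ (kap_support Z - 2 * n * #|V|) *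
   \prod_(j < n) (if (j \notin V) && (kap Z i0 j + row j w 0 0 * v 0 i0 != 0) then rho else 1))).
  apply: ler_sum => w _.
  rewrite -big_mkcond /= prodr_const -exprD; apply: exp_le.
  apply: leq_trans (kap_sparse_ge _ _ _ v0); rewrite leq_add2l.
  by apply: eq_leq; apply: eq_card => j; rewrite [RHS]inE -topredE /= mxE.
rewrite -mulr_sumr ler_wpM2l ?exprn_ge0 //.
rewrite (sum_prod_rows (fun j (y : 'rV[A]_1) =>
   if (j \notin V) && (kap Z i0 j + y 0 0 * v 0 i0 != 0) then rho else 1)).
have -> : (a ^ n)%:R * ((1 + rho) / 2) ^+ (n - #|V|) =
   \prod_(j < n) (a%:R * (if j \in V then 1 else (1 + rho) / 2)) :> R.
  rewrite big_split /= prodr_const card_ord natrX; congr (_ * _).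
  rewrite (bigID (mem V)) /= big1 ?mul1r => [|j ->//].
  rewrite (eq_bigr (fun _ => (1 + rho) / 2)) => [|j /negPf -> //].
  rewrite prodr_const; congr (_ ^+ _).
  have := cardC V; rewrite card_ord (eq_card (B := fun i : 'I_n => i \notin V)) //.
  by move=> nV; apply/eqP; rewrite -(eqn_add2l #|V|) subnKC ?nV // -[X in (_ <= X)%N]nV leq_addr.
apply: ler_prod => j _; apply/andP; split.
  by apply: sumr_ge0 => y _; case: ifP.
case: (boolP (j \in V)) => jV /=.
  by rewrite sumr_const card_mx mulr1 muln1 expn1.
pose S := [set y : 'rV[A]_1 | kap Z i0 j + y 0 0 * v 0 i0 == 0].
have leS : (2 * #|S| <= a)%N.
  have -> : a = #|{: 'rV[A]_1}| by rewrite card_mx.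
  apply: (@card_half _ S (const_mx 1)) => y; rewrite !inE !mxE => /eqP y0.
  by rewrite mulrDl addrA y0 add0r mul1r.
have -> : \sum_(y : 'rV[A]_1) (if kap Z i0 j + y 0 0 * v 0 i0 != 0 then rho else 1) =
   a%:R * rho + #|S|%:R * (1 - rho).
  rewrite (eq_bigr (fun y => rho + (y \in S)%:R * (1 - rho))) => [|y _]; last first.
    by rewrite inE; case: eqP => _ /=; rewrite ?mul1r ?mul0r ?addr0 // addrC subrK.
  rewrite big_split /= sumr_const card_mx mulr_natl; congr (_ + _).
  rewrite -mulr_suml -natr_sum -sum1_card [in RHS]big_mkcond /=; congr (_%:R * _).
have : 2 * #|S|%:R <= a%:R :> R by rewrite -natrM ler_nat.
move: rho1; set x := #|S|%:R; set b := a%:R => r1 xb.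
by nra.
Qed.

End Estimates.

(** * The law of F L for a fixed F, and the exceptional F *)

Lemma prob_mem (R : realType) (q : R) (A : finComNzRingType) n m (F : 'M[A]_(m, n))
    (Q : pred (graph n)) (K : {set 'M[A]_(m, n)}) :
  prob q (fun E => Q E && (F *m lapmx A E \in K)) =
  \sum_(c in K) prob q (fun E => Q E && (F *m lapmx A E == c)).
Proof.
rewrite /prob (partition_big (fun E => F *m lapmx A E) (mem K)) /=.
  apply: eq_bigr => c cK; apply: eq_bigl => E; rewrite -andbA.
  by case: eqP => [->|]; rewrite ?cK // !andbF.
by move=> E /andP[].
Qed.

Lemma prob_le (R : realType) (q : R) n (P Q : pred (graph n)) :
  0 < q -> q < 1 -> {subset P <= Q} -> prob q P <= prob q Q.
Proof.
move=> q0 q1 PQ; rewrite /prob big_mkcond [leRHS]big_mkcond /=.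
apply: ler_sum => E _; have := PQ E; rewrite !unfold_in.
have w0 : 0 <= graph_weight q E by apply: graph_weight_ge0; apply: ltW.
by case: (P E) => // [->//|]; case: (Q E).
Qed.

Lemma prob_predT (R : realType) (q : R) n : prob q (fun _ : graph n => true) = 1.
Proof.
rewrite -[RHS](ER_prob_total n q) ER_probE; apply: eq_bigl => E.
by apply/esym/asboolP.
Qed.

Lemma prob_or_le (R : realType) (q : R) n (I : finType) (D : pred I)
    (P : pred (graph n)) (Q : I -> pred (graph n)) :
  0 < q -> q < 1 -> (forall E, P E -> [exists i, D i && Q i E]) ->
  prob q P <= \sum_(i | D i) prob q (Q i).
Proof.
move=> q0 q1 PQ; rewrite /prob.
under [leRHS]eq_bigr do rewrite big_mkcond /=.
rewrite exchange_big /= big_mkcond; apply: ler_sum => E _.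
have w0 : 0 <= graph_weight q E by apply: graph_weight_ge0; apply: ltW.
case: ifP => [/PQ/existsP[i /andP[Di Qi]]|_].
  rewrite (bigD1 i) //= Qi lerDl; apply: sumr_ge0 => j _; by case: ifP.
by apply: sumr_ge0 => j _; case: ifP.
Qed.

Lemma code_leq (A : finComNzRingType) d d' m n (F : 'M[A]_(m, n)) :
  (d' <= d)%N -> code d F -> code d' F.
Proof.
move=> le cF; apply/forallP => l; apply/implyP => l0.
exact: leq_ltn_trans le (codeP cF l0).
Qed.

Definition symmetric_mxs (A : finComNzRingType) m := [set S : 'M[A]_m | S^T == S].

Definition good_graph (A : finComNzRingType) d n (E : graph n) : bool :=
  [forall v : 'rV[A]_n, (v != 0) && (#|vsupport v| <= d)%N ==> (v *m lapmx A E != 0)].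

Section Probability.
Variables (A : finComNzRingType) (R : realType) (e : A -> R[i]) (q rho : R).
Hypothesis fs : fourier_setup e q rho.
Variables (n m : nat).
Implicit Types (F c : 'M[A]_(m, n)) (Y : 'M[A]_(n, m)) (d tau t : nat).
Local Notation a := #|A|.
Local Notation B := (a ^ (m + 1))%N.

Let rho0 : 0 < rho. Proof. by case: fs => _ _ _ [_ /andP[]]. Qed.
Let rho1 : rho < 1. Proof. by case: fs => _ _ _ [_ /andP[]]. Qed.
Let q0 : 0 < q. Proof. by case: fs => _ _ _ [/andP[]]. Qed.
Let q1 : q < 1. Proof. by case: fs => _ _ _ [/andP[]]. Qed.
Let a_gt0 : (0 < a)%N. Proof. by apply/card_gt0P; exists 0. Qed.

Let an : R := (a ^ (n * m))%:R.
Let an_gt0 : 0 < an. Proof. by rewrite ltr0n expn_gt0 a_gt0. Qed.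

Definition nonspecial_mass F : R :=
  \sum_(Y | Y \notin special F) rho ^+ kap_support (Y *m F).

Lemma nonspecial_mass_ge0 F : 0 <= nonspecial_mass F.
Proof. by apply: sumr_ge0 => Y _; rewrite exprn_ge0 // ltW. Qed.

Lemma card_fiber_set F (T : {set 'M[A]_(m + 1, m)}) : inj_rows (augment F) ->
  (#|[set c : 'M[A]_(m, n) | augment F *m c^T \in T]| * a ^ ((m + 1) * m) =
   #|T| * a ^ (n * m))%N.
Proof.
move=> injF.
have -> : #|[set c : 'M[A]_(m, n) | augment F *m c^T \in T]| =
    (\sum_(t in T) #|[set X : 'M[A]_(n, m) | augment F *m X == t]|)%N.
  rewrite -(card_imset _ (@trmx_inj _ m n)).
  have -> : trmx @: [set c : 'M[A]_(m, n) | augment F *m c^T \in T] =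
      [set X : 'M[A]_(n, m) | augment F *m X \in T].
    apply/setP => X; apply/imsetP/idP => [[c]|]; rewrite inE.
      by rewrite inE => cT ->.
    by move=> XT; exists X^T; rewrite ?inE trmxK.
  rewrite -sum1_card (partition_big (fun X => augment F *m X) (mem T)) /=.
    apply: eq_bigr => t tT; rewrite -sum1_card; apply: eq_bigl => X; rewrite !inE.
    by case: eqP => [->|]; rewrite ?andbF // tT.
  by move=> X; rewrite inE.
rewrite big_distrl /= (eq_bigr (fun _ => (a ^ (n * m))%N)) => [|t _].
  by rewrite sum_nat_const.
exact: (card_fiber_mulmx fs).
Qed.

(** Membership becomes a prescription of [augment F *m c^T], so that the range can be counted by
    equal fibres. *)
Lemma lap_range_augment F :
  lap_range F = [set c | augment F *m c^T \in
                   [set col_mx S 0 | S in symmetric_mxs A m]].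
Proof.
apply/setP => c; rewrite !inE /augment mul_col_mx.
apply/andP/imsetP => [[/eqP sc /eqP c1]|[S]].
  exists (F *m c^T); first by rewrite inE trmx_mul trmxK -sc trmx_mul trmxK.
  congr col_mx; apply: (can_inj (@trmxK _ _ _)).
  by rewrite trmx_mul trmxK trmx_const trmx0 c1.
rewrite inE => /eqP SS /eq_col_mx[cS c1]; split; apply/eqP.
  have <- : (F *m c^T)^T = c *m F^T by rewrite trmx_mul trmxK.
  by rewrite cS !SS.
by apply: (can_inj (@trmxK _ _ _)); rewrite trmx_mul trmx_const c1 trmx0.
Qed.

Lemma card_lap_range F : inj_rows (augment F) ->
  (#|lap_range F| * a ^ ((m + 1) * m) = #|symmetric_mxs A m| * a ^ (n * m))%N.
Proof.
move=> injF; rewrite lap_range_augment card_fiber_set // card_imset //.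
by move=> S S' /eq_col_mx[].
Qed.

Lemma symmetric_mxs_gt0 : (0 < #|symmetric_mxs A m|)%N.
Proof. by apply/card_gt0P; exists 0; rewrite inE trmx0. Qed.

Lemma card_lap_range_ge F : inj_rows (augment F) ->
  an <= #|lap_range F|%:R * (a ^ ((m + 1) * m))%:R.
Proof.
move=> injF; rewrite -natrM card_lap_range // natrM ler_peMl ?ler0n //.
by rewrite ler1n symmetric_mxs_gt0.
Qed.

Lemma prob_lap_mem F (K : {set 'M[A]_(m, n)}) : K \subset lap_range F ->
  `|prob q (fun E => F *m lapmx A E \in K) * an - #|K|%:R * #|special F|%:R|
  <= #|K|%:R * nonspecial_mass F.
Proof.
move=> /fintype.subsetP KF.
have -> : prob q (fun E => F *m lapmx A E \in K) =
    \sum_(c in K) prob q (fun E => F *m lapmx A E == c).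
  exact: (prob_mem q F (fun _ => true) K).
have -> : #|K|%:R * #|special F|%:R = \sum_(c in K) #|special F|%:R :> R.
  by rewrite sumr_const mulr_natl.
rewrite mulr_suml -sumrB; apply: (le_trans (ler_norm_sum _ _ _)).
apply: (@le_trans _ _ (\sum_(c in K) nonspecial_mass F)).
  by apply: ler_sum => c cK; apply: (prob_lap_special fs); apply: KF.
by rewrite sumr_const mulr_natl.
Qed.

(** The size of [special F] is never computed: the same estimate for the whole range, which has
    probability 1, calibrates the main term. *)
Lemma prob_lap_approx F (K : {set 'M[A]_(m, n)}) : inj_rows (augment F) ->
  K \subset lap_range F ->
  `|prob q (fun E => F *m lapmx A E \in K) - #|K|%:R / #|lap_range F|%:R| * an
  <= 2 * #|K|%:R * nonspecial_mass F.
Proof.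
move=> injF KF.
have O0 : 0 < #|lap_range F|%:R :> R.
  have := card_lap_range_ge injF; rewrite ltNge => h; apply/negP => h'.
  have : an <= 0 by apply: (le_trans h); rewrite mulr_le0_ge0.
  by rewrite leNgt an_gt0.
have h1 := prob_lap_mem KF.
have h2 := prob_lap_mem (subxx (lap_range F)).
have e1 : prob q (fun E => F *m lapmx A E \in lap_range F) = 1.
  rewrite -[RHS](@prob_predT R q n); apply: eq_bigl => E.
  by rewrite lap_in_range.
rewrite e1 mul1r in h2.
set x := prob _ _ * an - _ in h1; set y := an - _ in h2.
rewrite -[X in _ * X](gtr0_norm an_gt0) -normrM.
have -> : (prob q (fun E => F *m lapmx A E \in K) - #|K|%:R / #|lap_range F|%:R) * an =
   x - #|K|%:R / #|lap_range F|%:R * y.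
  by rewrite /x /y; field; rewrite gt_eqF.
apply: (le_trans (ler_normB _ _)); rewrite normrM.
have -> : 2 * #|K|%:R * nonspecial_mass F =
  #|K|%:R * nonspecial_mass F + #|K|%:R / #|lap_range F|%:R * (#|lap_range F|%:R * nonspecial_mass F).
  by field; rewrite gt_eqF.
apply: lerD => //; rewrite ger0_norm ?divr_ge0 ?ler0n // ler_wpM2l // ?divr_ge0 //.
Qed.

Definition sparse_bound d tau t : R :=
  ((1 + rho) / 2) ^+ (n - t) *
  ((a ^ (n * m))%:R * rho ^+ ((d - B * tau).+1 * tau.+1 - 2 * n * t) +
   (a ^ (m * m + m))%:R * (sparse_card A n m (B * tau))%:R).

Lemma sparse_bound_ge0 d tau t : 0 <= sparse_bound d tau t.
Proof.
have r0 := ltW rho0.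
rewrite /sparse_bound mulr_ge0 ?exprn_ge0 ?addr_ge0 ?mulr_ge0 ?exprn_ge0 ?ler0n //; lra.
Qed.

Lemma prob_sparse_le F c d tau t (v : 'rV[A]_n) :
  code d F -> (B * tau <= d)%N -> v != 0 -> (#|vsupport v| <= t)%N ->
  prob q (fun E => (F *m lapmx A E == c) && (v *m lapmx A E == 0)) * an <=
  sparse_bound d tau t.
Proof.
move=> cF le_d v0 supv.
have [i0 vi0] : exists i0, v 0 i0 != 0 by case/rV0Pn: v0 => i; exists i.
have an0 : 0 < (a ^ n)%:R :> R by rewrite ltr0n expn_gt0 a_gt0.
have r0 := ltW rho0; have r1 := ltW rho1.
have h0 : 0 <= (1 + rho) / 2 by rewrite divr_ge0 // addr_ge0.
have h1 : (1 + rho) / 2 <= 1 by rewrite ler_pdivrMr // mul1r -[2]/(1 + 1) lerD2l.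
rewrite -(ler_pM2r an0).
apply: (@le_trans _ _ (prob q (fun E => (F *m lapmx A E == c) &&
    (v *m lapmx A E *m off_diag A (vsupport v) == 0)) * an * (a ^ n)%:R)).
  rewrite !ler_pM2r //; apply: prob_le => // E; rewrite !unfold_in => /andP[-> /eqP->].
  by rewrite mul0mx eqxx.
apply: (le_trans (prob_lap_sparse fs _ _ _ _)).
apply: (@le_trans _ _ (\sum_(Y : 'M[A]_(n, m))
   rho ^+ (kap_support (Y *m F) - 2 * n * t) * ((a ^ n)%:R * ((1 + rho) / 2) ^+ (n - t)))).
  apply: ler_sum => Y _; apply: (le_trans (sum_sparse_char fs _ _ vi0)).
  apply: ler_pM; rewrite ?mulr_ge0 ?exprn_ge0 //.
    by apply: ler_wiXn2l => //; apply: leq_sub2l; rewrite leq_mul2l supv orbT.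
  rewrite ler_wpM2l //; by apply: ler_wiXn2l => //; apply: leq_sub2l.
rewrite -mulr_suml mulrCA mulrC ler_pM2r // /sparse_bound mulrC.
rewrite ler_wpM2l ?exprn_ge0 //.
exact: (shifted_sum fs).
Qed.

(** Union over the function [l] and its sparse values. The linear part of [l] is nonzero, since a
    nonzero constant has full support and [d < n]; so each column of [F] satisfies a nontrivial
    affine equation, and at most half of all vectors do. *)
Lemma card_noncode d : (d < n)%N ->
  (2 ^ n * #|[set F : 'M[A]_(m, n) | ~~ code d F]| <=
   a ^ (m + 1) * sparse_card A n 1 d * a ^ (n * m))%N.
Proof.
move=> dn.
pose T := [set u : 'rV[A]_(m + 1) * 'rV[A]_n |
   (lsubmx u.1 != 0) && (#|vsupport u.2| <= d)%N].
pose S (u : 'rV[A]_(m + 1) * 'rV[A]_n) := [set F : 'M[A]_(m, n) | u.1 *m augment F == u.2].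
have sub : [set F : 'M[A]_(m, n) | ~~ code d F] \subset \bigcup_(u in T) S u.
  apply/fintype.subsetP => F; rewrite inE negb_forall => /existsP[l].
  rewrite negb_imply -leqNgt => /andP[l0 sl].
  apply/bigcupP; exists (l, l *m augment F); last by rewrite inE.
  rewrite inE /= sl andbT; apply/eqP => ll0.
  have lE : l = row_mx 0 (rsubmx l) by rewrite -ll0 hsubmxK.
  move: sl; rewrite lE /augment mul_row_col mul0mx add0r leqNgt => /negP[].
  apply: (leq_trans dn).
  have r0 : rsubmx l 0 0 != 0.
    apply: contra l0 => /eqP r0; rewrite lE (_ : rsubmx l = 0) ?row_mx0 //.
    by apply/matrixP => i j; rewrite !ord1 r0 mxE.
  rewrite -[X in (X <= _)%N]card_ord -cardsT; apply: subset_leq_card.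
  apply/fintype.subsetP => i _; rewrite inE mxE big_ord1 !mxE mulr1.
  by move: r0; rewrite mxE.
have cardS u : u \in T -> (2 ^ n * #|S u| <= a ^ (n * m))%N.
  rewrite inE => /andP[l0 _]; set l := lsubmx u.1 in l0.
  have [y1 ly1] : exists y1 : 'cV[A]_m, l *m y1 != 0.
    have [j lj] := rV0Pn _ l0; exists (delta_mx j 0).
    by rewrite -colE; apply/eqP => /matrixP/(_ 0 0); rewrite [col j l _ _]mxE [X in _ = X]mxE => /eqP; rewrite (negPf lj).
  pose b i := u.2 0 i - rsubmx u.1 0 0.
  pose C i := [set y : 'rV[A]_m | (l *m y^T) 0 0 == b i].
  have -> : #|S u| = (\prod_(i < n) #|C i|)%N.
    rewrite -(card_imset _ (@trmx_inj _ m n)).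
    have -> : trmx @: S u = [set Y : 'M[A]_(n, m) | [forall i, row i Y \in C i]].
      apply/setP => Y; rewrite inE; apply/imsetP/forallP => [[F]|YC].
        rewrite inE => /eqP uF -> i; rewrite inE -tr_col trmxK /b -uF.
        rewrite -{1}[u.1]hsubmxK /augment mul_row_col !mxE big_ord1 !mxE mulr1 addrK.
        by apply/eqP; apply: eq_bigr => k _; rewrite !mxE.
      exists Y^T; last by rewrite trmxK.
      rewrite inE; apply/eqP/rowP => i; have := YC i; rewrite inE => /eqP.
      rewrite /b => /eqP; rewrite eq_sym subr_eq => /eqP ->.
      rewrite -{1}[u.1]hsubmxK /augment mul_row_col !mxE big_ord1 !mxE mulr1; congr (_ + _).
      by apply: eq_bigr => k _; rewrite !mxE.
    have := @sum_prod_rows int A n m (fun i y => (y \in C i)%:R).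
    move=> h; apply/eqP; rewrite -eqz_nat; apply/eqP.
    rewrite -sum1_card -[LHS]natz natr_sum.
    transitivity (\sum_(Y : 'M[A]_(n, m)) \prod_(i < n) (row i Y \in C i)%:R : int).
      rewrite big_mkcond /=; apply: eq_bigr => Y _; rewrite inE.
      case: forallP => [YC|nYC]; first by rewrite big1 // => i _; rewrite YC.
      have [i /negPf ni] : exists i, row i Y \notin C i.
        by apply/existsP; rewrite -negb_forall; apply/forallP.
      by rewrite (bigD1 i) //= ni mul0r.
    rewrite h -natz natr_prod; apply: eq_bigr => i _.
    by rewrite -natr_sum -sum1_card [in RHS]big_mkcond.
  have -> : (2 ^ n = \prod_(i < n) 2)%N by rewrite prod_nat_const card_ord.
  rewrite -big_split /=.
  have -> : (a ^ (n * m) = \prod_(i < n) a ^ m)%N by rewrite prod_nat_const card_ord mulnC -expnM.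
  apply: leq_prod => i _.
  have -> : (a ^ m)%N = #|{: 'rV[A]_m}| by rewrite card_mx mul1n.
  apply: (@card_half _ (C i) y1^T) => y; rewrite !inE => /eqP yb.
  rewrite linearD /= trmxK mulmxDr mxE yb -subr_eq0 addrAC subrr add0r.
  apply: contra ly1 => /eqP h; apply/eqP/matrixP => i' j'.
  by rewrite !ord1 h mxE.
apply: (@leq_trans (\sum_(u in T) 2 ^ n * #|S u|)).
  rewrite -big_distrr leq_mul2l; apply/orP; right.
  apply: leq_trans (subset_leq_card sub) _.
  elim/big_rec2 : _ => [|u s X _ IH]; first by rewrite cards0.
  by apply: leq_trans (leq_card_setU _ _) _; rewrite leq_add2l.
apply: leq_trans (leq_sum _ cardS) _.
rewrite sum_nat_const leq_mul2r; apply/orP; right.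
apply: leq_trans (subset_leq_card (_ : T \subset finset.setX [set: 'rV[A]_(m + 1)]
     [set v : 'rV[A]_n | (#|vsupport v| <= d)%N])) _.
  by apply/fintype.subsetP => u; rewrite !inE => /andP[].
rewrite cardsX cardsT card_mx mul1n leq_mul2l; apply/orP; right.
rewrite -(card_imset _ (@trmx_inj _ 1 n)); apply: subset_leq_card.
apply/fintype.subsetP => Y /imsetP[v]; rewrite inE => sv ->; rewrite inE.
apply: leq_trans sv; apply: subset_leq_card; apply/fintype.subsetP => i; rewrite !inE.
by apply: contra => /eqP vi; apply/eqP/rowP => j; rewrite !mxE ord1 vi.
Qed.

End Probability.

(** * Asymptotics of the number of lifts *)

Definition vanishing (R : realType) (u : nat -> R) : Prop :=
  forall eps : R, 0 < eps -> exists n0 : nat, forall n, (n0 <= n)%N -> `|u n| <= eps.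

Section Vanishing.
Variable R : realType.
Implicit Types (u v : nat -> R) (x : R).

Lemma vanishingD u v : vanishing u -> vanishing v -> vanishing (fun n => u n + v n).
Proof.
move=> hu hv eps e0; have e2 : 0 < eps / 2 by rewrite divr_gt0.
have [n1 h1] := hu _ e2; have [n2 h2] := hv _ e2.
exists (maxn n1 n2) => n; rewrite geq_max => /andP[l1 l2].
apply: (le_trans (ler_normD _ _)); rewrite [eps]splitr; apply: lerD; [exact: h1|exact: h2].
Qed.

Lemma vanishing_le u v k : vanishing u -> (forall n, (k <= n)%N -> `|v n| <= u n) ->
  vanishing v.
Proof.
move=> hu le_vu eps e0; have [n0 h] := hu _ e0; exists (maxn n0 k) => n.
rewrite geq_max => /andP[l1 l2]; apply: (le_trans (le_vu _ l2)).
exact: le_trans (ler_norm _) (h _ l1).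
Qed.

Lemma vanishingZ x u : vanishing u -> vanishing (fun n => x * u n).
Proof.
move=> hu eps e0; have x0 : 0 < `|x| + 1 by rewrite ltr_wpDl.
have [n0 h] := hu (eps / (`|x| + 1)) (divr_gt0 e0 x0).
exists n0 => n /h; rewrite ler_pdivlMr // mulrC => hn.
rewrite normrM; apply: le_trans hn; rewrite ler_wpM2r // lerDl //.
Qed.

Lemma vanishing_norm u : vanishing u -> vanishing (fun n => `|u n|).
Proof. by move=> hu eps /hu[n0 h]; exists n0 => n /h; rewrite normr_id. Qed.

Lemma vanishing_expr x : 0 <= x -> x < 1 -> vanishing (fun n => x ^+ n).
Proof.
move=> x0 x1 eps e0.
have /cvgrPdist_le/(_ _ e0)[n0 _ h] : ((GRing.exp x) @ \oo --> (0 : R))%classic.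
  by apply: cvg_expr; rewrite ger0_norm.
by exists n0 => n /h /=; rewrite sub0r normrN.
Qed.

Lemma vanishing_cvg u x : vanishing (fun n => u n - x) -> (u @ \oo --> x)%classic.
Proof.
move=> h; apply/cvgrPdist_le => eps /h[n0 hn]; exists n0 => // n /= /hn.
by rewrite distrC.
Qed.

Lemma vanishing_expr_div (b rho : R) c : 1 <= b -> 0 <= rho -> (0 < c)%N ->
  b ^+ c * rho < 1 -> vanishing (fun n => b ^+ n * rho ^+ (n %/ c)).
Proof.
move=> b1 r0 c0 lt1; have b0 : 0 <= b by apply: le_trans b1.
have x0 : 0 <= b ^+ c * rho by rewrite mulr_ge0 // exprn_ge0.
have hx := vanishingZ (b ^+ c) (vanishing_expr x0 lt1).
move=> eps e0; have [k0 hk] := hx _ e0; exists (c * k0)%N => n hn.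
have kn : (k0 <= n %/ c)%N by rewrite leq_divRL // mulnC.
rewrite ger0_norm ?mulr_ge0 ?exprn_ge0 //.
apply: le_trans (le_trans (ler_norm _) (hk _ kn)).
rewrite exprMn mulrA ler_wpM2r ?exprn_ge0 // -exprM -exprD.
by apply: ler_weXn2l => //; rewrite {1}(divn_eq n c) mulnC addnC leq_add2r ltnW // ltn_pmod.
Qed.

(** For large [n] the quadratic exponent supplies a factor at most [1 / (2 b)] for each of the [n]
    factors [b]. *)
Lemma vanishing_expr_square (b rho : R) c : 1 <= b -> 0 <= rho -> rho < 1 -> (0 < c)%N ->
  vanishing (fun n => b ^+ n * rho ^+ ((n * n) %/ c)).
Proof.
move=> b1 r0 r1 c0; have b0 : 0 < b by apply: lt_le_trans b1.
have h2 : 0 < (2^-1 : R) by rewrite invr_gt0.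
have [k0 hk] := vanishing_expr r0 r1 (divr_gt0 h2 b0).
have /hk := leqnn k0; rewrite ger0_norm ?exprn_ge0 // ler_pdivlMr // => hk0.
have := @vanishing_expr (2^-1) (ltW h2); rewrite invf_lt1 // ltr1n => /(_ isT) van.
apply: (vanishing_le (k := (c * k0)%N) van) => n hn; rewrite ger0_norm; last first.
  by rewrite mulr_ge0 ?exprn_ge0 // ltW.
apply: (@le_trans _ _ (b ^+ n * (rho ^+ k0) ^+ n)).
  rewrite ler_wpM2l ?exprn_ge0 ?(ltW b0) // -exprM; apply: ler_wiXn2l => //; first exact: ltW.
  rewrite leq_divRL //; apply: leq_trans (_ : n * (c * k0) <= _)%N; first by lia.
  by rewrite leq_mul2l hn orbT.
rewrite -exprMn; apply: lerXn2r; rewrite ?nnegrE ?mulr_ge0 ?exprn_ge0 ?(ltW b0) ?(ltW h2) //.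
by rewrite mulrC.
Qed.

Lemma exists_small_growth (x : R) k : 0 <= x -> x < 1 ->
  exists2 eps, 0 < eps & (1 + eps) ^+ k * x < 1.
Proof.
move=> x0 x1.
have grow (eps : R) j : 0 <= eps -> eps <= 1 -> (1 + eps) ^+ j <= 1 + (2 ^+ j - 1) * eps.
  move=> e0 e1; elim: j => [|j IH]; first by rewrite !expr0 subrr mul0r addr0.
  rewrite exprS; apply: le_trans (ler_wpM2l _ IH) _; first by rewrite addr_ge0.
  rewrite exprS; have : 1 <= 2 ^+ j :> R by rewrite exprn_ege1 // ler1n.
  set y := 2 ^+ j => y1.
  have : 0 <= (y - 1) * eps * (1 - eps) by rewrite !mulr_ge0 ?subr_ge0.
  by move=> h; rewrite -subr_ge0 (_ : _ - _ = (y - 1) * eps * (1 - eps)) //; ring.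
have y0 : 0 < (2 : R) ^+ k by rewrite exprn_gt0.
have e1 : (1 - x) / 2 ^+ k.+1 <= 1.
  rewrite ler_pdivrMr ?exprn_gt0 // mul1r exprS.
  have : 1 <= 2 ^+ k :> R by rewrite exprn_ege1 // ler1n.
  by lra.
have e0 : 0 < (1 - x) / 2 ^+ k.+1 by rewrite divr_gt0 ?exprn_gt0 ?subr_gt0.
exists ((1 - x) / 2 ^+ k.+1) => //.
apply: le_lt_trans (ler_wpM2r x0 (grow _ k (ltW e0) e1)) _.
rewrite mulrBl mul1r; have -> : 2 ^+ k * ((1 - x) / 2 ^+ k.+1) = (1 - x) / 2.
  by rewrite exprS; field; rewrite gt_eqF.
by nra.
Qed.

End Vanishing.

(** In [sparse_card_le] the weight [z = eta / #|A| ^ m] makes the right side [(1 + eta) ^+ n], and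
    [z ^- t] is at most the same once [t] is a small fraction of [n]; [eta] is chosen with
    [(1 + eta) ^+ 2 <= 1 + eps]. *)
Lemma sparse_small (R : realType) (A : finComNzRingType) m (eps : R) : 0 < eps ->
  exists s0 : nat, forall s n t, (s0 <= s)%N -> (s * t <= n)%N ->
    (sparse_card A n m t)%:R <= (1 + eps) ^+ n.
Proof.
move=> e0; pose eta := Num.min eps 1 / 3.
have eta0 : 0 < eta by rewrite divr_gt0 // lt_min e0 ltr01.
have eta1 : eta <= 3^-1 by rewrite /eta ler_pdivrMr // mulVf // ge_min lexx orbT.
have eta2 : (1 + eta) ^+ 2 <= 1 + eps.
  have : eta * 3 <= eps by rewrite /eta divfK // ge_min lexx.
  by rewrite expr2; nra.
have K0 : 1 <= (#|A| ^ m)%:R :> R.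
  by rewrite ler1n expn_gt0; apply/orP; left; apply/card_gt0P; exists 0.
have Kgt0 : 0 < (#|A| ^ m)%:R :> R by apply: lt_le_trans K0.
pose z := eta / (#|A| ^ m)%:R.
have z0 : 0 < z by rewrite divr_gt0.
have z1 : z <= 1 by rewrite ler_pdivrMr // mul1r; apply: le_trans K0; apply: le_trans eta1 _; rewrite invf_le1 // ler1n.
have [s0 hs0] : exists s0 : nat, z^-1 <= (1 + eta) ^+ s0.
  have l1 : (1 + eta)^-1 < 1 by rewrite invf_lt1 ?ltrDl // addr_gt0.
  have l0 : 0 <= (1 + eta)^-1 by rewrite invr_ge0 addr_ge0 // ltW.
  have [k hk] := vanishing_expr l0 l1 z0; exists k.
  have := hk k (leqnn k); rewrite ger0_norm ?exprn_ge0 // exprVn.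
  by rewrite -[X in _ <= X]invrK lef_pV2 // ?posrE ?invr_gt0 ?exprn_gt0 // addr_gt0.
exists s0 => s n t ss0 stn.
have := sparse_card_le A n m t z0 z1.
have -> : (#|A| ^ m)%:R * z = eta by rewrite /z mulrC divfK // gt_eqF.
rewrite mulrC -ler_pdivlMr ?exprn_gt0 // => /le_trans; apply.
apply: (@le_trans _ _ ((1 + eta) ^+ n * (1 + eta) ^+ n)).
  rewrite ler_wpM2l ?exprn_ge0 ?addr_ge0 ?(ltW eta0) // -exprVn.
  apply: le_trans (_ : ((1 + eta) ^+ s0) ^+ t <= _).
    by rewrite lerXn2r // nnegrE ?invr_ge0 ?exprn_ge0 ?addr_ge0 // ltW.
  rewrite -exprM; apply: ler_weXn2l; first by rewrite lerDl ltW.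
  by apply: leq_trans stn; rewrite leq_mul2r ss0 orbT.
by rewrite -exprMn -expr2 lerXn2r // nnegrE ?exprn_ge0 ?addr_ge0 // ltW.
Qed.

Lemma card_vsparse (A : finComNzRingType) n d :
  (#|[set v : 'rV[A]_n | (#|vsupport v| <= d)%N]| <= sparse_card A n 1 d)%N.
Proof.
rewrite -(card_imset _ (@trmx_inj _ 1 n)); apply: subset_leq_card.
apply/fintype.subsetP => Y /imsetP[v]; rewrite inE => sv ->; rewrite inE.
apply: leq_trans sv; apply: subset_leq_card; apply/fintype.subsetP => i; rewrite !inE.
by apply: contra => /eqP vi; apply/eqP/rowP => j; rewrite !mxE ord1 vi.
Qed.

Section CoreFinite.
Variables (A : finComNzRingType) (R : realType) (e : A -> R[i]) (q rho : R).
Hypothesis fs : fourier_setup e q rho.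
Variables (n m : nat).
Local Notation a := #|A|.
Variables (d1 d2 : nat) (S1 S2 Bd kappa : R).
Hypothesis le12 : (d1 <= d2)%N.
Hypothesis kappa0 : 0 <= kappa.
Hypothesis S10 : 0 <= S1.
Hypothesis S20 : 0 <= S2.
Hypothesis Bd0 : 0 <= Bd.
Let an : R := (a ^ (n * m))%:R.
Hypothesis hS1 : forall F : 'M[A]_(m, n), code d1 F -> nonspecial_mass rho F <= S1.
Hypothesis hS2 : forall F : 'M[A]_(m, n), code d2 F -> nonspecial_mass rho F <= S2.
Hypothesis hBd : forall (F c : 'M[A]_(m, n)) v, code d2 F -> v != 0 ->
  (#|vsupport v| <= d1)%N ->
  prob q (fun E => (F *m lapmx A E == c) && (v *m lapmx A E == 0)) * an <= Bd.

Let q0 : 0 < q. Proof. by case: fs => _ _ _ [/andP[]]. Qed.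
Let q1 : q < 1. Proof. by case: fs => _ _ _ [/andP[]]. Qed.
Let a_gt0 : (0 < a)%N. Proof. by apply/card_gt0P; exists 0. Qed.
Let an_gt0 : 0 < an. Proof. by rewrite ltr0n expn_gt0 a_gt0. Qed.

Lemma prob_bad_le (F : 'M[A]_(m, n)) (K : {set 'M[A]_(m, n)}) : code d2 F ->
  prob q (fun E => ~~ good_graph A d1 E && (F *m lapmx A E \in K)) * an <=
  #|K|%:R * ((sparse_card A n 1 d1)%:R * Bd).
Proof.
move=> cF; rewrite (prob_mem q F (fun E => ~~ good_graph A d1 E) K) mulr_suml.
rewrite mulr_natl -sumr_const; apply: ler_sum => c _.
pose D := [set v : 'rV[A]_n | (v != 0) && (#|vsupport v| <= d1)%N].
apply: (@le_trans _ _ (\sum_(v in D)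
    prob q (fun E => (F *m lapmx A E == c) && (v *m lapmx A E == 0)) * an)).
  rewrite -mulr_suml ler_pM2r //; apply: prob_or_le => // E /andP[].
  rewrite negb_forall => /existsP[v]; rewrite negb_imply negbK => /andP[vD vL] Fc.
  by apply/existsP; exists v; rewrite inE vD Fc vL.
apply: (@le_trans _ _ (\sum_(v in D) Bd)).
  by apply: ler_sum => v; rewrite inE => /andP[v0 sv]; apply: hBd.
rewrite sumr_const -[leLHS]mulr_natl ler_wpM2r // ler_nat.
apply: leq_trans (card_vsparse A n d1); apply: subset_leq_card.
by apply/fintype.subsetP => v; rewrite !inE => /andP[].
Qed.

(** Three regimes. A code at [d2] admits both the Fourier estimate and the bound on bad graphs.
    Between [d1] and [d2] both terms are bounded crudely, which is affordable because few [F] occur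
    there. Below [d1] only the reference term can survive. *)
Lemma core_term (F : 'M[A]_(m, n)) (K : {set 'M[A]_(m, n)}) :
  (code 0 F -> K \subset lap_range F) -> (code 0 F -> #|K|%:R <= kappa) ->
  `|(if code d1 F then prob q (fun E => good_graph A d1 E && (F *m lapmx A E \in K)) else 0)
    - (if code 0 F then #|K|%:R / #|lap_range F|%:R else 0)| * an <=
  kappa * (if code d2 F then 2 * S2 + (sparse_card A n 1 d1)%:R * Bd
           else 2 * (a ^ ((m + 1) * m))%:R + 2 * S1).
Proof.
move=> hK hkap.
set T := _ / _; set P := prob q (fun E => F *m lapmx A E \in K).
set p := prob q (fun E => good_graph A d1 E && _).
have sp0 : 0 <= (sparse_card A n 1 d1)%:R * Bd by rewrite mulr_ge0.
have c0 : 0 <= (a ^ ((m + 1) * m))%:R :> R by [].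
have p0 : 0 <= p by apply: (prob_ge0 fs).
have T0 : 0 <= T by rewrite divr_ge0.
have pP : p <= P.
  by apply: prob_le => // E; rewrite !unfold_in => /andP[].
have decomp : P = p + prob q (fun E => ~~ good_graph A d1 E && (F *m lapmx A E \in K)).
  rewrite /P /p /prob (bigID (@good_graph A d1 n)) /=.
  by congr (_ + _); apply: eq_bigl => E; rewrite andbC.
have Tan : code 0 F -> T * an <= kappa * (a ^ ((m + 1) * m))%:R.
  move=> cF; have injF := code_inj_rows cF.
  have h := card_lap_range_ge fs injF.
  have O0 : 0 < #|lap_range F|%:R :> R.
    rewrite lt_neqAle ler0n andbT; apply/eqP => h'.
    by move: h; rewrite -h' mul0r leNgt an_gt0.
  rewrite /T mulrAC ler_pdivrMr // -mulrA [X in _ <= _ * X]mulrC.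
  by apply: ler_pM; rewrite ?ler0n ?hkap //; apply: ltW.
case: (boolP (code d2 F)) => cF2.
  have cF1 := code_leq le12 cF2; have cF0 := code_leq (leq0n _) cF2.
  rewrite cF1 cF0.
  have h1 := prob_lap_approx fs (code_inj_rows cF0) (hK cF0); rewrite -/P -/T -/an in h1.
  have h2 := prob_bad_le K cF2.
  have -> : p - T = (P - T) - prob q (fun E => ~~ good_graph A d1 E && (F *m lapmx A E \in K)).
    by rewrite decomp; ring.
  apply: (@le_trans _ _ ((`|P - T| + prob q (fun E => ~~ good_graph A d1 E && (F *m lapmx A E \in K))) * an)).
    rewrite ler_pM2r //; apply: (le_trans (ler_normB _ _)); rewrite lerD2l.
    by rewrite ger0_norm // (prob_ge0 fs).
  rewrite mulrDl mulrDr; apply: lerD.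
    apply: (le_trans h1); rewrite -[2 * _]mulrC -mulrA.
    by apply: ler_pM; rewrite ?mulr_ge0 ?(nonspecial_mass_ge0 fs) ?hkap // ler_pM2l // hS2.
  by apply: (le_trans h2); rewrite ler_wpM2r // hkap.
case: (boolP (code d1 F)) => cF1.
  have cF0 := code_leq (leq0n _) cF1; rewrite cF0.
  have h1 := prob_lap_approx fs (code_inj_rows cF0) (hK cF0); rewrite -/P -/T -/an in h1.
  apply: (@le_trans _ _ ((`|P - T| + T) * an)).
    rewrite ler_pM2r // ler_norml; apply/andP; split.
      by rewrite opprD -subr_ge0; have := normr_ge0 (P - T); lra.
    by have := ler_norm (P - T); lra.
  rewrite mulrDl addrC mulrDr; apply: lerD.
    by apply: (le_trans (Tan cF0)); rewrite ler_wpM2l // ler_peMl // ler1n.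
  apply: (le_trans h1); rewrite -[2 * _]mulrC -mulrA.
  by apply: ler_pM; rewrite ?mulr_ge0 ?(nonspecial_mass_ge0 fs) ?hkap // ler_pM2l // hS1.
case: (boolP (code 0 F)) => cF0.
  rewrite sub0r normrN ger0_norm //; apply: (le_trans (Tan cF0)).
  rewrite ler_wpM2l //; have : 0 <= S1 by []; move: c0; set x := (_ ^ _)%:R; lra.
by rewrite subrr normr0 mul0r mulr_ge0 // addr_ge0 // mulr_ge0.
Qed.

Lemma core_sum (K : 'M[A]_(m, n) -> {set 'M[A]_(m, n)}) :
  (forall F, code 0 F -> K F \subset lap_range F) ->
  (forall F, code 0 F -> #|K F|%:R <= kappa) ->
  `|\sum_(E | good_graph A d1 E) graph_weight q E *
       #|[set F | code d1 F && (F *m lapmx A E \in K F)]|%:R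
    - \sum_(F : 'M[A]_(m, n) | code 0 F) #|K F|%:R / #|lap_range F|%:R| <=
  kappa * (2 * S2 + (sparse_card A n 1 d1)%:R * Bd +
    #|[set F : 'M[A]_(m, n) | ~~ code d2 F]|%:R / an *
      (2 * (a ^ ((m + 1) * m))%:R + 2 * S1)).
Proof.
move=> hK hkap.
have -> : \sum_(E | good_graph A d1 E) graph_weight q E *
       #|[set F | code d1 F && (F *m lapmx A E \in K F)]|%:R =
   \sum_(F : 'M[A]_(m, n)) (if code d1 F then
      prob q (fun E => good_graph A d1 E && (F *m lapmx A E \in K F)) else 0).
  under eq_bigr do rewrite -sum1_card natr_sum mulr_sumr big_mkcond /=.
  rewrite exchange_big /=; apply: eq_bigr => F _.
  rewrite /prob; case: ifP => cF.
    rewrite [RHS]big_mkcondr /=; apply: eq_bigr => E _.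
    by rewrite inE cF mulr1.
  by apply: big1 => E _; rewrite inE cF.
rewrite [X in _ - X]big_mkcond -sumrB /= -(ler_pM2r an_gt0).
apply: (@le_trans _ _ (\sum_(F : 'M[A]_(m, n)) `|(if code d1 F then
      prob q (fun E => good_graph A d1 E && (F *m lapmx A E \in K F)) else 0)
      - (if code 0 F then #|K F|%:R / #|lap_range F|%:R else 0)| * an)).
  by rewrite -mulr_suml ler_pM2r //; apply: ler_norm_sum.
apply: (le_trans (ler_sum _ (fun F _ => core_term (hK F) (hkap F)))).
rewrite -mulr_sumr -[leRHS]mulrA ler_wpM2l // (bigID (fun F => code d2 F)) /= [leRHS]mulrDl.
have sp0 : 0 <= (sparse_card A n 1 d1)%:R * Bd by rewrite mulr_ge0.
apply: lerD.
  rewrite (eq_bigr (fun _ => 2 * S2 + (sparse_card A n 1 d1)%:R * Bd)) => [|F -> //].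
  rewrite sumr_const -[leLHS]mulr_natr ler_wpM2l ?addr_ge0 ?mulr_ge0 // ler_nat.
  by apply: leq_trans (max_card _) _; rewrite card_mx mulnC.
rewrite (eq_bigr (fun _ => 2 * (a ^ ((m + 1) * m))%:R + 2 * S1)) => [|F /negPf -> //].
rewrite sumr_const -[leLHS]mulr_natl mulrAC divfK ?gt_eqF //.
rewrite ler_wpM2r ?addr_ge0 ?mulr_ge0 // ler_nat.
by apply: eq_leq; apply: eq_card => F; rewrite inE.
Qed.

End CoreFinite.

Lemma leq_div_of_mul x c G : (0 < c)%N -> (x <= c * G)%N -> (x %/ c <= G)%N.
Proof. by move=> c0 h; rewrite -(mulKn G c0) leq_div2r. Qed.

Lemma half_leq_sub n y : (y <= n %/ 2)%N -> (n %/ 2 <= n - y)%N.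
Proof. by move: (leq_trunc_div n 2); lia. Qed.

Lemma leq_double_sub k X W : (k <= X -> W <= k -> k <= 2 * X - W)%N.
Proof. by lia. Qed.

Section CoreAsymptotic.
Variables (A : finComNzRingType) (R : realType) (e : A -> R[i]) (q rho : R).
Hypothesis fs : fourier_setup e q rho.
Variable (m : nat).
Local Notation a := #|A|.
Local Notation B := (a ^ (m + 1))%N.

Let rho0 : 0 < rho. Proof. by case: fs => _ _ _ [_ /andP[]]. Qed.
Let rho1 : rho < 1. Proof. by case: fs => _ _ _ [_ /andP[]]. Qed.
Let a_gt0 : (0 < a)%N. Proof. by apply/card_gt0P; exists 0. Qed.
Let am_ge1 : 1 <= (a ^ m)%:R :> R. Proof. by rewrite ler1n expn_gt0 a_gt0. Qed.
Let B_gt0 : (0 < B)%N. Proof. by rewrite expn_gt0 a_gt0. Qed.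

Lemma scale_tau s u n : (0 < s)%N -> (2 * s <= u)%N ->
  (2 * (B * (n %/ (B * u))) <= n %/ s)%N.
Proof.
move=> s0 su; rewrite leq_divRL //.
apply: leq_trans (leq_trunc_div n (B * u)).
rewrite (_ : 2 * (B * (n %/ (B * u))) * s = n %/ (B * u) * (B * (2 * s)))%N; last by ring.
by rewrite leq_mul2l leq_mul2l su !orbT.
Qed.

(** With [tau] proportional to [n], the product bounding the support stays quadratic in [n]; the
    factor 2 pays for subtracting [B * tau], at most half of [d]. *)
Lemma scale_square s u n d tau : (0 < s)%N -> (0 < u)%N ->
  d = (n %/ s)%N -> tau = (n %/ (B * u))%N -> (2 * (B * tau) <= d)%N ->
  (n * n <= (2 * s * (B * u)) * ((d - B * tau).+1 * tau.+1))%N.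
Proof.
move=> s0 u0 dE tauE le_d.
have h1 : (n <= s * d.+1)%N by rewrite dE mulnC ltnW // ltn_ceil.
have h2 : (n <= B * u * tau.+1)%N by rewrite tauE mulnC ltnW // ltn_ceil // muln_gt0 B_gt0.
have h3 : (d.+1 <= 2 * (d - B * tau).+1)%N.
  move: le_d; set x := (B * tau)%N; lia.
apply: leq_trans (leq_mul h1 h2) _.
rewrite (_ : 2 * s * (B * u) * ((d - B * tau).+1 * tau.+1) =
  s * (2 * (d - B * tau).+1) * (B * u * tau.+1))%N; last by ring.
by rewrite leq_mul2r leq_mul2l h3 !orbT.
Qed.

Lemma nonspecial_small s : (0 < s)%N -> exists2 del : nat -> R,
  vanishing del & forall n, 0 <= del n /\
    forall F : 'M[A]_(m, n), code (n %/ s) F -> nonspecial_mass rho F <= del n.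
Proof.
move=> s0; have r0 := ltW rho0.
(* Chosen so that the near-special matrices, at most [(1 + eps) ^+ n] up to a constant, are beaten
   by [rho ^+ (n %/ (2 * s))]. *)
have [eps e0 he] := exists_small_growth (2 * s) r0 rho1.
have [sB hB] := sparse_small A m e0.
pose u := maxn sB (2 * s).
have u0 : (0 < u)%N by rewrite leq_max muln_gt0 s0 orbT.
pose tau n := (n %/ (B * u))%N.
have e1 : 1 <= 1 + eps by rewrite lerDl ltW.
have c0 : (0 < 2 * s * (B * u))%N by rewrite !muln_gt0 s0 u0 B_gt0.
exists (fun n => (a ^ m)%:R ^+ n * rho ^+ ((n * n) %/ (2 * s * (B * u))) +
  (a ^ (m * m + m))%:R * ((1 + eps) ^+ n * rho ^+ (n %/ (2 * s)))).
  apply: vanishingD; first exact: vanishing_expr_square.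
  by apply: vanishingZ; apply: vanishing_expr_div => //; lia.
move=> n; split.
  have e2 : 0 <= 1 + eps by apply: le_trans e1.
  by rewrite addr_ge0 ?mulr_ge0 ?exprn_ge0 ?ler0n.
move=> F cF.
have le_d : (2 * (B * tau n) <= n %/ s)%N by apply: scale_tau => //; rewrite leq_maxr.
have le_d' : (B * tau n <= n %/ s)%N by apply: leq_trans le_d; rewrite leq_pmull.
apply: (le_trans (nonspecial_sum fs cF le_d')); apply: lerD.
  rewrite /near_bound mulnC expnM natrX ler_wpM2l ?exprn_ge0 //.
  apply: ler_wiXn2l; rewrite ?ltW //.
  by apply: leq_div_of_mul => //; apply: scale_square.
rewrite -mulrA ler_wpM2l // ler_pM ?exprn_ge0 //.
  apply: (hB u); first by rewrite leq_maxl.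
  by rewrite mulnCA mulnA mulnC leq_trunc_div.
apply: ler_wiXn2l; rewrite ?ltW // mulnC divnMA.
move: le_d; set x := (B * _)%N; set d := (n %/ s)%N; lia.
Qed.

Lemma sparse_vanish s2 : (1 < s2)%N -> exists s0 : nat, forall s, (s0 <= s)%N ->
  [/\ (s2 <= s)%N & exists2 Bd : nat -> R,
    vanishing (fun n => (sparse_card A n 1 (n %/ s))%:R * Bd n) &
    forall n, 0 <= Bd n /\ forall (F c : 'M[A]_(m, n)) v, code (n %/ s2) F -> v != 0 ->
      (#|vsupport v| <= n %/ s)%N ->
      prob q (fun E => (F *m lapmx A E == c) && (v *m lapmx A E == 0)) *
        (a ^ (n * m))%:R <= Bd n].
Proof.
move=> s20; have r0 := ltW rho0; have s2gt0 : (0 < s2)%N by apply: ltnW.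
pose lam := (1 + rho) / 2.
have lam0 : 0 <= lam by rewrite divr_ge0 // addr_ge0.
have lam1 : lam < 1 by rewrite ltr_pdivrMr // mul1r -[2]/(1 + 1) ltrD2l.
(* Exponent 4: two factors [(1 + eps) ^+ n], one for the sparse [v] and one for the near-special
   [Y], against only [lam ^+ (n %/ 2)]. *)
have [eps e0 he] := exists_small_growth 4 lam0 lam1.
have e1 : 1 <= 1 + eps by rewrite lerDl ltW.
have e2 : 0 <= 1 + eps by apply: le_trans e1.
have [sB hB] := sparse_small A m e0.
have [sC hC] := sparse_small A 1 e0.
pose u := maxn sB (2 * s2).
have u0 : (0 < u)%N by rewrite leq_max muln_gt0 s2gt0 orbT.
pose tau n := (n %/ (B * u))%N.
pose c4 := (4 * s2 * (B * u))%N.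
have c40 : (0 < c4)%N by rewrite !muln_gt0 s2gt0 u0 B_gt0.
(* [c4] is twice the constant of [scale_square], so the exponent is at least [2 n^2 / c4];
   [2 * c4 <= s] keeps the loss [2 * n * (n %/ s)] below half of that. *)
exists (maxn sC (2 * c4)) => s; rewrite geq_max => /andP[sCs c4s].
have ss2 : (s2 <= s)%N.
  apply: leq_trans c4s; rewrite /c4 (_ : (2 * (4 * s2 * (B * u)) = s2 * (8 * (B * u)))%N); last by ring.
  by rewrite leq_pmulr // !muln_gt0 u0 B_gt0.
have s2' : (1 < s)%N by apply: leq_trans ss2.
split=> //.
exists (fun n => sparse_bound A rho n m (n %/ s2) (tau n) (n %/ s)); last first.
  move=> n; split; first exact: (sparse_bound_ge0 fs).
  move=> F c v cF v0 sv; apply: (prob_sparse_le fs) => //.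
  have le_d : (2 * (B * tau n) <= n %/ s2)%N by apply: scale_tau => //; rewrite leq_maxr.
  by apply: leq_trans le_d; rewrite leq_pmull.
have van1 : vanishing (fun n => ((a ^ m)%:R * (1 + eps)) ^+ n * rho ^+ ((n * n) %/ c4)).
  by apply: vanishing_expr_square => //; apply: mulr_ege1.
have van2 : vanishing (fun n => ((1 + eps) ^+ 2) ^+ n * lam ^+ (n %/ 2)).
  by apply: vanishing_expr_div => //; rewrite ?exprn_ege1 // -exprM.
apply: (vanishing_le (k := 0) (vanishingD van1 (vanishingZ (a ^ (m * m + m))%:R van2))) => n _.
have sp1 : (sparse_card A n 1 (n %/ s))%:R <= (1 + eps) ^+ n.
  by apply: (hC s) => //; rewrite mulnC leq_trunc_div.
have sp2 : (sparse_card A n m (B * tau n))%:R <= (1 + eps) ^+ n.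
  apply: (hB u); first by rewrite leq_maxl.
  by rewrite mulnCA mulnA mulnC leq_trunc_div.
rewrite ger0_norm; last by apply: mulr_ge0 => //; apply: (sparse_bound_ge0 fs).
have le_d : (2 * (B * tau n) <= n %/ s2)%N by apply: scale_tau => //; rewrite leq_maxr.
have lamn : lam ^+ (n - n %/ s) <= lam ^+ (n %/ 2).
  apply: (ler_wiXn2l lam0 (ltW lam1)).
  by apply: half_leq_sub; apply: leq_div2l.
have rhon : rho ^+ ((n %/ s2 - B * tau n).+1 * (tau n).+1 - 2 * n * (n %/ s)) <=
            rho ^+ ((n * n) %/ c4).
  apply: ler_wiXn2l; rewrite ?ltW //; apply: leq_div_of_mul => //.
  have h := @scale_square s2 u n _ _ s2gt0 u0 erefl erefl le_d.
  have h' : (2 * c4 * (n %/ s) <= n)%N.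
    by apply: leq_trans (leq_trunc_div n s); rewrite mulnC leq_mul2l c4s orbT.
  have h'' : (2 * c4 * n * (n %/ s) <= n * n)%N.
    by rewrite -mulnA [(n * (_ %/ _))%N]mulnC mulnA leq_mul2r h' orbT.
  rewrite mulnBr; move: h h''; set G := (_.+1 * _.+1)%N.
  rewrite (_ : c4 * G = 2 * (2 * s2 * (B * u) * G))%N; last by rewrite /c4; ring.
  rewrite (_ : c4 * (2 * n * (n %/ s)) = 2 * c4 * n * (n %/ s))%N; last by ring.
  exact: leq_double_sub.
rewrite /sparse_bound -/lam.
apply: (@le_trans _ _ ((1 + eps) ^+ n * (lam ^+ (n %/ 2) *
    ((a ^ (n * m))%:R * rho ^+ ((n * n) %/ c4) + (a ^ (m * m + m))%:R * (1 + eps) ^+ n)))).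
  apply: ler_pM; rewrite ?mulr_ge0 ?addr_ge0 ?mulr_ge0 ?exprn_ge0 //.
  apply: ler_pM; rewrite ?addr_ge0 ?mulr_ge0 ?exprn_ge0 //.
  by apply: lerD; rewrite ler_wpM2l.
rewrite [X in (1 + eps) ^+ n * X]mulrDr mulrDr; apply: lerD.
  rewrite [in leRHS]exprMn [(n * m)%N]mulnC expnM natrX.
  set x := (1 + eps) ^+ n; set y := lam ^+ _; set z := (_ ^ m)%:R ^+ n; set w := rho ^+ _.
  have -> : x * (y * (z * w)) = y * (z * x * w) by ring.
  by rewrite ler_piMl ?mulr_ge0 ?exprn_ge0 // exprn_ile1 // ltW.
rewrite -[((1 + eps) ^+ 2) ^+ n]exprM mulnC exprM expr2.
set x := (1 + eps) ^+ n; set y := lam ^+ _; set z := (_ ^ _)%:R.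
by rewrite le_eqVlt; apply/orP; left; apply/eqP; ring.
Qed.

Lemma noncode_small s2 : (1 < s2)%N ->
  (forall n, (sparse_card A n 1 (n %/ s2))%:R <= (1 + 2^-1) ^+ n :> R) ->
  vanishing (fun n => #|[set F : 'M[A]_(m, n) | ~~ code (n %/ s2) F]|%:R /
                      (a ^ (n * m))%:R : R).
Proof.
move=> s20 hs.
(* 3/4 is the growth 3/2 of the sparse vectors divided by the 2 of [card_noncode]. *)
have h0 : 0 <= 3 / 4 :> R by lra.
have h1 : 3 / 4 < 1 :> R by lra.
apply: (vanishing_le (k := 1) (vanishingZ (a ^ (m + 1))%:R (vanishing_expr h0 h1))) => n n1.
have dn : (n %/ s2 < n)%N by apply: ltn_Pdiv.
have := card_noncode A m dn.
rewrite -(ler_nat R) !natrM !natrX => hc.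
have an0 : 0 < (a ^ (n * m))%:R :> R by rewrite ltr0n expn_gt0 a_gt0.
rewrite ger0_norm ?divr_ge0 // ler_pdivrMr //.
have t0 : 0 < 2 ^+ n :> R by rewrite exprn_gt0.
rewrite -(ler_pM2l t0); apply: (le_trans hc).
rewrite (_ : (3 / 4 : R) = (1 + 2^-1) / 2); last by lra.
rewrite expr_div_n.
have -> : 2 ^+ n * (a%:R ^+ (m + 1) * ((1 + 2^-1) ^+ n / 2 ^+ n) * a%:R ^+ (n * m)) =
  a%:R ^+ (m + 1) * (1 + 2^-1) ^+ n * a%:R ^+ (n * m) :> R.
  by field; rewrite gt_eqF.
  by rewrite ler_wpM2r ?exprn_ge0 // ler_wpM2l ?exprn_ge0.
by rewrite -natrX.
Qed.

(** The larger threshold [n %/ s2] is fixed first and [s] is then taken large against it. The error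
    [eps] depends on neither [K] nor [kappa], since both will vary with [n]. *)
Lemma core_asymptotic : exists s0 : nat, forall s, (s0 <= s)%N ->
  exists2 eps : nat -> R, vanishing eps &
  forall n (K : 'M[A]_(m, n) -> {set 'M[A]_(m, n)}) (kappa : R),
  (forall F, code 0 F -> K F \subset lap_range F) -> 0 <= kappa ->
  (forall F, code 0 F -> #|K F|%:R <= kappa) ->
  `|\sum_(E | good_graph A (n %/ s) E) graph_weight q E *
       #|[set F | code (n %/ s) F && (F *m lapmx A E \in K F)]|%:R
    - \sum_(F : 'M[A]_(m, n) | code 0 F) #|K F|%:R / #|lap_range F|%:R| <=
  kappa * eps n.
Proof.
have h2 : 0 < 2^-1 :> R by rewrite invr_gt0.
have [sA hA] := sparse_small A 1 h2.
pose s2 := maxn sA 2.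
have s20 : (1 < s2)%N by rewrite /s2; lia.
have [s0 hs0] := sparse_vanish s20.
have [S2 vS2 hS2] := nonspecial_small (ltnW s20).
have vN : vanishing (fun n => #|[set F : 'M[A]_(m, n) | ~~ code (n %/ s2) F]|%:R /
                      (a ^ (n * m))%:R : R).
  apply: noncode_small => // n; apply: (hA s2); first by rewrite leq_maxl.
  by rewrite mulnC leq_trunc_div.
exists s0 => s ss0; have [ss2 [Bd vB hB]] := hs0 s ss0.
have s_gt0 : (0 < s)%N by apply: leq_trans ss2; apply: ltnW.
have [S1 vS1 hS1] := nonspecial_small s_gt0.
have [n1 hn1] := vS1 1 ltr01.
exists (fun n => 2 * S2 n + (sparse_card A n 1 (n %/ s))%:R * Bd n +
    #|[set F : 'M[A]_(m, n) | ~~ code (n %/ s2) F]|%:R / (a ^ (n * m))%:R *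
      (2 * (a ^ ((m + 1) * m))%:R + 2 * S1 n)).
  apply: vanishingD; first by apply: vanishingD => //; apply: vanishingZ.
  apply: (vanishing_le (k := n1) (vanishingZ (2 * (a ^ ((m + 1) * m))%:R + 2) (vanishing_norm vN))).
  move=> n /hn1; have [S10 _] := hS1 n; rewrite (ger0_norm S10) => S1le.
  rewrite normrM mulrC ler_wpM2r // ger0_norm ?addr_ge0 ?mulr_ge0 //.
  by rewrite lerD2l -[leRHS]mulr1 ler_wpM2l.
move=> n K kappa hK k0 hk.
have [S10 S1P] := hS1 n; have [S20 S2P] := hS2 n; have [Bd0 BdP] := hB n.
by apply: (core_sum fs (d2 := (n %/ s2)%N)) => //; apply: leq_div2l => //; apply: ltnW.
Qed.

End CoreAsymptotic.

(** The case [m = 0] of [sparse_vanish]: without rows the affine functions are the constants, and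
    the code property reduces to [n %/ 2 < n]. *)
Lemma prob_not_good (A : finComNzRingType) (R : realType) (e : A -> R[i]) (q rho : R) :
  fourier_setup e q rho ->
  exists s0 : nat, forall s, (s0 <= s)%N ->
  vanishing (fun n => prob q (fun E : graph n => ~~ good_graph A (n %/ s) E)).
Proof.
move=> fs; have [s0 hs0] := sparse_vanish fs 0 (isT : 1 < 2)%N.
exists s0 => s /hs0[_ [Bd vB hB]].
have q0 : 0 < q by case: fs => _ _ _ [/andP[]].
have q1 : q < 1 by case: fs => _ _ _ [/andP[]].
apply: (vanishing_le (k := 1) vB) => n n1.
have [Bd0 hBn] := hB n.
rewrite ger0_norm ?(prob_ge0 fs) //.
have c0 : code (n %/ 2) (0 : 'M[A]_(0, n)).
  apply/forallP => l; apply/implyP => l0.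
  have -> : vsupport (l *m augment (0 : 'M[A]_(0, n))) = [set: 'I_n].
    apply/setP => i; rewrite !inE -[l]hsubmxK /augment mul_row_col !mxE big_ord0 add0r big_ord1 !mxE mulr1.
    apply/negP => /eqP h; case/negP: l0; apply/eqP/rowP => j; rewrite [RHS]mxE -h.
    by congr (l _ _); apply: val_inj; case: j => -[].
  by rewrite cardsT card_ord ltn_Pdiv.
pose D := [set v : 'rV[A]_n | (v != 0) && (#|vsupport v| <= n %/ s)%N].
apply: (@le_trans _ _ (\sum_(v in D) prob q (fun E => v *m lapmx A E == 0))).
  apply: prob_or_le => // E; rewrite negb_forall => /existsP[v].
  rewrite negb_imply negbK => /andP[vD vL].
  by apply/existsP; exists v; rewrite inE vD vL.
apply: (@le_trans _ _ (\sum_(v in D) Bd n)).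
  apply: ler_sum => v; rewrite inE => /andP[v0 sv].
  have := hBn 0 0 v c0 v0 sv; rewrite muln0 expn0 mulr1; apply: le_trans.
  apply: prob_le => // E; rewrite !unfold_in => ->; rewrite andbT mul0mx eqxx //.
rewrite sumr_const -[leLHS]mulr_natl ler_wpM2r // ler_nat.
apply: leq_trans (card_vsparse A n (n %/ s)); apply: subset_leq_card.
by apply/fintype.subsetP => v; rewrite !inE => /andP[].
Qed.

(** * Faithful characters of cyclic groups *)

Lemma exists_prim_root (C : numClosedFieldType) M : (0 < M)%N ->
  exists z : C, M.-primitive_root z.
Proof.
move=> M0; have [rs rsE] := closed_field_poly_normal ('X^M - 1 : {poly C}).
move: rsE; rewrite lead_coefDl ?lead_coefXn ?scale1r; last first.
  by rewrite size_polyXn size_polyN size_poly1 ltnS.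
move=> rsE.
have sz : size rs = M.
  by have := congr1 (fun s : {poly C} => size s) rsE; rewrite size_XnsubC // size_prod_XsubC => -[].
have rs_uniq : uniq rs.
  by rewrite -separable_prod_XsubC -rsE separable_Xn_sub_1 // pnatr_eq0 -lt0n.
have rs_unity : all M.-unity_root rs.
  by apply/allP => x xrs; rewrite /root_of_unity rsE root_prod_XsubC.
have /hasP[z _ pz] := has_prim_root M0 rs_unity rs_uniq (eq_leq (esym sz)).
by exists z.
Qed.

(** On the unit circle the squared norm is [1 - 2 q (1 - q) (1 - x)], with [x] the real part of
    [z]. *)
Lemma norm_mix_lt1 (R : realType) (q : R) (z : R[i]) : 0 < q -> q < 1 ->
  `|z| = 1 -> z != 1 -> `|q%:C%C * z + (1 - q%:C%C)| < 1.
Proof.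
case: z => x y q0 q1 /eqP; rewrite normc_def /= => /eqP nz nz1.
have xy1 : x ^+ 2 + y ^+ 2 = 1.
  have s0 : 0 <= x ^+ 2 + y ^+ 2 by rewrite addr_ge0 ?sqr_ge0.
  case: nz => h; by rewrite -[LHS](sqr_sqrtr s0) h expr1n.
have x1 : x < 1.
  rewrite lt_neqAle; apply/andP; split; last by move: xy1; have := sqr_ge0 y; nra.
  apply: contra nz1 => /eqP x1; move: xy1; rewrite x1 expr1n => /eqP.
  by rewrite -subr_eq0 addrAC subrr add0r sqrf_eq0 => /eqP ->.
rewrite normc_def /= -[X in _ < X]/(1%:C%C) ltcR -[X in _ < X]sqrtr1.
rewrite ltr_sqrt // !mul0r !subr0 !addr0.
have y2 : y ^+ 2 = 1 - x ^+ 2 by rewrite -xy1 addrC addKr.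
rewrite [(q * y) ^+ 2]exprMn y2 -subr_gt0.
rewrite (_ : _ - _ = 2 * q * (1 - q) * (1 - x)); last by ring.
by rewrite !mulr_gt0 ?subr_gt0.
Qed.

Lemma exists_fourier_setup (R : realType) (q : R) M : 0 < q -> q < 1 -> (1 < M)%N ->
  exists (e : 'Z_M -> R[i]) (rho : R), fourier_setup e q rho.
Proof.
move=> q0 q1 M1; have [z pz] := @exists_prim_root R[i] M (ltnW M1).
pose e (a : 'Z_M) := z ^+ (a : nat).
have zM : z ^+ M = 1 := prim_expr_order pz.
have eD a b : e (a + b) = e a * e b.
  have zM' : z ^+ (Zp_trunc M).+2 = 1 by rewrite Zp_cast.
  by rewrite /e /= (expr_mod _ zM') exprD.
have nz : `|z| = 1.
  have : `|z| ^+ M = 1 by rewrite -normrX zM normr1.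
  by move/eqP; rewrite pexpr_eq1 // ?(ltnW M1) // => /eqP.
have ne a : `|e a| = 1 by rewrite /e normrX nz expr1n.
have e_inj a : e a = 1 -> a = 0.
  move/eqP; rewrite /e -(prim_order_dvd pz) => /dvdnP[k ak].
  have : (a < M)%N by rewrite -[X in (_ < X)%N](Zp_cast M1) ltn_ord.
  by rewrite ak; case: k ak => [|k] ak; [move=> _; apply: val_inj | rewrite mulSn; lia].
pose nrm (w : R[i]) : R := Num.sqrt (complex.Re w ^+ 2 + complex.Im w ^+ 2).
pose mix a := nrm (q%:C%C * e a + (1 - q%:C%C)).
have mix_lt1 a : a != 0 -> mix a < 1.
  move=> a0; rewrite -ltcR /mix /nrm -normc_def.
  by apply: norm_mix_lt1 => //; apply: contra a0 => /eqP /e_inj ->.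
(* The base value 1/2 keeps [r] positive; [rho] is its square root because the setup bounds by
   [rho ^+ 2]. *)
pose r := \big[Num.max/2^-1]_(a : 'Z_M | a != 0) mix a.
have r0 : 0 < r.
  by apply: (lt_le_trans (_ : 0 < 2^-1)); rewrite ?invr_gt0 //; apply: bigmax_ge_id.
have r1 : r < 1.
  by apply/bigmax_ltP; split=> [|a a0]; [rewrite invf_lt1 // ltr1n | exact: mix_lt1].
exists e, (Num.sqrt r); split => //.
  split; first by rewrite q0 q1.
  by rewrite sqrtr_gt0 r0 /= -[X in _ < X]sqrtr1 ltr_sqrt.
move=> a a0; rewrite (sqr_sqrtr (ltW r0)) normc_def lecR.
by apply: (le_bigmax_cond _ (fun a => mix a)).
Qed.

(** * The prescribed values of [F *m L] *)

Lemma card_image_kernel (X Y : finZmodType) (f : {additive X -> Y}) (S : {set X}) :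
  (forall x k, x \in S -> f k = 0 -> x + k \in S) ->
  (#|f @: S| * #|[set k | f k == 0%R]| = #|S|)%N.
Proof.
move=> inv; rewrite -[RHS]sum1_card (partition_big f (mem (f @: S))) /=; last first.
  by move=> x xS; apply: imset_f.
rewrite -sum_nat_const; apply: eq_bigr => y /imsetP[x0 x0S ->].
rewrite sum1_card -[#|[set k | _]|](card_imset _ (addrI x0)); apply: eq_card => x.
rewrite [RHS]unfold_in; apply/imsetP/andP => [[k]|[xS /eqP fx]].
  by rewrite inE => /eqP fk ->; rewrite inv // raddfD /= fk addr0.
exists (x - x0); last by rewrite addrCA subrr addr0.
by rewrite inE raddfB /= fx subrr.
Qed.

Lemma card_mx_entries (T : finType) m n (C : 'I_m -> 'I_n -> {set T}) :
  #|[set W : 'M[T]_(m, n) | [forall i, forall j, W i j \in C i j]]| =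
  (\prod_(i < m) \prod_(j < n) #|C i j|)%N.
Proof.
rewrite pair_big /=.
transitivity #|family (fun u : 'I_m * 'I_n => mem (C u.1 u.2))|; last by rewrite card_family foldrE big_map big_enum.
pose g (f : {ffun 'I_m * 'I_n -> T}) : 'M[T]_(m, n) := \matrix_(i, j) f (i, j).
have g_inj : injective g.
  by move=> f f' /matrixP ff'; apply/ffunP => -[i j]; have := ff' i j; rewrite !mxE.
rewrite -(fintype.card_image g_inj); apply: eq_card => W; rewrite inE.
apply/forallP/fintype.imageP => [h|[f /familyP ff ->] i].
  exists [ffun u => W u.1 u.2]; last by apply/matrixP => i j; rewrite !mxE ffunE.
  by apply/familyP => u; rewrite ffunE; have /forallP := h u.1.
by apply/forallP => j; rewrite mxE; apply: (ff (i, j)).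
Qed.

Section PrimePower.
Variables (p N : nat).
Hypotheses (p_pr : prime p) (N0 : (0 < N)%N).
Local Notation A := 'Z_(p ^ N).

Lemma pN_gt1 : (1 < p ^ N)%N.
Proof. by rewrite -(exp1n N) ltn_exp2r // prime_gt1. Qed.

Lemma card_ZpN : #|A| = (p ^ N)%N.
Proof. by rewrite card_ord Zp_cast // pN_gt1. Qed.

Lemma ZpN_eq0 k : (k%:R == 0 :> A) = (p ^ N %| k)%N.
Proof. by rewrite -val_eqE /= val_Zp_nat ?pN_gt1. Qed.

Definition ppow (j : nat) : A := (p ^ j)%:R.

Lemma ppowD i j : ppow (i + j) = ppow i * ppow j.
Proof. by rewrite /ppow expnD natrM. Qed.

Lemma ppowN : ppow N = 0.
Proof. by apply/eqP; rewrite ZpN_eq0. Qed.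

Lemma ppow_mul_eq0 j (x : A) : (j <= N)%N ->
  (ppow j * x == 0) = (p ^ (N - j) %| x)%N.
Proof.
move=> jN; rewrite -[x in LHS]natr_Zp -natrM ZpN_eq0.
by rewrite -{1}(subnKC jN) expnD dvdn_pmul2l // expn_gt0 prime_gt0.
Qed.

Lemma ppow_annP j (x : A) : (j <= N)%N -> ppow j * x = 0 -> exists y, x = ppow (N - j) * y.
Proof.
move=> jN /eqP; rewrite ppow_mul_eq0 // => /dvdnP[k xk]; exists k%:R.
by rewrite -natrM mulnC -xk natr_Zp.
Qed.

Definition ppow_ann j : {set A} := [set x : A | ppow j * x == 0].

Lemma card_ppow_ann j : (j <= N)%N -> #|ppow_ann j| = (p ^ j)%N.
Proof.
move=> jN; rewrite -[RHS]card_ord.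
have q0 : (0 < p ^ (N - j))%N by rewrite expn_gt0 prime_gt0.
have h_inj : injective (fun y : 'I_(p ^ j) => (p ^ (N - j) * y)%:R : A).
  move=> y y' /(congr1 val) /=; rewrite !val_Zp_nat ?pN_gt1 // !modn_small.
  - by move/eqP; rewrite eqn_pmul2l // => /eqP/val_inj.
  - by rewrite -{2}(subnK jN) expnD ltn_pmul2l // ltn_ord.
  - by rewrite -{2}(subnK jN) expnD ltn_pmul2l // ltn_ord.
rewrite -(fintype.card_image h_inj); apply: eq_card => x; rewrite inE ppow_mul_eq0 //.
apply/idP/fintype.imageP => [/dvdnP[k xk]|[y _ ->]].
  have kj : (k < p ^ j)%N.
    have : (x < p ^ N)%N by rewrite -[X in (_ < X)%N](Zp_cast pN_gt1) ltn_ord.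
    by rewrite xk -{2}(subnKC jN) expnD ltn_pmul2r.
  by exists (Ordinal kj) => //=; rewrite mulnC -xk natr_Zp.
by rewrite val_Zp_nat ?pN_gt1 // /dvdn modn_dvdm ?dvdn_exp2l ?leq_subr // modnMr.
Qed.

Definition in_ppow j (x : A) : bool := [exists y, x == ppow j * y].

Lemma in_ppowP j x : reflect (exists y, x = ppow j * y) (in_ppow j x).
Proof. by apply: (iffP existsP) => -[y /eqP]; exists y => //; apply/eqP. Qed.

Lemma in_ppow_sum (I : finType) j (f : I -> A) :
  (forall i, in_ppow j (f i)) -> in_ppow j (\sum_i f i).
Proof.
move=> h; elim/big_ind: _ => // [|x y /in_ppowP[u ->] /in_ppowP[v ->]].
  by apply/in_ppowP; exists 0; rewrite mulr0.
by apply/in_ppowP; exists (u + v); rewrite mulrDr.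
Qed.

Lemma in_ppow_mull j x y : in_ppow j x -> in_ppow j (y * x).
Proof. by move=> /in_ppowP[u ->]; apply/in_ppowP; exists (y * u); rewrite mulrCA. Qed.

Lemma in_ppow_leq i j x : (i <= j)%N -> in_ppow j x -> in_ppow i x.
Proof.
move=> ij /in_ppowP[u ->]; apply/in_ppowP; exists (ppow (j - i) * u).
by rewrite mulrA -ppowD subnKC.
Qed.

Lemma in_ppowD j x y : in_ppow j x -> in_ppow j y -> in_ppow j (x + y).
Proof.
by move=> /in_ppowP[u ->] /in_ppowP[v ->]; apply/in_ppowP; exists (u + v); rewrite mulrDr.
Qed.

Section Targets.
Variables (m : nat) (ex : 'I_m -> nat) (wx : 'I_m -> 'I_m -> nat) (Gam : 'M[A]_m).
Local Notation mu c a := (wx c a + ex a)%N.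
Hypothesis ex_le : forall a, (ex a <= N)%N.
Hypothesis muC : forall c a, mu c a = mu a c.
Hypothesis mu_le : forall c a, (mu c a <= N)%N.
Hypothesis Gam_sym : forall c a, ppow (ex a) * Gam c a = ppow (ex c) * Gam a c.

Let wx_le c a : (wx c a <= N)%N. Proof. exact: leq_trans (leq_addr _ _) (mu_le c a). Qed.

Definition scale n (T : 'M[A]_(m, n)) : 'M[A]_(m, n) := \matrix_(a, j) (ppow (ex a) * T a j).

Lemma scale_is_additive n : additive (@scale n).
Proof. by move=> T T'; apply/matrixP => a j; rewrite !mxE mulrBr. Qed.

HB.instance Definition _ n :=
  GRing.isAdditive.Build 'M[A]_(m, n) 'M[A]_(m, n) (@scale n) (@scale_is_additive n).

Definition in_shift (Q : 'M[A]_m) : bool :=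
  [forall c, forall a, in_ppow (wx c a) (Q c a - Gam c a)].

(** [T] is the quotient of [F L] by the row moduli [p ^ ex a]. As [F L F^T] has entries
    [ppow (ex a) * (F T^T) c a], a congruence for [F T^T] modulo [p ^ wx c a] is one for this
    symmetric matrix modulo [p ^ mu c a]; by [muC] and [Gam_sym] the entries (c, a) and (a, c)
    impose the same condition. *)
Definition targets n (F : 'M[A]_(m, n)) : {set 'M[A]_(m, n)} :=
  [set T | in_shift (F *m T^T) && (scale T \in lap_range F)].

Definition values n (F : 'M[A]_(m, n)) := (@scale n) @: targets F.

Lemma values_sub n (F : 'M[A]_(m, n)) : values F \subset lap_range F.
Proof. by apply/fintype.subsetP => c /imsetP[T]; rewrite inE => /andP[_ ?] ->. Qed.

Lemma card_scale_ker n :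
  #|[set T : 'M[A]_(m, n) | scale T == 0]| = ((\prod_a p ^ ex a) ^ n)%N.
Proof.
transitivity (\prod_(a < m) \prod_(j < n) #|ppow_ann (ex a)|)%N.
  rewrite -[RHS](@card_mx_entries _ m n (fun a _ => ppow_ann (ex a))).
  apply: eq_card => T; rewrite !inE; apply/eqP/forallP => [/matrixP h a|h].
    by apply/forallP => j; have := h a j; rewrite inE !mxE => ->.
  by apply/matrixP => a j; have /forallP/(_ j) := h a; rewrite inE !mxE => /eqP.
rewrite (big_morph (fun x => x ^ n)%N (fun x y => expnMn x y n) (exp1n n)).
apply: eq_bigr => a _.
by rewrite prod_nat_const card_ord card_ppow_ann.
Qed.

(** Scaling determines row [a] of [T] up to multiples of [p ^ (N - ex a)], and [mu_le] makes such a
    change invisible to the shift condition. *)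
Lemma card_values n (F : 'M[A]_(m, n)) :
  (#|values F| * (\prod_a p ^ ex a) ^ n = #|targets F|)%N.
Proof.
rewrite -card_scale_ker; apply: card_image_kernel => T k; rewrite !inE => /andP[sT lT] k0.
apply/andP; split; last by rewrite raddfD /= k0 addr0.
apply/forallP => c; apply/forallP => a; have /forallP/(_ a) := forallP sT c.
move=> hT; have -> : F *m (T + k)^T = F *m T^T + F *m k^T by rewrite linearD /= mulmxDr.
rewrite mxE addrAC; apply: in_ppowD => //.
rewrite mxE; apply: in_ppow_sum => j; apply: in_ppow_mull; rewrite mxE.
apply: (@in_ppow_leq _ (N - ex a)); first by rewrite -(leq_add2r (ex a)) subnK.
by apply/in_ppowP/ppow_annP => //; have /matrixP/(_ a j) := k0; rewrite !mxE.
Qed.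

Definition shift_sym_mxs := [set Q : 'M[A]_m | in_shift Q &&
  [forall c, forall a, ppow (ex a) * Q c a == ppow (ex c) * Q a c]].

Definition torsion_rows := [set t : 'rV[A]_m | [forall i, forall a, t i a \in ppow_ann (ex a)]].

Lemma targets_augment n (F : 'M[A]_(m, n)) :
  targets F = [set T | augment F *m T^T \in
    [set X | (usubmx X \in shift_sym_mxs) && (dsubmx X \in torsion_rows)]].
Proof.
apply/setP => T; rewrite !inE /augment mul_col_mx col_mxKu col_mxKd -andbA; congr (_ && _).
have QE c a : (scale T *m F^T) c a = ppow (ex c) * (F *m T^T) a c.
  by rewrite !mxE mulr_sumr; apply: eq_bigr => j _; rewrite !mxE -mulrA [T c j * _]mulrC.
have tE i a : (scale T *m const_mx (n := 1) 1) a i = ppow (ex a) * (const_mx (m := 1) 1 *m T^T) i a.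
  by rewrite !mxE mulr_sumr; apply: eq_bigr => j _; rewrite !mxE mul1r mulr1.
congr (_ && _).
  apply/eqP/forallP => [/matrixP h c|h].
    by apply/forallP => a; have := h c a; rewrite mxE !QE => ->.
  by apply/matrixP => c a; rewrite mxE !QE; apply/eqP; exact: (forallP (h c) a).
apply/eqP/forallP => [/matrixP h i|h].
  by apply/forallP => a; have := h a i; rewrite tE inE => ->; rewrite mxE.
by apply/matrixP => a i; have /forallP/(_ a) := h i; rewrite inE tE => /eqP ->; rewrite mxE.
Qed.

Lemma card_torsion_rows : #|torsion_rows| = (\prod_a p ^ ex a)%N.
Proof.
rewrite (@card_mx_entries _ 1 m (fun _ a => ppow_ann (ex a))).
by rewrite big_ord1; apply: eq_bigr => a _; rewrite card_ppow_ann.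
Qed.

(** The matrices [Z] for which [Gam + weight Z] has the symmetry required in [shift_sym_mxs]. *)
Definition twisted_sym_mxs := [set Z : 'M[A]_m |
  [forall c, forall a, ppow (mu c a) * (Z c a - Z a c) == 0]].

Definition weight (Z : 'M[A]_m) : 'M[A]_m := \matrix_(c, a) (ppow (wx c a) * Z c a).

Lemma weight_is_additive : additive weight.
Proof. by move=> Z Z'; apply/matrixP => a j; rewrite !mxE mulrBr. Qed.

HB.instance Definition _ :=
  GRing.isAdditive.Build 'M[A]_m 'M[A]_m weight weight_is_additive.

Lemma card_shift_sym :
  (#|shift_sym_mxs| * (\prod_c \prod_a p ^ wx c a) = #|twisted_sym_mxs|)%N.
Proof.
have -> : (\prod_c \prod_a p ^ wx c a)%N = #|[set Z | weight Z == 0]|.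
  transitivity (\prod_(c < m) \prod_(a < m) #|ppow_ann (wx c a)|)%N.
    by apply: eq_bigr => c _; apply: eq_bigr => a _; rewrite card_ppow_ann.
  rewrite -[LHS](@card_mx_entries _ m m (fun c a => ppow_ann (wx c a))).
  apply: eq_card => T; rewrite !inE; apply/forallP/eqP => [h|/matrixP h c].
    by apply/matrixP => a j; have /forallP/(_ j) := h a; rewrite inE !mxE => /eqP.
  by apply/forallP => j; have := h c j; rewrite inE !mxE => ->.
rewrite -(@card_image_kernel _ _ weight twisted_sym_mxs); last first.
  move=> Z k; rewrite !inE => /forallP hZ /matrixP k0.
  apply/forallP => c; apply/forallP => a; have /forallP/(_ a)/eqP hca := hZ c.
  have k1 : ppow (mu c a) * k c a = 0.
    by have := k0 c a; rewrite !mxE addnC ppowD -mulrA => ->; rewrite mulr0.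
  have k2 : ppow (mu c a) * k a c = 0.
    by have := k0 a c; rewrite muC !mxE addnC ppowD -mulrA => ->; rewrite mulr0.
  rewrite !mxE; apply/eqP.
  rewrite (_ : _ * _ = ppow (mu c a) * (Z c a - Z a c) + ppow (mu c a) * k c a - ppow (mu c a) * k a c).
    by rewrite hca k1 k2 addr0 subr0.
  by ring.
congr (_ * _)%N.
rewrite -[#|weight @: _|](card_imset _ (addrI Gam)); apply: eq_card => Q.
apply/idP/imsetP => [|[X /imsetP[Z]]].
  rewrite inE => /andP[/forallP sh /forallP sy].
  pose Z := \matrix_(c, a) odflt 0 [pick y | Q c a - Gam c a == ppow (wx c a) * y].
  have QZ : Q = Gam + weight Z.
    apply/matrixP => c a; rewrite !mxE; case: pickP => [y /eqP <-|none] /=.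
      by rewrite addrC subrK.
    have /forallP/(_ a)/existsP[y] := sh c.
    by rewrite none.
  exists (weight Z) => //; apply: imset_f; rewrite inE.
  apply/forallP => c; apply/forallP => a; have /forallP/(_ a)/eqP := sy c.
  have QE i j : Q i j = Gam i j + ppow (wx i j) * Z i j.
    by rewrite [in LHS]QZ [LHS]mxE [weight Z i j]mxE.
  rewrite !QE !mulrDr Gam_sym => /addrI.
  rewrite !mulrA -!ppowD ![(ex _ + _)%N]addnC => h.
  by rewrite mulrN h (muC c a) subrr.
rewrite inE => /forallP hZ -> ->; rewrite inE; apply/andP; split.
  apply/forallP => c; apply/forallP => a; apply/in_ppowP; exists (Z c a).
  by rewrite !mxE addrAC subrr add0r.
apply/forallP => c; apply/forallP => a; have /forallP/(_ a) := hZ c.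
have QE i j : (Gam + weight Z) i j = Gam i j + ppow (wx i j) * Z i j by rewrite !mxE.
rewrite !QE mulrBr subr_eq0 => /eqP h; apply/eqP; rewrite !mulrDr Gam_sym; congr (_ + _).
by rewrite !mulrA -!ppowD ![(ex _ + _)%N]addnC h muC.
Qed.

(** Entries on and above the diagonal are free; an entry below differs from its mirror image by an
    element killed by [p ^ mu c a]. *)
Lemma card_twisted_sym : #|twisted_sym_mxs| =
  (#|symmetric_mxs A m| * \prod_(c < m) \prod_(a < m) (if a < c then p ^ mu c a else 1))%N.
Proof.
pose C (c a : 'I_m) := if (a < c)%N then ppow_ann (mu c a) else [set 0].
transitivity (#|symmetric_mxs A m| * #|[set W : 'M[A]_m | [forall c, forall a, W c a \in C c a]]|)%N.
  rewrite -cardsX -(card_in_imset (f := fun u : 'M[A]_m * 'M[A]_m => u.1 + u.2)).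
    apply: eq_card => Z; rewrite inE; apply/forallP/imsetP => [h|[[S W]]].
      pose S := \matrix_(c, a) if (a < c)%N then Z a c else Z c a.
      exists (S, Z - S); last by rewrite /= addrC subrK.
      rewrite !inE /=; apply/andP; split.
        apply/eqP/matrixP => c a; rewrite !mxE.
        by case: (ltngtP a c) => // /ord_inj ->.
      apply/forallP => c; apply/forallP => a; rewrite /C !mxE.
      case: ifP => ac; last by rewrite inE subrr.
      by rewrite inE; have /forallP/(_ a) := h c.
    rewrite !inE /= => /andP[/eqP SS /forallP hW] -> c; apply/forallP => a.
    have Sca : S c a = S a c by rewrite -{1}SS mxE.
    have W1 := forallP (hW c) a; have W2 := forallP (hW a) c.
    rewrite !mxE Sca (_ : S a c + W c a - (S a c + W a c) = W c a - W a c); last by ring.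
    move: W1 W2; rewrite /C; case: (ltngtP a c) => ac; rewrite !inE.
    - by move=> w1 /eqP->; rewrite subr0.
    - by move=> /eqP-> w2; rewrite sub0r mulrN oppr_eq0 muC.
    - by move=> /eqP-> /eqP->; rewrite subrr mulr0.
  move=> [S W] [S' W']; rewrite !inE /= => /andP[/eqP SS /forallP hW] /andP[/eqP SS' /forallP hW'] e.
  have eS : S = S'.
    have up (c a : 'I_m) : (c <= a)%N -> S c a = S' c a.
      move=> ca; have := congr1 (fun X : 'M[A]_m => X c a) e; rewrite !mxE.
      have := forallP (hW c) a; have := forallP (hW' c) a.
      by rewrite /C ltnNge ca /= !inE => /eqP-> /eqP->; rewrite !addr0.
    apply/matrixP => c a; case: (leqP c a) => [/up //|/ltnW/up h].
    by rewrite -SS -SS' !mxE.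
  by move: e; rewrite eS => /addrI ->.
congr (_ * _)%N; rewrite (@card_mx_entries _ m m C).
apply: eq_bigr => c _; apply: eq_bigr => a _; rewrite /C.
by case: ifP => _; [rewrite card_ppow_ann | rewrite cards1].
Qed.

(** The ratio of the two cardinals does not depend on [F], which makes the reference sum of
    [core_asymptotic] computable. *)
Lemma card_values_range (R : realType) (e : A -> R[i]) (q rho : R) n (F : 'M[A]_(m, n)) :
  fourier_setup e q rho -> inj_rows (augment F) ->
  (#|values F| * (\prod_a p ^ ex a) ^ n * (\prod_c \prod_a p ^ wx c a) =
   #|lap_range F| * (\prod_a p ^ ex a) *
     \prod_(c < m) \prod_(a < m) (if a < c then p ^ mu c a else 1))%N.
Proof.
move=> fs injF; rewrite card_values targets_augment.
have a0 : (0 < #|A| ^ ((m + 1) * m))%N by rewrite expn_gt0 card_ZpN expn_gt0 prime_gt0.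
apply/eqP; rewrite -(eqn_pmul2r a0); apply/eqP.
rewrite mulnAC (card_fiber_set fs _ injF).
have -> : #|[set X : 'M[A]_(m + 1, m) | (usubmx X \in shift_sym_mxs) && (dsubmx X \in torsion_rows)]|
    = (#|shift_sym_mxs| * #|torsion_rows|)%N.
  rewrite -cardsX -(card_imset _ (f := fun u : 'M[A]_m * 'rV[A]_m => col_mx u.1 u.2)).
    apply: eq_card => X; rewrite inE; apply/idP/imsetP => [h|[[Q t]]].
      by exists (usubmx X, dsubmx X); rewrite ?vsubmxK // inE.
    by rewrite inE => /andP[h1 h2] ->; rewrite col_mxKu col_mxKd h1.
  by move=> [Q t] [Q' t'] /eq_col_mx[/= -> ->].
rewrite card_torsion_rows.
transitivity (#|twisted_sym_mxs| * (\prod_a p ^ ex a) * #|A| ^ (n * m))%N.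
  by rewrite -card_shift_sym; ring.
rewrite card_twisted_sym.
transitivity (#|lap_range F| * #|A| ^ ((m + 1) * m) * (\prod_a p ^ ex a) *
   \prod_(c < m) \prod_(a < m) (if a < c then p ^ mu c a else 1))%N; last by ring.
by rewrite (card_lap_range fs injF); ring.
Qed.

End Targets.
End PrimePower.

(** * Duality pairings and embeddings *)

Lemma modZD x y : modZ (x + y) = modZ x + modZ y.
Proof. by rewrite /modZ raddfD. Qed.

Lemma modZN x : modZ (- x) = - modZ x.
Proof. by rewrite /modZ raddfN. Qed.

Lemma modZ_sum (I : Type) (r : seq I) (P : pred I) (f : I -> rat) :
  modZ (\sum_(i <- r | P i) f i) = \sum_(i <- r | P i) modZ (f i).
Proof. by rewrite /modZ raddf_sum. Qed.

Lemma modZ_mulz x (z : int) : modZ (x *~ z) = modZ x *~ z.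
Proof. by rewrite /modZ raddfMz. Qed.

Lemma modZ_eqP x y : modZ x = modZ y <-> x - y \is a Num.int.
Proof.
split=> [/eqP|]; last exact: modZ_eq.
by rewrite /modZ -Quotient.idealrBE.
Qed.

Lemma modZ_eq0 x : modZ x = 0 <-> x \is a Num.int.
Proof.
have -> : (0 : QZ) = modZ 0 by rewrite /modZ raddf0.
by rewrite modZ_eqP subr0.
Qed.

Definition liftQ (t : QZ) : rat := repr t.

Lemma liftQK t : modZ (liftQ t) = t.
Proof. exact: reprK. Qed.

Lemma QZ_torsion (t : QZ) (k : nat) : (0 < k)%N -> t *+ k = 0 ->
  exists z : int, t = modZ (z%:~R / k%:R).
Proof.
move=> k0; rewrite -[t]liftQK -[_ *+ k]/(modZ _ *~ k%:Z) -modZ_mulz => /modZ_eq0.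
move=> /intrP[z hz]; exists z; congr modZ.
by rewrite -hz -mulrzr mulfK // pnatr_eq0 -lt0n.
Qed.

Lemma natr_dvd_int (z : int) (k : nat) : (0 < k)%N ->
  (z%:~R / k%:R : rat) \is a Num.int -> (k%:Z %| z)%Z.
Proof.
move=> k0 /intrP[y hy]; apply/dvdzP; exists y.
have k0' : (k%:R : rat) != 0 by rewrite pnatr_eq0 -lt0n.
apply: (@intr_inj rat); rewrite intrM -hy -[k%:Z%:~R]/(k%:R) divfK //.
Qed.

Section PGroupBasis.
Variables (p : nat) (G : finZmodType) (pairG : G -> G -> QZ).
Hypotheses (p_pr : prime p) (pG : (p.-group [set: G])%g) (dG : duality_pairing pairG).

Lemma exists_basis : exists (r : nat) (g : 'I_r -> G) (ex : 'I_r -> nat),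
  [/\ forall a, (0 < ex a)%N,
      forall a, g a *+ (p ^ ex a) = 0,
      forall z : 'I_r -> int, \sum_a g a *~ z a = 0 -> forall a, ((p ^ ex a)%N%:Z %| z a)%Z,
      forall b, exists z : 'I_r -> int, b = \sum_a g a *~ z a &
      (\prod_a p ^ ex a)%N = #|G| ].
Proof.
have abG : abelian [set: G] by apply/centsP => x _ y _; exact: addrC.
have [b defG ob] := abelian_structure abG.
pose r := size b; pose g (a : 'I_r) := tnth (in_tuple b) a.
have og a : (1 < #[g a]%g)%N.
  have : #[g a]%g \in abelian_type [set: G].
    by rewrite -ob; apply: map_f; rewrite mem_tnth.
  by move=> h; have := allP (abelian_type_gt1 [set: G]) _ h.
pose ex a := logn p #[g a]%g.
have oE a : #[g a]%g = (p ^ ex a)%N.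
  have /p_natP[k hk] : p.-nat #[g a]%g by apply: (mem_p_elt pG); rewrite inE.
  by rewrite /ex hk pfactorK.
have defG' : \big[dprod/1%g]_(a < r) <[g a]>%g = [set: G].
  by rewrite -defG (big_tnth _ _ b).
exists r, g, ex; split.
- by move=> a; have := og a; rewrite oE; case: (ex a).
- move=> a; rewrite -oE; have := expg_order (g a); by rewrite FinRing.zmodXgE.
- move=> z z0 a.
  have cyc (x : G) (y : int) : x *~ y \in <[x]>%g.
    case: y => k; first by rewrite -pmulrn -FinRing.zmodXgE mem_cycle.
    by rewrite NegzE mulrNz -pmulrn -FinRing.zmodXgE -FinRing.zmodVgE groupV mem_cycle.
  have [c [_ _ uniq]] := mem_bigdprod defG' (finset.in_setT (0 : G)).
  have e1 := uniq (fun a => g a *~ z a) (fun a _ => cyc _ _) (esym z0) a isT.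
  have e2 : 1%g = c a.
    by apply: (uniq (fun=> 1%g)) => //; rewrite big1.
  have ga0 : g a *~ z a = 0 by rewrite e1 -e2.
  have gk k : g a *+ k = 0 -> (p ^ ex a %| k)%N.
    by rewrite -FinRing.zmodXgE -oE => /eqP; rewrite -order_dvdn.
  case: (z a) ga0 => k; first by rewrite -pmulrn => /gk.
  by rewrite NegzE mulrNz -pmulrn => /eqP; rewrite oppr_eq0 dvdzE abszN => /eqP/gk.
- move=> x; have [c [cg xE _]] := mem_bigdprod defG' (finset.in_setT x).
  have cE a : exists k : nat, c a = g a *+ k.
    by have /cycleP[k ->] := cg a isT; exists k; rewrite FinRing.zmodXgE.
  have [k hk] := choice cE; exists (fun a => (k a)%:Z); rewrite xE.
  by apply: eq_bigr => a _; rewrite -pmulrn.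
- rewrite -cardsT -(bigdprod_card defG'); apply: eq_bigr => a _.
  by rewrite -oE.
Qed.

End PGroupBasis.

Section Dual.
Variables (p : nat) (G : finZmodType) (pairG : G -> G -> QZ).
Hypotheses (p_pr : prime p) (dG : duality_pairing pairG).
Variables (r : nat) (g : 'I_r -> G) (ex : 'I_r -> nat).
Hypothesis g_ord : forall a, g a *+ (p ^ ex a) = 0.
Hypothesis g_free : forall z : 'I_r -> int, \sum_a g a *~ z a = 0 ->
  forall a, ((p ^ ex a)%N%:Z %| z a)%Z.
Hypothesis g_span : forall b, exists z : 'I_r -> int, b = \sum_a g a *~ z a.

Let pk_gt0 k : (0 < p ^ k)%N. Proof. by rewrite expn_gt0 prime_gt0. Qed.

Lemma pairDl x y z : pairG (x + y) z = pairG x z + pairG y z.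
Proof. by case: dG => -[]. Qed.

Lemma pairDr x y z : pairG x (y + z) = pairG x y + pairG x z.
Proof. by case: dG => -[]. Qed.

Lemma pairC x y : pairG x y = pairG y x.
Proof. by case: dG. Qed.

Lemma pair0l y : pairG 0 y = 0.
Proof. by apply: (addrI (pairG 0 y)); rewrite -pairDl !addr0. Qed.

Lemma pairNl x y : pairG (- x) y = - pairG x y.
Proof. by apply/eqP; rewrite -addr_eq0 -pairDl addNr pair0l. Qed.

Lemma pairMzl x y (z : int) : pairG (x *~ z) y = pairG x y *~ z.
Proof.
have nat k : pairG (x *+ k) y = pairG x y *+ k.
  by elim: k => [|k IH]; rewrite ?mulr0n ?pair0l // !mulrS pairDl IH.
by case: z => k; rewrite ?NegzE ?mulrNz ?pairNl -!pmulrn nat.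
Qed.

Lemma pair_suml (I : finType) (f : I -> G) y :
  pairG (\sum_i f i) y = \sum_i pairG (f i) y.
Proof. by apply: (big_morph (fun x => pairG x y)) => [u v|]; rewrite ?pairDl ?pair0l. Qed.

Lemma pairMzr x y (z : int) : pairG y (x *~ z) = pairG y x *~ z.
Proof. by rewrite pairC pairMzl pairC. Qed.

Lemma pair_sumr (I : finType) (f : I -> G) y :
  pairG y (\sum_i f i) = \sum_i pairG y (f i).
Proof. by rewrite pairC pair_suml; apply: eq_bigr => i _; rewrite pairC. Qed.

Lemma g_dvd (z : int) a : ((p ^ ex a)%N%:Z %| z)%Z -> g a *~ z = 0.
Proof. by move=> /dvdzP[y ->]; rewrite mulrC mulrzA -pmulrn g_ord mul0rz. Qed.

Lemma exists_dual : exists gs : 'I_r -> G, forall a c,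
  pairG (gs a) (g c) = modZ ((a == c)%:R / (p ^ ex a)%:R).
Proof.
suff h a : exists x, forall c, pairG x (g c) = modZ ((a == c)%:R / (p ^ ex a)%:R).
  by have [gs hgs] := choice h; exists gs.
have [co coP] := choice g_span.
pose phi (b : G) := modZ ((co b a)%:~R / (p ^ ex a)%:R).
(* Coordinates are defined only modulo [p ^ ex a]; division by this order makes them well defined in
   Q/Z. *)
have phiE b (z : 'I_r -> int) : b = \sum_c g c *~ z c -> phi b = modZ ((z a)%:~R / (p ^ ex a)%:R).
  move=> bz; apply/modZ_eqP; rewrite -mulrBl -intrB.
  have : \sum_c g c *~ (co b c - z c) = 0.
    by under eq_bigr do rewrite mulrzBr; rewrite sumrB -coP -bz subrr.
  move/g_free => /(_ a) /dvdzP[y ->]; rewrite intrM -[(p ^ ex a)%N%:Z%:~R]/((p ^ ex a)%:R).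
  by rewrite mulfK ?pnatr_eq0 -?lt0n // intr_int.
have phi_add : additive phi.
  move=> b b'; rewrite (@phiE _ (fun c => co b c - co b' c)).
    by rewrite intrB mulrBl modZD modZN.
  by under eq_bigr do rewrite mulrzBr; rewrite sumrB -!coP.
pose Phi : {additive G -> QZ} := HB.pack phi (GRing.isAdditive.Build G QZ phi phi_add).
have [_ _ /(_ Phi)[x [hx _]]] := dG; exists x => c.
rewrite hx /= (@phiE _ (fun d => (c == d)%:Z)).
  by rewrite eq_sym; case: eqP.
rewrite (bigD1 c) //= eqxx mulr1z big1 ?addr0 // => d dc.
by rewrite eq_sym (negPf dc) mulr0z.
Qed.

Variable gs : 'I_r -> G.
Hypothesis gsP : forall a c, pairG (gs a) (g c) = modZ ((a == c)%:R / (p ^ ex a)%:R).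

Lemma pair_gs a (z : 'I_r -> int) :
  pairG (gs a) (\sum_c g c *~ z c) = modZ ((z a)%:~R / (p ^ ex a)%:R).
Proof.
rewrite pair_sumr (bigD1 a) //= pairMzr gsP eqxx -modZ_mulz.
rewrite big1 ?addr0 => [|c ca].
  by congr modZ; rewrite -mulrzr mulrC mul1r.
by rewrite pairMzr gsP eq_sym (negPf ca) mul0r -modZ_mulz mul0rz; apply/modZ_eq0.
Qed.

Lemma pair_gs_inj x y : (forall a, pairG (gs a) x = pairG (gs a) y) -> x = y.
Proof.
move=> h; have [z hz] := g_span (x - y); apply/eqP; rewrite -subr_eq0 hz; apply/eqP.
apply: big1 => a _; apply: g_dvd; apply: natr_dvd_int => //.
by apply/modZ_eq0; rewrite -pair_gs -hz pairDr -mulrN1z pairMzr mulrN1z h subrr.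
Qed.

Lemma gs_ord a : gs a *+ (p ^ ex a) = 0.
Proof.
have [_ _ hd] := dG.
have add0 : additive (fun _ : G => 0 : QZ) by move=> ? ?; rewrite subr0.
pose Z : {additive G -> QZ} := HB.pack (fun _ : G => 0 : QZ) (GRing.isAdditive.Build G QZ _ add0).
have [x [hx xu]] := hd Z.
rewrite -[RHS](xu 0) => [|y]; last by rewrite pair0l.
apply/esym/xu => y; have [z ->] := g_span y.
rewrite -[gs a *+ _]/(gs a *~ (p ^ ex a)%N) pairMzl pair_gs -modZ_mulz.
apply/modZ_eq0; rewrite -mulrzr -[(p ^ ex a)%N%:~R]/((p ^ ex a)%:R).
by rewrite divfK ?intr_int // pnatr_eq0 -lt0n.
Qed.

Lemma dual_expand b (z : 'I_r -> int) :
  (forall a, pairG b (g a) = modZ ((z a)%:~R / (p ^ ex a)%:R)) -> b = \sum_a gs a *~ z a.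
Proof.
have [_ _ hd] := dG => hz.
have add : additive (pairG b).
  by move=> x y; rewrite pairDr -mulrN1z pairMzr mulrN1z.
pose Phi : {additive G -> QZ} := HB.pack (pairG b) (GRing.isAdditive.Build G QZ _ add).
have [x [hx xu]] := hd Phi.
rewrite -[LHS](xu b) // -[RHS](xu _) // => y; rewrite /= -[y]/(y).
have [w ->] := g_span y; rewrite pair_suml.
transitivity (\sum_a \sum_c pairG (gs a) (g c) *~ (z a * w c)).
  apply: eq_bigr => a _; rewrite pair_sumr; apply: eq_bigr => c _.
  by rewrite pairMzl pairMzr -mulrzA mulrC.
rewrite exchange_big pair_sumr /=; apply: eq_bigr => c _.
rewrite pairMzr hz (bigD1 c) //= big1 ?addr0 => [|a ac].
  rewrite gsP eqxx -!modZ_mulz; congr modZ.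
  by rewrite mulrzA -[1 / _ *~ z c]mulrzr mulrC mul1r.
by rewrite gsP (negPf ac) mul0r -modZ_mulz mul0rz; apply/modZ_eq0.
Qed.

Lemma exists_dual_gram : exists Gam : 'I_r -> 'I_r -> int,
  [/\ forall c a, (p ^ ex a)%N%:Z * Gam c a = (p ^ ex c)%N%:Z * Gam a c,
      forall a, gs a = \sum_c g c *~ Gam c a &
      forall c a, pairG (gs a) (gs c) = modZ ((Gam c a)%:~R / (p ^ ex c)%:R)].
Proof.
pose s a c := liftQ (pairG (gs a) (gs c)).
(* [liftQ] picks the same rational for equal classes, so the symmetry is exact in Q and the relation
   on [Gam] holds in the integers, not just modulo a power of [p]. *)
have sC a c : s a c = s c a by rewrite /s pairC.
have sint a c : s a c * (p ^ ex c)%:R \is a Num.int.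
  apply/modZ_eq0; rewrite -[(p ^ ex c)%:R]/((p ^ ex c)%N%:~R) mulrzr modZ_mulz liftQK.
  by rewrite -pairMzr -pmulrn gs_ord pairC pair0l.
pose Gam c a := numq (s a c * (p ^ ex c)%:R).
have GamE c a : (Gam c a)%:~R = s a c * (p ^ ex c)%:R :> rat.
  by have /intrP[z hz] := sint a c; rewrite /Gam hz numq_int.
have pairE c a : pairG (gs a) (gs c) = modZ ((Gam c a)%:~R / (p ^ ex c)%:R).
  by rewrite GamE mulfK ?liftQK // pnatr_eq0 -lt0n.
exists Gam; split => //.
  move=> c a; apply: (@intr_inj rat); rewrite !intrM !GamE sC.
  by rewrite -!pmulrn; ring.
move=> a; apply: pair_gs_inj => d; rewrite pair_gs pairC -pairE; by [].
Qed.

End Dual.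

(** * Integral representatives of sandpile classes *)

Local Open Scope quotient_scope.

Section Classes.
Variables (p n : nat) (E : graph n).
Local Notation L := (laplacian E).
Local Notation Sp := (Sylow_subgroup p (sandpile E)).

Lemma lap_const (c : int) : L *m const_mx c = 0 :> 'cV[int]_n.
Proof.
have := const_lapmx (c%:M : 'cV[int]_1) E => /(congr1 trmx).
rewrite !trmx_mul lapmx_sym trmx0 trmx_const tr_scalar_mx mul_mx_scalar.
have -> : lapmx int E = L by apply/matrixP => i j; rewrite mxE intz.
by move=> <-; congr (_ *m _); apply/matrixP => i j; rewrite !mxE mulr1.
Qed.

Lemma lap_sum0 (x : 'cV[int]_n) : \sum_i (L *m x) i 0 = 0.
Proof.
have -> : \sum_i (L *m x) i 0 = dot (L *m x) (const_mx 1).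
  by apply: eq_bigr => i _; rewrite [X in _ * X]mxE mulr1.
rewrite -dot_sym ?laplacian_sym // lap_const dotC /dot big1 // => i _.
by rewrite mxE mul0r.
Qed.

Definition rep (s : Sp) : 'cV[int]_n := sum_zero_val (repr (Sylow_val s)).

Lemma rep_sum0 s : \sum_i rep s i 0 = 0.
Proof. by rewrite /rep; case: (repr _) => v /= /eqP. Qed.

Lemma sandpile_eqP (x y : sum_zero n) :
  \pi_(sandpile E) x = \pi_(sandpile E) y <->
  exists w, sum_zero_val x = sum_zero_val y + L *m w.
Proof.
split=> [/eqP|[w xy]].
  rewrite -Quotient.idealrBE => /asboolP[w xy]; exists w.
  by rewrite -xy addrC subrK.
apply/eqP; rewrite -Quotient.idealrBE; apply/asboolP; exists w.
by rewrite -[LHS]/(sum_zero_val x - sum_zero_val y) xy addrAC subrr add0r.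
Qed.

Lemma rep_eqP (s t : Sp) : s = t <-> exists w, rep s = rep t + L *m w.
Proof.
split=> [->|/sandpile_eqP]; first by exists 0; rewrite mulmx0 addr0.
by rewrite !reprK => st; apply: val_inj.
Qed.

Lemma repD (s t : Sp) : exists w, rep (s + t) = rep s + rep t + L *m w.
Proof.
have /sandpile_eqP[w hw] : \pi_(sandpile E) (repr (Sylow_val (s + t))) =
    \pi_(sandpile E) (repr (Sylow_val s) + repr (Sylow_val t)).
  by rewrite raddfD /= !reprK.
by exists w.
Qed.

Lemma rep0 : exists w, rep 0 = L *m w.
Proof.
have /sandpile_eqP[w hw] : \pi_(sandpile E) (repr (Sylow_val (0 : Sp))) = \pi_(sandpile E) 0.
  by rewrite raddf0 reprK.
by exists w; rewrite /rep hw add0r.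
Qed.

Lemma rep_eq0P (s : Sp) : s = 0 <-> exists w, rep s = L *m w.
Proof.
have [w0 h0] := rep0; split=> [->|[w hw]]; first by exists w0.
by apply/rep_eqP; exists (w - w0); rewrite hw h0 mulmxBr addrC subrK.
Qed.

Lemma repMn (s : Sp) k : exists w, rep (s *+ k) = rep s *+ k + L *m w.
Proof.
elim: k => [|k [w IH]]; first by have [w hw] := rep0; exists w; rewrite !mulr0n add0r.
rewrite !mulrS; have [w' hw'] := repD s (s *+ k); exists (w + w').
by rewrite hw' IH mulmxDr !addrA.
Qed.

Lemma repN (s : Sp) : exists w, rep (- s) = - rep s + L *m w.
Proof.
have [w hw] := repD s (- s); have [w0 h0] := rep0.
exists (w0 - w); rewrite subrr h0 in hw; rewrite mulmxBr hw.
by move: (L *m w) => u; apply/colP => i; rewrite !mxE; ring.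
Qed.

Lemma repMz (s : Sp) (z : int) : exists w, rep (s *~ z) = rep s *~ z + L *m w.
Proof.
case: z => k; first exact: repMn.
rewrite NegzE !mulrNz -!pmulrn; have [w hw] := repN (s *+ k.+1).
have [w' hw'] := repMn s k.+1; exists (w - w').
by rewrite hw hw' mulmxBr opprD -!addrA [- (L *m w') + _]addrC.
Qed.

Lemma rep_sum (I : finType) (s : I -> Sp) :
  exists w, rep (\sum_i s i) = \sum_i rep (s i) + L *m w.
Proof.
elim/big_ind2: _ => [|X1 x1 X2 x2 [w1 h1] [w2 h2]|i _].
- by have [w hw] := rep0; exists w; rewrite add0r.
- have [w h] := repD x1 x2; exists (w1 + w2 + w); rewrite h h1 h2 !mulmxDr.
  by rewrite addrACA !addrA.
- by exists 0; rewrite mulmx0 addr0.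
Qed.

Lemma rep_torsion (s : Sp) k : s *+ k = 0 -> exists S, L *m S = rep s *+ k.
Proof.
move=> sk; have [w hw] := repMn s k; have [w0 h0] := rep0.
exists (w0 - w); rewrite sk h0 in hw.
by rewrite mulmxBr hw addrK.
Qed.

Lemma Sylow_torsion (s : Sp) : exists k, s *+ (p ^ k) = 0.
Proof.
have := valP s => /asboolP[k hk]; exists k; apply: val_inj.
by rewrite raddfMn.
Qed.

Lemma exists_rep (T S : 'cV[int]_n) k : \sum_i T i 0 = 0 -> L *m S = T *+ (p ^ k) ->
  exists (s : Sp) w, rep s = T + L *m w.
Proof.
move=> /eqP T0 LS; pose z := SumZero T0.
have zt : \pi_(sandpile E) z \in @ppower_torsion p (sandpile E).
  apply/asboolP; exists k; rewrite -raddfMn /=.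
  suff -> : \pi_(sandpile E) (z *+ (p ^ k)) = \pi_(sandpile E) 0 by rewrite raddf0.
  apply/sandpile_eqP; exists S.
  rewrite -[sum_zero_val 0]/(0 : 'cV[int]_n) add0r LS.
  by elim: (p ^ k)%N => [//|j IH]; rewrite !mulrS -IH.
exists (SylowSubgroup zt).
have /sandpile_eqP[w hw] : \pi_(sandpile E) (repr (\pi_(sandpile E) z)) = \pi_(sandpile E) z.
  exact: reprK.
by exists w.
Qed.

Lemma ker_perp_of (T S : 'cV[int]_n) k : (0 < k)%N -> L *m S = T *+ k -> ker_perp L T.
Proof.
move=> k0 LS v Lv; apply/eqP.
have: dot T v *+ k == 0.
  rewrite -dotMnl -LS -dot_sym ?laplacian_sym // Lv dotC /dot big1 // => i _.
  by rewrite mxE mul0r.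
by rewrite mulrn_eq0 eqn0Ngt k0.
Qed.

(** A multiple of [rep t] is also in the image of [L]; its factor cancels against the denominator,
    so only a preimage for [s] appears in the value. *)
Lemma Sylow_pairingE (s t : Sp) k S : prime p -> (0 < k)%N -> L *m S = rep s *+ k ->
  sandpile_Sylow_pairing s t = modZ ((dot S (rep t))%:~R / k%:R).
Proof.
move=> p_pr k0 LS; have [l tl] := Sylow_torsion t.
have [S' LS'] := rep_torsion tl.
have l0 : (0 < p ^ l)%N by rewrite expn_gt0 prime_gt0.
have val : BL_value (sandpile_to_cok (Sylow_val s)) (sandpile_to_cok (Sylow_val t))
    (modZ ((dot S (rep t))%:~R / k%:R)).
  exists (rep s), (rep t), S, S', k, (p ^ l)%N; split => //.
    by split; apply: (ker_perp_of _ LS) || apply: (ker_perp_of _ LS').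
  have -> : (S^T *m L *m S') 0 0 = dot S (rep t) *+ (p ^ l).
    by rewrite -mulmxA -dotE LS' [LHS]dotC dotMnl dotC.
  congr modZ; rewrite raddfMn /= -[_ *+ (p ^ l)]mulr_natr natrM.
  by field; rewrite !pnatr_eq0 -!lt0n k0 l0.
by apply: (BL_value_unique (laplacian_sym E) _ val); exact: xgetI val.
Qed.

End Classes.

(** * Full embeddings are isometries *)

Section Embeddings.
Variables (p : nat) (G : finZmodType) (pairG : G -> G -> QZ).
Hypotheses (p_pr : prime p) (pG : (p.-group [set: G])%g) (dG : duality_pairing pairG).
Variables (n : nat) (E : graph n).
Local Notation L := (laplacian E).
Local Notation Sp := (Sylow_subgroup p (sandpile E)).
Implicit Types (F : {ffun 'I_n -> G}).

Definition act F (T : 'cV[int]_n) : G := \sum_j F j *~ T j 0.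

Lemma actD F T T' : act F (T + T') = act F T + act F T'.
Proof. by rewrite /act -big_split; apply: eq_bigr => j _; rewrite mxE mulrzDr. Qed.

Lemma actMn F T k : act F (T *+ k) = act F T *+ k.
Proof.
elim: k => [|k IH]; last by rewrite !mulrS actD IH.
by rewrite /act big1 // => j _; rewrite mxE mulr0z.
Qed.

Definition lap_hom F : bool := [forall j, \sum_i F i *~ L i j == 0].

Lemma lap_homP F x : lap_hom F -> act F (L *m x) = 0.
Proof.
move=> /forallP h; rewrite /act.
under eq_bigr do rewrite mxE mulrz_sumr.
rewrite exchange_big big1 // => i _.
under eq_bigr do rewrite mulrzA.
by rewrite -mulrz_suml (eqP (h i)) mul0rz.
Qed.

(* [x] is a rational lift of the character [<b, F _>] of [Z^n] and [T = L x]
   represents the image of [b] under the adjoint of [F]. *)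
Definition adjoint F b (x : 'cV[rat]_n) (T : 'cV[int]_n) : Prop :=
  (forall i, modZ (x i 0) = pairG b (F i)) /\
  map_mx intr T = map_mx intr L *m x :> 'cV[rat]_n.

Definition embedding F : Prop :=
  lap_hom F /\ forall b x T, adjoint F b x T -> act F T = b.

(** Integral lifts of the vectors of [U]; by [kills_congr] the condition depends on [psi] only
    modulo [p]. *)
Definition kills F (psi : 'cV[int]_n) : Prop :=
  (forall j, (p%:Z %| (L *m psi)%R j 0%R)%Z) /\
  forall b x T, adjoint F b x T -> (p%:Z %| dot psi T)%Z.

Definition full F : Prop :=
  embedding F /\ forall psi, kills F psi -> forall i j, (p%:Z %| (psi i 0 - psi j 0)%R)%Z.

Definition dotq (T : 'cV[int]_n) (x : 'cV[rat]_n) : rat := \sum_i (T i 0)%:~R * x i 0.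

Lemma dotq_adjoint F b x T T' : adjoint F b x T ->
  modZ (dotq T' x) = pairG b (act F T').
Proof.
move=> [h _]; rewrite /dotq modZ_sum (pair_sumr dG); apply: eq_bigr => i _.
by rewrite mulrC mulrzr modZ_mulz h (pairMzr dG).
Qed.

Lemma dotq_lap (S T : 'cV[int]_n) x : map_mx intr T = map_mx intr L *m x :> 'cV[rat]_n ->
  (dot S T)%:~R = dotq (L *m S) x.
Proof.
move=> /matrixP h; rewrite /dot /dotq rmorph_sum /=.
under eq_bigr => i _.
  rewrite rmorphM /=; have := h i 0; rewrite mxE => ->.
  rewrite mxE mulr_sumr.
  over.
rewrite exchange_big /=; apply: eq_bigr => j _; rewrite [(L *m S) j 0]mxE rmorph_sum mulr_suml /=.
apply: eq_bigr => i _; rewrite mxE rmorphM /= -{1}(laplacian_sym E) [L^T i j]mxE.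
by rewrite mulrA [_ * (L j i)%:~R]mulrC.
Qed.

Lemma adjoint_exists F b : lap_hom F -> exists x T, adjoint F b x T.
Proof.
move=> hF; pose x : 'cV[rat]_n := \col_i liftQ (pairG b (F i)).
have hx i : modZ (x i 0) = pairG b (F i) by rewrite mxE liftQK.
have xi j : (map_mx intr L *m x) j 0 \is a Num.int.
  apply/modZ_eq0; rewrite mxE modZ_sum.
  transitivity (pairG b (\sum_i F i *~ L i j)).
    rewrite (pair_sumr dG); apply: eq_bigr => i _.
    by rewrite mxE mulrC mulrzr modZ_mulz hx (pairMzr dG) -{1}(laplacian_sym E) mxE.
  by rewrite (eqP (forallP hF j)) (pairC dG) (pair0l dG).
exists x, (\col_j numq ((map_mx intr L *m x) j 0)); split => //.
by apply/colP => j; rewrite mxE [X in X%:~R]mxE; have /intrP[z ->] := xi j; rewrite numq_int.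
Qed.

Lemma adjoint_sum0 F b x T : adjoint F b x T -> \sum_i T i 0 = 0.
Proof.
move=> [_ hT]; apply: (@intr_inj rat).
have := @dotq_lap (const_mx 1) T x hT; rewrite lap_const => h.
transitivity ((dot (const_mx 1) T)%:~R : rat).
  by congr (_%:~R); apply: eq_bigr => i _; rewrite mxE mul1r.
by rewrite h /dotq big1 // => i _; rewrite mxE mul0r.
Qed.

Lemma group_exp (b : G) : b *+ #|G| = 0.
Proof. by have := expg_cardG (finset.in_setT b); rewrite FinRing.zmodXgE cardsT. Qed.

Lemma card_pgroup_exp : exists k, #|G| = (p ^ k)%N.
Proof. by have /p_natP[k hk] := pG; exists k; rewrite -cardsT. Qed.

(** The order [p ^ k] of [G] kills the character, so [p ^ k x] is integral, and [L] maps it to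
    [p ^ k T]. *)
Lemma adjoint_torsion F b x T : adjoint F b x T ->
  exists k (S : 'cV[int]_n), L *m S = T *+ (p ^ k) /\
    map_mx intr S = x *+ (p ^ k).
Proof.
move=> [hx hT]; have [k hk] := card_pgroup_exp; exists k.
have xi i : (x *+ (p ^ k)) i 0 \is a Num.int.
  apply/modZ_eq0; rewrite mulmxnE -[_ *+ _]/(x i 0 *~ (p ^ k)%N) modZ_mulz hx -(pairMzl dG).
  by rewrite -pmulrn -hk group_exp (pair0l dG).
exists (\col_i numq ((x *+ (p ^ k)) i 0)).
have SE : map_mx intr (\col_i numq ((x *+ (p ^ k)) i 0)) = x *+ (p ^ k).
  by apply/colP => j; rewrite mxE [X in X%:~R]mxE; have /intrP[z ->] := xi j; rewrite numq_int.
split => //.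
have /colP h : map_mx intr (L *m \col_i numq ((x *+ (p ^ k)) i 0)) =
    map_mx intr (T *+ (p ^ k)) :> 'cV[rat]_n.
  have mMn j : map_mx intr (T *+ j) = map_mx intr T *+ j :> 'cV[rat]_n.
    by elim: j => [|j IH]; rewrite ?mulr0n ?map_mx0 // !mulrS map_mxD IH.
  by rewrite map_mxM SE mMn hT -!scaler_nat -scalemxAr.
by apply/colP => j; apply: (@intr_inj rat); have := h j; rewrite mxE [X in _ = X]mxE.
Qed.

Definition restr F (s : Sp) : G := act F (rep s).

Lemma restr_additive F : lap_hom F -> additive (restr F).
Proof.
move=> hF s t; rewrite /restr.
have [w hw] := repD s (- t); have [w' hw'] := repN t.
rewrite hw hw' !actD !(lap_homP _ hF) !addr0; congr (_ + _).
by rewrite -scaleN1r /act -sumrN; apply: eq_bigr => j _; rewrite mxE mulN1r mulrNz.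
Qed.

Lemma adjoint_class F b x T : lap_hom F -> adjoint F b x T ->
  exists (s : Sp) w, rep s = T + L *m w /\ restr F s = act F T.
Proof.
move=> hF ad; have [k [S [LS _]]] := adjoint_torsion ad.
have [s [w hw]] := exists_rep (adjoint_sum0 ad) LS.
by exists s, w; split => //; rewrite /restr hw actD (lap_homP _ hF) addr0.
Qed.

(** The integral vector [p ^ k x] divided by [p ^ k] is again [x], which lifts the character of [b]
    along [F]; the change [L w] of representative adds an integer. *)
Lemma adjoint_pairing F b x T s w (t : Sp) : adjoint F b x T -> rep s = T + L *m w ->
  sandpile_Sylow_pairing s t = pairG b (restr F t).
Proof.
move=> ad hs; have [k [S [LS Sx]]] := adjoint_torsion ad.
have k0 : (0 < p ^ k)%N by rewrite expn_gt0 prime_gt0.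
rewrite (@Sylow_pairingE p n E s t (p ^ k) (S + w *+ (p ^ k)) p_pr k0); last first.
  by rewrite mulmxDr LS hs mulrnDl -!scaler_nat -!scalemxAr.
rewrite -(dotq_adjoint (rep t) ad); apply/modZ_eqP.
have -> : (dot (S + w *+ (p ^ k)) (rep t))%:~R =
    (dot S (rep t))%:~R + (dot w (rep t))%:~R * (p ^ k)%:R :> rat.
  by rewrite dotDl dotMnl rmorphD raddfMn /= mulr_natr.
rewrite mulrDl mulfK ?pnatr_eq0 -?lt0n //.
have -> : (dot S (rep t))%:~R / (p ^ k)%:R = dotq (rep t) x.
  rewrite dotC /dot /dotq rmorph_sum mulr_suml /=; apply: eq_bigr => i _.
  rewrite rmorphM /= -mulrA; congr (_ * _).
  have /colP/(_ i) := Sx; rewrite mxE mulmxnE => ->.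
  by rewrite -[_ *+ _]mulr_natr mulfK // pnatr_eq0 -lt0n.
by rewrite addrAC subrr add0r intr_int.
Qed.

Lemma divz_const (psi : 'cV[int]_n) : (forall i j, (p%:Z %| (psi i 0 - psi j 0)%R)%Z) ->
  exists c (psi' : 'cV[int]_n), psi = const_mx c + psi' *+ p.
Proof.
case: n psi => [|n'] psi h; first by exists 0, 0; apply/colP => -[].
exists (psi ord0 0), (\col_i ((psi i 0 - psi ord0 0)%R %/ p)%Z).
apply/colP => i; rewrite mxE mulmxnE !mxE.
have /divzK e := h i ord0; rewrite -[_ *+ p]mulr_natr natz e addrC subrK //.
Qed.

(** A nonzero kernel would contain some [t] of order [p], and a vector [S] with [L S = p t] then
    lies in [U]. As [S] is constant modulo [p], say [S = c + p S'], the class [t] is represented by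
    [L S'] and vanishes. *)
Lemma full_inj F : full F -> injective (restr F).
Proof.
move=> [[hF hE] hk]; have addF := restr_additive hF.
suff inj0 s : restr F s = 0 -> s = 0.
  move=> s t st; apply/eqP; rewrite -subr_eq0; apply/eqP/inj0.
  by rewrite addF st subrr.
move=> fs0; have ex_k : exists k, s *+ (p ^ k) == 0.
  by have [k hk'] := Sylow_torsion s; exists k; apply/eqP.
case: (ex_minnP ex_k) => -[|k] /eqP sk mink; first by rewrite expn0 mulr1n in sk.
pose t := s *+ (p ^ k).
have tp : t *+ p = 0 by rewrite /t -mulrnA -expnSr.
have ft : act F (rep t) = 0.
  have [w hw] := repMn s (p ^ k); rewrite /t hw actD actMn (lap_homP _ hF) addr0.
  by rewrite [act F _]fs0 mul0rn.
have [S LS] := rep_torsion tp.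
(* [S . T = (L S) . x = p (t . x)], and [t . x] is an integer because its class is the pairing of
   [b] with [F t = 0]. *)
have kS : kills F S.
  split=> [j|b x T ad]; first by rewrite LS mulmxnE -mulr_natr natz dvdz_mull.
  have := @dotq_lap S T x ad.2; rewrite LS => hd.
  have /modZ_eq0/intrP[y hy] : modZ (dotq (rep t) x) = 0.
    by rewrite (dotq_adjoint _ ad) ft (pairC dG) (pair0l dG).
  apply/dvdzP; exists y; apply: (@intr_inj rat); rewrite hd rmorphM /= -hy.
  rewrite /dotq mulr_suml; apply: eq_bigr => i _.
  by rewrite mulmxnE raddfMn /= -[_ *+ p]mulr_natr -pmulrn mulrAC.
have [c [S' SE]] := divz_const (hk _ kS).
have t0 : t = 0.
  apply/rep_eq0P; exists S'.
  have : (L *m S') *+ p = rep t *+ p.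
    by rewrite -LS SE mulmxDr lap_const add0r -!scaler_nat scalemxAr.
  move=> h; apply/colP => i; have /colP/(_ i) := h; rewrite !mulmxnE => /eqP.
  by rewrite eqr_pMn2r ?prime_gt0 // => /eqP.
have := mink k; rewrite -/t t0 eqxx ltnn => /(_ isT); by [].
Qed.

Lemma full_surj F : full F -> forall b, exists s, restr F s = b.
Proof.
move=> [[hF hE] _] b; have [x [T ad]] := adjoint_exists b hF.
have [s [w [_ hs]]] := adjoint_class hF ad.
by exists s; rewrite hs (hE b x T ad).
Qed.

Lemma full_pairing F : full F -> forall s t,
  pairG (restr F s) (restr F t) = sandpile_Sylow_pairing s t.
Proof.
move=> fF s t; have [[hF hE] _] := fF.
have [x [T ad]] := adjoint_exists (restr F s) hF.
have [s' [w [hs' fs']]] := adjoint_class hF ad.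
have ss' : s' = s by apply: (full_inj fF); rewrite fs' (hE _ _ _ ad).
by rewrite -(adjoint_pairing t ad hs') ss'.
Qed.

Lemma full_iso F : full F -> pairing_iso (@sandpile_Sylow_pairing p n E) pairG.
Proof.
move=> fF; have [[hF _] _] := fF.
pose f : {additive Sp -> G} := HB.pack (restr F) (GRing.isAdditive.Build Sp G _ (restr_additive hF)).
exists f; split; last by move=> s t; exact: full_pairing.
have [h hh] := choice (full_surj fF).
by exists h => s; [apply: (full_inj fF); rewrite hh | rewrite /= hh].
Qed.

(** Connectedness of the graph, in the form in which it is used. *)
Definition lap_ker_const : Prop :=
  forall u : 'cV[int]_n, L *m u = 0 -> forall i j, u i 0 = u j 0.

(** A kernel vector lies in [U], hence is constant modulo [p]; removing the constant and dividing by
    [p] gives another kernel vector. So differences of entries are divisible by every power of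
    [p]. *)
Lemma full_ker_const F : full F -> lap_ker_const.
Proof.
move=> [_ hk] u Lu.
have killsu v : L *m v = 0 -> kills F v.
  move=> Lv; split=> [j|b x T ad]; first by rewrite Lv mxE dvdz0.
  have := @dotq_lap v T x ad.2; rewrite Lv => hd.
  rewrite (_ : dot v T = 0) ?dvdz0 //; apply: (@intr_inj rat); rewrite hd /dotq big1 // => i _.
  by rewrite mxE mul0r.
have dvd m : forall v : 'cV[int]_n, L *m v = 0 -> forall i j, ((p ^ m)%N%:Z %| (v i 0 - v j 0)%R)%Z.
  elim: m => [|m IH] v Lv i j; first by rewrite expn0 dvd1z.
  have [c [v' vE]] := divz_const (hk _ (killsu _ Lv)).
  have Lv' : L *m v' = 0.
    have : (L *m v') *+ p = 0.
      by move: Lv; rewrite vE mulmxDr lap_const add0r -!scaler_nat scalemxAr.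
    move=> /colP h; apply/colP => k; have := h k; rewrite mulmxnE !mxE => /eqP.
    by rewrite mulrn_eq0 eqn0Ngt prime_gt0 //= => /eqP.
  have /dvdzP[y hy] := IH _ Lv' i j; apply/dvdzP; exists y.
  rewrite vE !mxE !mulmxnE opprD addrACA subrr add0r -mulrnBl hy.
  by rewrite expnS -mulr_natr natz PoszM -!mulrA [_ * (p : int)]mulrC.
move=> i j; apply/eqP; rewrite -subr_eq0; apply/negPn/negP => ne.
have := dvd `|(u i 0 - u j 0)%R|%N u Lu i j; rewrite dvdzE /= => /dvdn_leq.
rewrite absz_gt0 => /(_ ne); apply/negP; rewrite -ltnNge.
exact: ltn_expl (prime_gt1 p_pr).
Qed.

End Embeddings.

(** * Counting full functions on a connected graph *)

Lemma common_denominator n (x : 'I_n -> rat) :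
  exists2 D : nat, (0 < D)%N & forall i, x i * D%:R \is a Num.int.
Proof.
exists (\prod_i `|denq (x i)|)%N.
  by rewrite prodn_gt0 // => i; rewrite absz_gt0 denq_neq0.
move=> i; rewrite (bigD1 i) //= natrM mulrA; apply: rpredM; last by rewrite pmulrn intr_int.
have -> : `|denq (x i)|%N%:R = (denq (x i))%:~R :> rat.
  by rewrite pmulrn gez0_abs // ltW // denq_gt0.
by rewrite -{1}[x i]divq_num_den divfK ?intr_int // intq_eq0 denq_neq0.
Qed.

Section Count.
Variables (p : nat) (G : finZmodType) (pairG : G -> G -> QZ).
Hypotheses (p_pr : prime p) (pG : (p.-group [set: G])%g) (dG : duality_pairing pairG).
Variables (n : nat) (E : graph n) (i0 : 'I_n).
Local Notation L := (laplacian E).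
Local Notation Sp := (Sylow_subgroup p (sandpile E)).
Implicit Types (F : {ffun 'I_n -> G}).
Hypothesis kerL : lap_ker_const E.

Let Lq : 'M[rat]_n := map_mx intr L.

Lemma lap_ker_const_rat (v : 'cV[rat]_n) : Lq *m v = 0 -> forall i j, v i 0 = v j 0.
Proof.
move=> Lv; have [D D0 hD] := common_denominator (fun i => v i 0).
have D0' : D%:R != 0 :> rat by rewrite pnatr_eq0 -lt0n.
pose u : 'cV[int]_n := \col_i numq (v i 0 * D%:R).
have uE i : (u i 0)%:~R = v i 0 * D%:R :> rat.
  by rewrite mxE; have /intrP[z ->] := hD i; rewrite numq_int.
have Lu : L *m u = 0.
  apply/colP => i; apply: (@intr_inj rat); rewrite [(0 : 'cV_n) i 0]mxE mxE rmorph_sum /=.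
  have /colP/(_ i) := Lv; rewrite !mxE => /(congr1 (fun z => z * D%:R)).
  rewrite mul0r mulr_suml => h; rewrite -[RHS]h; apply: eq_bigr => j _.
  by rewrite rmorphM /= uE [Lq i j]mxE mulrA.
move=> i j; apply: (mulIf D0'); rewrite -!uE.
by rewrite (kerL Lu i j).
Qed.

(** Over the rationals the image of the symmetric [L] is the orthogonal of its kernel, and the
    kernel is the constants. *)
Lemma lap_solve (T : 'cV[int]_n) : \sum_i T i 0 = 0 ->
  exists2 K : nat, (0 < K)%N & exists S, L *m S = T *+ K.
Proof.
move=> T0; pose t : 'rV[rat]_n := (map_mx intr T)^T.
have /submxP[y hy] : (t <= Lq)%MS.
  rewrite submxE; apply/eqP/rowP => j; rewrite !mxE.
  have hc : Lq *m col j (cokermx Lq) = 0 by rewrite colE mulmxA mulmx_coker mul0mx.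
  have hcE := lap_ker_const_rat hc.
  transitivity (\sum_i (T i 0)%:~R * (cokermx Lq) i0 j).
    by apply: eq_bigr => i _; rewrite !mxE; congr (_ * _); have := hcE i i0; rewrite !mxE.
  by rewrite -mulr_suml -rmorph_sum /= T0 mul0r.
have [K K0 hK] := common_denominator (fun i => y 0 i).
exists K => //; exists (\col_i numq (y 0 i * K%:R)).
apply/colP => j; apply: (@intr_inj rat); rewrite mulmxnE mxE rmorph_sum raddfMn /=.
have -> : (T j 0)%:~R = \sum_i y 0 i * Lq i j.
  by transitivity (t 0 j); [rewrite !mxE | rewrite hy mxE].
rewrite -[RHS]mulr_natr mulr_suml.
apply: eq_bigr => i _; rewrite rmorphM /= [(\col__ _) _ _]mxE.
have /intrP[z hz] := hK i; rewrite hz numq_int -hz [Lq i j]mxE -{1}(laplacian_sym E) [L^T j i]mxE.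
by rewrite mulrC mulrAC.
Qed.

(** [e_i - e_i0] need not represent a class of [p]-power order. Multiplying by the part [m] of a
    common order that is prime to [p] repairs this, and [m'] undoes it on the [p]-group [G]. *)
Lemma exists_sections : exists (m m' : nat) (s : 'I_n -> Sp) (w : 'I_n -> 'cV[int]_n),
  [/\ forall b : G, b *+ m *+ m' = b, coprime p m &
      forall i, rep (s i) = (delta_mx i 0 - delta_mx i0 0) *+ m + L *m w i].
Proof.
pose e i : 'cV[int]_n := delta_mx i 0 - delta_mx i0 0.
have e0 i : \sum_j e i j 0 = 0.
  have d1 k : \sum_j (delta_mx k 0 : 'cV[int]_n) j 0 = 1.
    rewrite (bigD1 k) //= mxE !eqxx big1 ?addr0 // => j jk.
    by rewrite mxE (negPf jk).
  have -> : \sum_j e i j 0 = \sum_j ((delta_mx i 0 : 'cV[int]_n) j 0 - (delta_mx i0 0 : 'cV[int]_n) j 0).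
    by apply: eq_bigr => j _; rewrite [LHS]mxE; congr (_ + _); rewrite mxE.
  by rewrite sumrB !d1 subrr.
have hK i : exists K : nat, (0 < K)%N /\ exists S, L *m S = e i *+ K.
  by have [K K0 [S hS]] := lap_solve (e0 i); exists K; split => //; exists S.
have [K hKi] := choice hK.
pose Kt := (\prod_i K i)%N.
have Kt0 : (0 < Kt)%N by rewrite prodn_gt0 // => i; case: (hKi i).
have hKt i : exists S, L *m S = e i *+ Kt.
  have [_ [S hS]] := hKi i; exists (S *+ (\prod_(j | j != i) K j)).
  have LMn k : L *m (S *+ k) = (L *m S) *+ k by rewrite -!scaler_nat -scalemxAr.
  by rewrite LMn hS -mulrnA; congr (_ *+ _); rewrite /Kt [RHS](bigD1 i).
have [m cpm KtE] := pfactor_coprime p_pr Kt0.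
have [kG hkG] := card_pgroup_exp pG.
have m0 : (0 < m)%N by move: Kt0; rewrite KtE muln_gt0 => /andP[].
have cmG : coprime m #|G| by rewrite hkG coprime_sym coprimeXl.
have /(coprimeP _ m0)[[u1 u2] /= hu] := cmG.
have hs i : exists (s : Sp) w, rep s = e i *+ m + L *m w.
  have [S hS] := hKt i; apply: (exists_rep (S := S) (k := logn p Kt)).
    by under eq_bigr do rewrite mulmxnE; rewrite sumrMnl e0 mul0rn.
  by rewrite hS KtE mulrnA -KtE.
have [s hs'] := choice hs; have [w hw] := choice hs'.
exists m, u1, s, w; split => // b.
rewrite -mulrnA [(m * u1)%N]mulnC (_ : (u1 * m = u2 * #|G| + 1)%N); last first.
  have : (0 < u1 * m - u2 * #|G|)%N by rewrite hu.
  by rewrite subn_gt0 => /ltnW h; rewrite -hu addnC subnK.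
by rewrite mulrnDr mulrnA group_exp add0r.
Qed.

Variables (m m' : nat) (s : 'I_n -> Sp) (w : 'I_n -> 'cV[int]_n).
Hypothesis mm' : forall b : G, b *+ m *+ m' = b.
Hypothesis cpm : coprime p m.
Hypothesis sE : forall i, rep (s i) = (delta_mx i 0 - delta_mx i0 0) *+ m + L *m w i.

Lemma section_rep (T : 'cV[int]_n) : \sum_i T i 0 = 0 ->
  exists u, rep (\sum_i s i *~ T i 0) = T *+ m + L *m u.
Proof.
move=> T0; have [u hu] := rep_sum (fun i => s i *~ T i 0).
have [v hv] := choice (fun i => repMz (s i) (T i 0)).
exists (\sum_i (w i *~ T i 0 + v i) + u).
rewrite hu mulmxDr addrA; congr (_ + _).
have LMz (x : 'cV[int]_n) (z : int) : L *m (x *~ z) = (L *m x) *~ z.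
  by rewrite -!scaler_int -scalemxAr.
transitivity (\sum_i (((delta_mx i 0 - delta_mx i0 0) *+ m) *~ T i 0 + L *m (w i *~ T i 0 + v i))).
  apply: eq_bigr => i _; rewrite hv sE mulrzDl mulmxDr LMz addrA //.
rewrite big_split /= mulmx_sumr; congr (_ + _).
apply/colP => j; rewrite summxE mulmxnE.
transitivity (\sum_i ((i == j)%:R * T i 0 - (i0 == j)%:R * T i 0) *+ m).
  apply: eq_bigr => i _.
  rewrite -scaler_int mxE mulmxnE !mxE !andbT intz [i == j]eq_sym [i0 == j]eq_sym.
  by rewrite mulrnAr mulrBr ![T i 0 * _]mulrC.
rewrite sumrMnl; congr (_ *+ _); rewrite sumrB -mulr_sumr T0 mulr0 subr0.
rewrite (bigD1 j) //= eqxx mul1r big1 ?addr0 // => i ij.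
by rewrite (negPf ij) mul0r.
Qed.

Section Extend.
Variable f : {additive Sp -> G}.
Hypothesis f_bij : bijective f.
Hypothesis f_pair : forall x y, pairG (f x) (f y) = sandpile_Sylow_pairing x y.
Variable g0 : G.

(** A function with [F L = 0] satisfies [F i - F i0 = m' F(s i)], so it is recovered from its
    restriction [f] and its value [g0] at the root [i0]. *)
Definition extend : {ffun 'I_n -> G} := [ffun i => g0 + f (s i) *+ m'].

Lemma act_extend (T : 'cV[int]_n) : \sum_i T i 0 = 0 ->
  act extend T = f (\sum_i s i *~ T i 0) *+ m'.
Proof.
move=> T0; rewrite /act.
under eq_bigr do rewrite ffunE mulrzDl.
rewrite big_split /= -mulrz_sumr T0 mulr0z add0r raddf_sum -sumrMnl.
apply: eq_bigr => i _; rewrite raddfMz /=.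
by rewrite !pmulrn -!mulrzA mulrC.
Qed.

Lemma extend_hom : lap_hom E extend.
Proof.
apply/forallP => j; apply/eqP.
have -> : \sum_i extend i *~ L i j = act extend (L *m delta_mx j 0).
  by apply: eq_bigr => i _; congr (_ *~ _); rewrite -colE [RHS]mxE.
rewrite act_extend ?lap_sum0 //.
have [u hu] := section_rep (lap_sum0 E (delta_mx j 0)).
rewrite (_ : \sum_i _ = 0) ?raddf0 ?mul0rn //.
apply/rep_eq0P; exists (delta_mx j 0 *+ m + u).
by rewrite hu mulmxDr -!scaler_nat -scalemxAr.
Qed.

Lemma restr_extend x : restr extend x = f x.
Proof.
rewrite /restr act_extend ?rep_sum0 //.
have [u hu] := section_rep (rep_sum0 x).
rewrite (_ : \sum_i _ = x *+ m); first by rewrite raddfMn mm'.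
have [v hv] := repMn x m; apply/rep_eqP; exists (u - v).
by rewrite hu hv mulmxBr -addrA [L *m v + _]addrC subrK.
Qed.

Lemma pair_nondeg b b' : (forall y, pairG b y = pairG b' y) -> b = b'.
Proof.
move=> h; have [_ _ hd] := dG.
have add : additive (pairG b).
  by move=> x y; rewrite (pairDr dG) -mulrN1z (pairMzr dG) mulrN1z.
pose Phi : {additive G -> QZ} := HB.pack (pairG b) (GRing.isAdditive.Build G QZ _ add).
have [x [hx xu]] := hd Phi.
have e1 : x = b := xu b (fun _ => erefl).
have e2 : x = b' := xu b' (fun y => esym (h y)).
by rewrite -e1.
Qed.

Lemma extend_adjoint b x T : adjoint pairG E extend b x T ->
  exists2 y : Sp, f y = b & exists u, rep y = T + L *m u.
Proof.
move=> ad; have [y [u [hy ry]]] := adjoint_class pG dG extend_hom ad.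
exists y; last by exists u.
apply: pair_nondeg => z; have [h fh hf] := f_bij.
by rewrite -[z]hf f_pair (adjoint_pairing p_pr pG dG _ ad hy) restr_extend.
Qed.

Lemma extend_full : full p pairG E extend.
Proof.
have emb : embedding pairG E extend.
  split; first exact: extend_hom.
  move=> b x T ad; have [y fy [u hy]] := extend_adjoint ad.
  by rewrite -fy -restr_extend /restr hy actD (lap_homP _ extend_hom) addr0.
split=> // psi [k1 k2].
(* For [b = f (s i)] the adjoint is [m (e_i - e_i0)] up to the image of [L], so [p] divides
   [m (psi i - psi i0)], and [m] is prime to [p]. *)
suff h i : (p%:Z %| (psi i 0 - psi i0 0)%R)%Z.
  move=> i j; rewrite (_ : psi i 0 - psi j 0 = (psi i 0 - psi i0 0) - (psi j 0 - psi i0 0)); last by ring.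
  by rewrite rpredB.
have [x [T ad]] := adjoint_exists dG (f (s i)) extend_hom.
have [y fy [u hy]] := extend_adjoint ad.
have ys : y = s i by apply: (bij_inj f_bij).
have Lpsi (v : 'cV[int]_n) : (p%:Z %| dot psi (L *m v))%Z.
  rewrite dot_sym ?laplacian_sym // /dot rpred_sum // => j _.
  by rewrite dvdz_mulr.
have dpsi k : dot psi (delta_mx k 0) = psi k 0.
  rewrite /dot (bigD1 k) //= mxE !eqxx mulr1 big1 ?addr0 // => j jk.
  by rewrite mxE (negPf jk) mulr0.
have hT : T = (delta_mx i 0 - delta_mx i0 0) *+ m + L *m (w i - u).
  by rewrite mulmxBr addrA -sE -ys hy addrK.
have := k2 _ _ _ ad; rewrite hT dotC dotDl [dot (L *m _) _]dotC dotMnl dotDl.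
rewrite (rpredDr _ (Lpsi _)).
have -> : dot (- delta_mx i0 0) psi = - psi i0 0.
  by rewrite -dpsi [in RHS]dotC /dot -sumrN; apply: eq_bigr => j _; rewrite mxE mulNr.
rewrite dotC dpsi -mulr_natr natz mulrC Gauss_dvdzr //.
Qed.

End Extend.

Lemma full_extend F : full p pairG E F -> exists (f : {additive Sp -> G}),
  [/\ bijective f, forall x, f x = restr F x & F = extend f (F i0)].
Proof.
move=> fF; have [[hF _] _] := fF.
pose f : {additive Sp -> G} := HB.pack (restr F) (GRing.isAdditive.Build Sp G _ (restr_additive hF)).
exists f; split => //.
  have [h hh] := choice (full_surj pG dG fF).
  by exists h => x; [apply: (full_inj p_pr dG fF); rewrite hh | rewrite /= hh].
apply/ffunP => i; rewrite ffunE /= /restr sE actD actMn (lap_homP _ hF) addr0 mm'.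
have -> : act F (delta_mx i 0 - delta_mx i0 0) = F i - F i0.
  have actd k : act F (delta_mx k 0) = F k.
    rewrite /act (bigD1 k) //= mxE !eqxx mulr1z big1 ?addr0 // => j jk.
    by rewrite mxE (negPf jk) mulr0z.
  rewrite actD actd; congr (_ + _); rewrite -[in RHS](actd i0).
  by rewrite /act -sumrN; apply: eq_bigr => j _; rewrite mxE mulrNz.
by rewrite addrC subrK.
Qed.

(** A full function amounts to a value at the root, free in [G], and an isometry onto [G]; the
    isometries are a torsor under [pairing_Aut]. *)
Lemma card_full_sections : pairing_iso (@sandpile_Sylow_pairing p n E) pairG ->
  #|[set F | `[< full p pairG E F >]]| = (#|G| * #|pairing_Aut pairG|)%N.
Proof.
move=> [f0 [f0_bij f0_pair]].
have [h0 fh0 hf0] := f0_bij.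
pose ph (a : {perm G}) (u : G) : {ffun 'I_n -> G} := [ffun i => u + a (f0 (s i)) *+ m'].
have autP (a : {perm G}) : a \in pairing_Aut pairG ->
    additive (a \o f0) /\ forall x y, pairG (a (f0 x)) (a (f0 y)) = sandpile_Sylow_pairing x y.
  rewrite inE => /andP[]; rewrite inE => /andP[_ /morphicP am] /forallP ap.
  have aD x y : a (x + y) = a x + a y by apply: am; rewrite inE.
  have a0 : a 0 = 0 by apply: (addrI (a 0)); rewrite -aD !addr0.
  have aN x : a (- x) = - a x by apply/eqP; rewrite -addr_eq0 -aD addNr a0.
  split=> x y; first by rewrite /= raddfB /= aD aN.
  by rewrite (eqP (forallP (ap _) _)) f0_pair.
rewrite -cardsT -cardsX.
rewrite -(card_in_imset (f := fun u : G * {perm G} => ph u.2 u.1)).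
  apply: eq_card => F; rewrite inE; apply/asboolP/imsetP.
    move=> fF; have [f [f_bij fE FE]] := full_extend fF.
    have f_pair x y : pairG (f x) (f y) = sandpile_Sylow_pairing x y.
      by rewrite !fE (full_pairing p_pr pG dG fF).
    have a_inj : injective (fun b => f (h0 b)).
      move=> b b' /(bij_inj f_bij)/(congr1 f0); by rewrite !hf0.
    exists (F i0, perm a_inj).
      rewrite inE /= finset.in_setT /= inE; apply/andP; split.
        rewrite inE; apply/andP; split.
          by apply/fintype.subsetP => x _; rewrite inE.
        apply/morphicP => x y _ _; rewrite !permE.
        have -> : h0 (x * y)%g = h0 x + h0 y.
          by apply: (bij_inj f0_bij); rewrite raddfD /= !hf0.
        by rewrite raddfD.
      apply/forallP => x; apply/forallP => y; rewrite !permE f_pair -f0_pair !hf0 //.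
    by rewrite {1}FE; apply/ffunP => i; rewrite !ffunE /= permE fh0.
  move=> [[u a]]; rewrite inE /= => /andP[_ aA] ->.
  have [addf pf] := autP a aA.
  pose f : {additive Sp -> G} := HB.pack (a \o f0) (GRing.isAdditive.Build Sp G _ addf).
  have -> : ph a u = extend f u by apply/ffunP => i; rewrite !ffunE.
  apply: extend_full => //.
  by apply: bij_comp => //; exists (a^-1)%g => x; rewrite ?permK ?permKV.
move=> [u a] [v b]; rewrite !finset.in_setX /= => /andP[_ aA] /andP[_ bA] phE.
have [adda pa] := autP a aA; have [addb pb] := autP b bA.
pose fa : {additive Sp -> G} := HB.pack (a \o f0) (GRing.isAdditive.Build Sp G _ adda).
pose fb : {additive Sp -> G} := HB.pack (b \o f0) (GRing.isAdditive.Build Sp G _ addb).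
have si0 : s i0 = 0 by apply/rep_eq0P; exists (w i0); rewrite sE subrr mul0rn add0r.
have uv : u = v.
  have := congr1 (fun F : {ffun 'I_n -> G} => F i0) phE; rewrite !ffunE si0.
  have -> : a (f0 0) = 0 by exact: (raddf0 fa).
  have -> : b (f0 0) = 0 by exact: (raddf0 fb).
  by rewrite mul0rn !addr0.
congr (_, _); first exact: uv.
apply/permP => x; rewrite -[x]hf0.
have ea : ph a u = extend fa u by apply/ffunP => i; rewrite !ffunE.
have eb : ph b v = extend fb v by apply/ffunP => i; rewrite !ffunE.
rewrite -[LHS]/(fa (h0 x)) -[RHS]/(fb (h0 x)).
by rewrite -(restr_extend fa u) -(restr_extend fb v) -ea -eb phE.
Qed.

End Count.

(** A graph with nonconstant kernel vectors has no full function even if its Sylow subgroup is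
    isometric to [G]; hence [lap_ker_const] in the condition. *)
Lemma card_full p (G : finZmodType) (pairG : G -> G -> QZ) n (E : graph n) :
  prime p -> (p.-group [set: G])%g -> duality_pairing pairG -> (0 < n)%N ->
  #|[set F | `[< full p pairG E F >]]| =
  if `[< lap_ker_const E /\ pairing_iso (@sandpile_Sylow_pairing p n E) pairG >]
  then (#|G| * #|pairing_Aut pairG|)%N else 0%N.
Proof.
move=> p_pr pG dG; case: n E => // n E _; case: asboolP => [[kerL iso]|no].
  have [m [m' [s [w [mm' cpm sE]]]]] := @exists_sections p G p_pr pG _ E ord0 kerL.
  exact: (card_full_sections p_pr pG dG mm' cpm sE iso).
apply: eq_card0 => F; rewrite inE; apply/negP => /asboolP fF; apply: no; split.
  exact: (full_ker_const p_pr fF).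
exact: (full_iso p_pr pG dG fF).
Qed.

(** * From embeddings to matrices modulo prime powers *)

Lemma lap_row n (E : graph n) m (M : 'M[int]_(m, n)) a :
  laplacian E *m (row a M)^T = (row a (M *m laplacian E))^T.
Proof. by rewrite row_mul trmx_mul laplacian_sym. Qed.

Lemma dot_rows n m m' (M : 'M[int]_(m, n)) (M' : 'M[int]_(m', n)) c a :
  dot (row c M)^T (row a M')^T = (M *m M'^T) c a.
Proof. by rewrite mxE; apply: eq_bigr => i _; rewrite !mxE. Qed.

Section Coordinates.
Variables (p : nat) (G : finZmodType) (pairG : G -> G -> QZ).
Hypotheses (p_pr : prime p) (dG : duality_pairing pairG).
Variables (r : nat) (g : 'I_r -> G) (ex : 'I_r -> nat).
Hypothesis ex_gt0 : forall a, (0 < ex a)%N.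
Hypothesis g_ord : forall a, g a *+ (p ^ ex a) = 0.
Hypothesis g_free : forall z : 'I_r -> int, \sum_a g a *~ z a = 0 ->
  forall a, ((p ^ ex a)%N%:Z %| z a)%Z.
Hypothesis g_span : forall b, exists z : 'I_r -> int, b = \sum_a g a *~ z a.
Variable gs : 'I_r -> G.
Hypothesis gsP : forall a c, pairG (gs a) (g c) = modZ ((a == c)%:R / (p ^ ex a)%:R).
Variable Gam : 'I_r -> 'I_r -> int.
Hypothesis gs_Gam : forall a, gs a = \sum_c g c *~ Gam c a.

Let pk_gt0 k : (0 < p ^ k)%N. Proof. by rewrite expn_gt0 prime_gt0. Qed.

Lemma exists_dual_coord b : exists z : 'I_r -> int,
  (forall a, pairG b (g a) = modZ ((z a)%:~R / (p ^ ex a)%:R)) /\ b = \sum_a gs a *~ z a.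
Proof.
have h a : exists z : int, pairG b (g a) = modZ (z%:~R / (p ^ ex a)%:R).
  by apply: QZ_torsion => //; rewrite pmulrn -(pairMzr dG) -pmulrn g_ord (pairC dG) (pair0l dG).
by have [z hz] := choice h; exists z; split => //; exact: (dual_expand dG g_span gsP hz).
Qed.

Lemma g_congr (z z' : 'I_r -> int) : (forall a, ((p ^ ex a)%N%:Z %| (z a - z' a)%R)%Z) ->
  \sum_a g a *~ z a = \sum_a g a *~ z' a.
Proof.
move=> h; apply: eq_bigr => a _; apply/eqP; rewrite -subr_eq0 -mulrzBr.
by rewrite (g_dvd g_ord).
Qed.

Lemma g_inj (z z' : 'I_r -> int) : \sum_a g a *~ z a = \sum_a g a *~ z' a ->
  forall a, ((p ^ ex a)%N%:Z %| (z a - z' a)%R)%Z.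
Proof.
move=> h; apply: g_free.
by under eq_bigr do rewrite mulrzBr; rewrite sumrB h subrr.
Qed.

(* The dual generators generate [G], so their coordinate matrix is invertible
   modulo [p]. *)
Lemma Gam_inj (u : 'I_r -> int) : (forall a, (p%:Z %| (\sum_c u c * Gam c a)%R)%Z) ->
  forall c, (p%:Z %| u c)%Z.
Proof.
move=> hu c0; have [z [_ hz]] := exists_dual_coord (g c0).
have : \sum_c g c *~ (\sum_a Gam c a * z a) = \sum_c g c *~ (c == c0)%:Z.
  transitivity (g c0).
    rewrite [RHS]hz; under [RHS]eq_bigr do rewrite gs_Gam mulrz_suml.
    rewrite exchange_big /=; apply: eq_bigr => c _; rewrite mulrz_sumr.
    by apply: eq_bigr => a _; rewrite mulrzA.
  by rewrite (bigD1 c0) //= eqxx big1 ?addr0 // => c /negPf->.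
move=> /g_inj h.
have hp c : (p%:Z %| ((\sum_a Gam c a * z a) - (c == c0)%:Z)%R)%Z.
  apply: dvdz_trans (h c); rewrite -(prednK (ex_gt0 c)) expnS PoszM.
  exact: dvdz_mulr.
have -> : u c0 = \sum_a (\sum_c u c * Gam c a) * z a -
   \sum_c u c * ((\sum_a Gam c a * z a) - (c == c0)%:Z).
  under [X in _ - X]eq_bigr do rewrite mulrBr.
  rewrite sumrB.
  have -> : \sum_a (\sum_c u c * Gam c a) * z a = \sum_c u c * (\sum_a Gam c a * z a).
    under eq_bigr do rewrite mulr_suml.
    rewrite exchange_big; apply: eq_bigr => c _ /=; rewrite mulr_sumr.
    by apply: eq_bigr => a _; rewrite mulrA.
  rewrite opprB addrCA subrr addr0 (bigD1 c0) //= eqxx mulr1 big1 ?addr0 //.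
  by move=> c /negPf->; rewrite mulr0.
by rewrite rpredB // rpred_sum // => a _; [rewrite dvdz_mulr|rewrite dvdz_mull].
Qed.

Variables (n k : nat) (E : graph n).
Local Notation L := (laplacian E).

Definition basis_fun (phi : 'M[int]_(r, n)) : {ffun 'I_n -> G} :=
  [ffun i => \sum_a g a *~ phi a i].

Lemma act_basis phi (v : 'cV[int]_n) :
  act (basis_fun phi) v = \sum_a g a *~ (phi *m v) a 0.
Proof.
rewrite /act; under eq_bigr do rewrite ffunE mulrz_suml.
rewrite exchange_big /=; apply: eq_bigr => a _; rewrite mxE mulrz_sumr.
by apply: eq_bigr => i _; rewrite mulrzA.
Qed.

Lemma lap_hom_basis phi : lap_hom E (basis_fun phi) <->
  forall a j, ((p ^ ex a)%N%:Z %| (phi *m L)%R a j)%Z.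
Proof.
have e j : \sum_i basis_fun phi i *~ L i j = \sum_a g a *~ (phi *m L) a j.
  transitivity (act (basis_fun phi) (col j L)).
    by apply: eq_bigr => i _; rewrite [col j L i 0]mxE.
  by rewrite act_basis colE mulmxA -colE; apply: eq_bigr => a _; rewrite mxE.
split=> [/forallP h a j|h].
  by apply: (g_free (z := fun a => (phi *m L) a j)); rewrite -e; apply/eqP.
by apply/forallP => j; rewrite e big1 // => a _; apply: (g_dvd g_ord).
Qed.

(* [T] and [U] are the quotients of the rows of [phi L] and [psi L] by their
   moduli. *)
Definition lattice_data (phi : 'M[int]_(r, n)) (psi : 'M[int]_(k, n))
    (T : 'M[int]_(r, n)) (U : 'M[int]_(k, n)) : Prop :=
  [/\ forall a j, (phi *m L) a j = (p ^ ex a)%N%:Z * T a j,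
      forall c j, (psi *m L) c j = p%:Z * U c j,
      forall c a, ((p ^ ex c)%N%:Z %| ((phi *m T^T) c a - Gam c a)%R)%Z,
      forall c a, (p%:Z %| (psi *m T^T)%R c a)%Z &
      forall c a, ((p ^ ex c)%N%:Z %| (phi *m U^T)%R c a)%Z].

(** Writing [b] in the dual generators gives one rational lift, the sum of the
    [z_a phi_a / p^(ex a)]; any other lift differs from it by an integral vector [y]. *)
Lemma adjoint_coord phi (T : 'M[int]_(r, n)) b x T0 :
  (forall a j, (phi *m L) a j = (p ^ ex a)%N%:Z * T a j) ->
  adjoint pairG E (basis_fun phi) b x T0 ->
  exists (z : 'I_r -> int) (y : 'cV[int]_n), b = \sum_a gs a *~ z a /\
    T0 = T^T *m (\col_a z a) + L *m y.
Proof.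
move=> hT [hx hT0]; have [z [hz bE]] := exists_dual_coord b.
pose w i : rat := \sum_a (phi a i)%:~R * ((z a)%:~R / (p ^ ex a)%:R).
have yi i : x i 0 - w i \is a Num.int.
  apply/modZ_eqP; rewrite hx ffunE (pair_sumr dG) modZ_sum; apply: eq_bigr => a _.
  by rewrite (pairMzr dG) hz -modZ_mulz; congr modZ; rewrite -mulrzr mulrC.
exists z, (\col_i numq (x i 0 - w i)); split => //.
have xE i : x i 0 = w i + ((\col_i numq (x i 0 - w i)) i 0)%:~R.
  by rewrite mxE; have /intrP[u hu] := yi i; rewrite hu numq_int -hu addrC subrK.
apply/colP => j; apply: (@intr_inj rat).
move/colP/(_ j): hT0; rewrite [LHS]mxE => ->.
rewrite [RHS in _ = RHS](_ : _ = ((T^T *m (\col_a z a)) j 0)%:~R +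
   ((L *m \col_i numq (x i 0 - w i)) j 0)%:~R); last by rewrite -rmorphD; congr (_%:~R); rewrite [LHS]mxE.
have LHSE : (map_mx intr L *m x) j 0 = \sum_i (L j i)%:~R * x i 0.
  by rewrite mxE; apply: eq_bigr => i _; rewrite mxE.
rewrite LHSE; under eq_bigr do rewrite xE mulrDr.
rewrite big_split /=; congr (_ + _); last first.
  by rewrite [X in _ = X%:~R]mxE rmorph_sum; apply: eq_bigr => i _ /=; rewrite rmorphM.
rewrite [X in _ = X%:~R]mxE rmorph_sum /= /w.
under eq_bigr do rewrite mulr_sumr.
rewrite exchange_big /=; apply: eq_bigr => a _.
rewrite rmorphM /= !mxE.
have := hT a j; rewrite mxE => /(congr1 (fun t : int => t%:~R : rat)).
rewrite rmorph_sum rmorphM /= => h.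
transitivity ((\sum_i (phi a i * L i j)%:~R) * ((z a)%:~R / (p ^ ex a)%:R) : rat).
  rewrite mulr_suml; apply: eq_bigr => i _.
  have -> : L j i = L i j by rewrite -{1}(laplacian_sym E) [LHS]mxE.
  by rewrite rmorphM /=; ring.
rewrite h -pmulrn; field.
by rewrite pnatr_eq0 -lt0n.
Qed.

Lemma adjoint_basis phi (T : 'M[int]_(r, n)) a : (forall a j, (phi *m L) a j = (p ^ ex a)%N%:Z * T a j) ->
  adjoint pairG E (basis_fun phi) (gs a)
    (\col_i ((phi a i)%:~R / (p ^ ex a)%:R)) (row a T)^T.
Proof.
move=> hT; split=> [i|]; first by rewrite mxE ffunE (pair_gs dG gsP).
apply/colP => j; rewrite [RHS]mxE ![LHS]mxE.
under eq_bigr do rewrite mxE [X in _ * X]mxE mulrA.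
rewrite -mulr_suml.
have := hT a j; rewrite mxE => /(congr1 (fun t : int => t%:~R : rat)).
rewrite rmorph_sum rmorphM /= => h.
have -> : \sum_i (L j i)%:~R * (phi a i)%:~R = \sum_i (phi a i * L i j)%:~R :> rat.
  apply: eq_bigr => i _.
  have -> : L j i = L i j by rewrite -{1}(laplacian_sym E) [LHS]mxE.
  by rewrite rmorphM mulrC.
by rewrite h -pmulrn mulrAC mulfV ?mul1r ?pnatr_eq0 -?lt0n // !mxE.
Qed.

(** It suffices to test the dual generators, whose adjoint vectors are the rows of [T]: all other
    adjoint vectors are combinations of these modulo the image of [L]. *)
Lemma lattice_dataP phi psi : (exists T U, lattice_data phi psi T U) <->
  embedding pairG E (basis_fun phi) /\
  forall c, kills p pairG E (basis_fun phi) (row c psi)^T.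
Proof.
split.
  move=> [T [U [hT hU hTT hpT hU2]]].
  have lh : lap_hom E (basis_fun phi).
    by apply/lap_hom_basis => a j; rewrite hT dvdz_mulr.
  split; first split => // b x T0 ad.
    have [z [y [-> ->]]] := adjoint_coord hT ad.
    rewrite actD (lap_homP _ lh) addr0 act_basis.
    transitivity (\sum_c g c *~ (\sum_a Gam c a * z a)).
      apply: g_congr => c; rewrite mulmxA mxE -sumrB rpred_sum // => a _.
      by rewrite [X in _ * X]mxE -mulrBl dvdz_mulr.
    under [RHS]eq_bigr do rewrite gs_Gam mulrz_suml.
    rewrite exchange_big /=; apply: eq_bigr => c _; rewrite mulrz_sumr.
    by apply: eq_bigr => a _; rewrite mulrzA.
  move=> c; split=> [j|b x T0 ad].
    by rewrite lap_row [((_)^T)%R j 0%R]mxE [row _ _ _ _]mxE hU dvdz_mulr.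
  have [z [y [_ ->]]] := adjoint_coord hT ad.
  rewrite dotC dotDl; apply: rpredD.
    rewrite dotC dotE trmxK mulmxA -row_mul mxE rpred_sum // => a _.
    by rewrite [X in X * _]mxE dvdz_mulr.
  rewrite dotC dot_sym ?laplacian_sym // lap_row /dot rpred_sum // => j _.
  by rewrite [X in X * _]mxE [X in X * _]mxE hU -mulrA dvdz_mulr.
move=> [[lh em] ki].
have hd := (lap_hom_basis phi).1 lh.
pose T : 'M[int]_(r, n) := \matrix_(a, j) ((phi *m L)%R a j %/ (p ^ ex a)%N%:Z)%Z.
have hT a j : (phi *m L) a j = (p ^ ex a)%N%:Z * T a j.
  by rewrite [T a j]mxE mulrC divzK.
have hpL c j : (p%:Z %| (psi *m L)%R c j)%Z.
  by have [/(_ j) + _] := ki c; rewrite lap_row [((_)^T)%R j 0%R]mxE [row _ _ _ _]mxE.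
pose U : 'M[int]_(k, n) := \matrix_(c, j) ((psi *m L)%R c j %/ p%:Z)%Z.
have hU c j : (psi *m L) c j = p%:Z * U c j.
  by rewrite [U c j]mxE mulrC divzK.
have hpT c a : (p%:Z %| (psi *m T^T)%R c a)%Z.
  by have [_ /(_ _ _ _ (adjoint_basis a hT))] := ki c; rewrite dot_rows.
exists T, U; split => //.
  move=> c a; have := em _ _ _ (adjoint_basis a hT); rewrite act_basis gs_Gam.
  move=> /g_inj/(_ c); rewrite (_ : (phi *m (row a T)^T) c 0 = (phi *m T^T) c a) //.
  by rewrite !mxE; apply: eq_bigr => i _; rewrite !mxE.
(* By symmetry of [L], [p (phi U^T) c a] equals [p^(ex c) (psi T^T) a c], and the last factor is
   divisible by [p]. *)
move=> c a; have /dvdzP[u hu] := hpT a c.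
have p0 : p%:Z != 0 by rewrite -lt0n prime_gt0.
apply/dvdzP; exists u; apply: (mulfI p0).
have e1 : p%:Z * (phi *m U^T) c a = (phi *m (psi *m L)^T) c a.
  rewrite [in LHS]mxE [RHS]mxE mulr_sumr; apply: eq_bigr => j _.
  by rewrite [U^T j a]mxE [((psi *m L)^T) j a]mxE hU mulrCA.
have e2 : (phi *m (psi *m L)^T) c a = (p ^ ex c)%N%:Z * (psi *m T^T) a c.
  rewrite trmx_mul laplacian_sym mulmxA [LHS]mxE [(psi *m T^T) a c]mxE mulr_sumr.
  by apply: eq_bigr => j _; rewrite hT [psi^T j a]mxE [T^T j c]mxE -mulrA [T c j * _]mulrC.
by rewrite e1 e2 hu; ring.
Qed.

End Coordinates.

(** * Independence of rows modulo p and modulo p^N *)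

Definition indep_mod (p : nat) m n (M : 'M[int]_(m, n)) : Prop :=
  forall u : 'rV[int]_m, (forall i, (p%:Z %| (u *m M)%R 0%R i)%Z) ->
  forall c, (p%:Z %| u 0%R c)%Z.

Definition liftz (q m n : nat) (M : 'M['I_q]_(m, n)) : 'M[int]_(m, n) :=
  map_mx (fun x : 'I_q => (x : nat)%:Z) M.

Lemma map_augment (S : comNzRingType) m n (M : 'M[int]_(m, n)) :
  map_mx intr (augment M) = augment (map_mx intr M) :> 'M[S]_(m + 1, n).
Proof. by rewrite /augment map_col_mx; congr col_mx; apply/matrixP => i j; rewrite !mxE. Qed.

Section PrimeField.
Variable p : nat.
Hypothesis p_pr : prime p.

Lemma Fp_intr_eq0 (z : int) : (z%:~R == 0 :> 'F_p) = (p%:Z %| z)%Z.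
Proof. by rewrite (dvdz_pcharf (pchar_Fp p_pr)). Qed.

Lemma liftz_Fp m n (M : 'M['F_p]_(m, n)) : map_mx intr (liftz M) = M.
Proof. by apply/matrixP => i j; rewrite !mxE -pmulrn natr_Zp. Qed.

Lemma indep_modF m n (M : 'M[int]_(m, n)) :
  inj_rows (map_mx intr M : 'M['F_p]_(m, n)) <-> indep_mod p M.
Proof.
split=> [inj u hu c|ind l lM].
  have := inj (map_mx intr u); rewrite -map_mxM => h.
  have /h/rowP/(_ c) : map_mx intr (u *m M) = 0 :> 'rV['F_p]_n.
    by apply/rowP => i; rewrite mxE [RHS]mxE; apply/eqP; rewrite Fp_intr_eq0.
  by rewrite !mxE => /eqP; rewrite Fp_intr_eq0.
rewrite -(liftz_Fp l); apply/rowP => c; rewrite mxE [RHS]mxE; apply/eqP.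
rewrite Fp_intr_eq0; apply: ind => i.
have := congr1 (fun v : 'rV['F_p]_n => v 0 i) lM.
rewrite -{1}(liftz_Fp l) -map_mxM mxE [RHS]mxE => /eqP.
by rewrite Fp_intr_eq0.
Qed.

End PrimeField.

Section PrimePowerRing.
Variables (p N : nat).
Hypotheses (p_pr : prime p) (N0 : (0 < N)%N).
Local Notation A := 'Z_(p ^ N).

Let pk_gt0 k : (0 < p ^ k)%N. Proof. by rewrite expn_gt0 prime_gt0. Qed.

Lemma ZpN_intr_eq0 (z : int) : (z%:~R == 0 :> A) = ((p ^ N)%N%:Z %| z)%Z.
Proof.
case: z => k; first by rewrite -pmulrn ZpN_eq0.
by rewrite NegzE mulrNz oppr_eq0 -pmulrn ZpN_eq0 // dvdzN.
Qed.

Lemma liftz_ZpN m n (M : 'M[A]_(m, n)) : map_mx intr (liftz M) = M.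
Proof. by apply/matrixP => i j; rewrite !mxE -pmulrn natr_Zp. Qed.

Lemma ppow_intr j : ppow p N j = (p ^ j)%N%:~R.
Proof. by rewrite /ppow pmulrn. Qed.

Lemma in_ppow_intr j (z : int) : (j <= N)%N -> in_ppow j (z%:~R : A) = ((p ^ j)%N%:Z %| z)%Z.
Proof.
move=> jN; apply/in_ppowP/idP => [[y]|/dvdzP[y ->]].
  move=> /eqP; rewrite -[y]natr_Zp ppow_intr pmulrn -intrM -subr_eq0 -intrB ZpN_intr_eq0.
  move=> h; rewrite -(subrK ((p ^ j)%N%:Z * (y : nat)%:Z) z) rpredD ?dvdz_mulr //.
  apply: dvdz_trans h; rewrite -(subnKC jN) expnD PoszM; exact: dvdz_mulr.
by exists y%:~R; rewrite intrM ppow_intr mulrC.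
Qed.

Lemma exists_torsion_multiple m (l : 'rV[A]_m) : l != 0 ->
  exists s : nat, ppow p N s *: l != 0 /\ ppow p N 1 *: (ppow p N s *: l) = 0.
Proof.
move=> l0; have ex_t : exists t, ppow p N t *: l == 0.
  by exists N; rewrite ppowN // scale0r.
case: (ex_minnP ex_t) => -[|t] /eqP ht mint.
  by move: l0; rewrite -[l]scale1r -[1]/(ppow p N 0) ht eqxx.
exists t; split; last by rewrite scalerA -ppowD add1n.
by apply/negP => /mint; rewrite ltnn.
Qed.

(** A relation over Z/p^N has a nonzero multiple killed by [p], that is, [p^(N-1)] times a relation
    modulo [p]. Conversely, multiply a relation modulo [p] by [p^(N-1)]. *)
Lemma indep_modA m n (M : 'M[int]_(m, n)) :
  inj_rows (map_mx intr M : 'M[A]_(m, n)) <-> indep_mod p M.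
Proof.
have pN : (p ^ N = p ^ N.-1 * p)%N by rewrite -expnSr prednK.
have dvdpN (z : int) : ((p ^ N)%N%:Z %| ((p ^ N.-1)%N%:Z * z)%R)%Z = (p%:Z %| z)%Z.
  by rewrite pN PoszM dvdz_mul2l // -lt0n pk_gt0.
split=> [inj u hu c|ind l lM].
  have := inj (map_mx intr ((p ^ N.-1)%N%:Z *: u)); rewrite -map_mxM => h.
  have /h/rowP/(_ c) : map_mx intr ((p ^ N.-1)%N%:Z *: u *m M) = 0 :> 'rV[A]_n.
    apply/rowP => i; rewrite mxE [RHS]mxE; apply/eqP.
    by rewrite ZpN_intr_eq0 -scalemxAl mxE dvdpN.
  by rewrite !mxE => /eqP; rewrite ZpN_intr_eq0 dvdpN.
apply/eqP; apply/negPn/negP => /exists_torsion_multiple[s [l'0 pl']].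
set l' := ppow p N s *: l in l'0 pl'.
have l'M : l' *m map_mx intr M = 0 by rewrite -scalemxAl lM scaler0.
have hy c : exists y : int, l' 0 c = ((p ^ N.-1)%N%:Z * y)%:~R.
  have := congr1 (fun v : 'rV[A]_m => v 0 c) pl'; rewrite mxE [RHS]mxE => h.
  have [y ->] := ppow_annP p_pr N0 N0 h; exists (y : nat)%:Z.
  by rewrite intrM -ppow_intr -pmulrn natr_Zp subn1.
have [y hy'] := choice hy.
have l'E : l' = map_mx intr ((p ^ N.-1)%N%:Z *: \row_c y c).
  by apply/rowP => c; rewrite hy' !mxE.
have yp c : (p%:Z %| y c)%Z.
  have -> : y c = (\row_c y c) 0 c by rewrite mxE.
  apply: ind => i; rewrite -dvdpN -ZpN_intr_eq0; apply/eqP.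
  have := congr1 (fun v : 'rV[A]_n => v 0 i) l'M; rewrite /= [RHS]mxE => <-.
  by rewrite l'E -map_mxM -scalemxAl !mxE.
case/negP: l'0; apply/eqP/rowP => c; rewrite hy' [RHS]mxE; apply/eqP.
by rewrite ZpN_intr_eq0 dvdpN.
Qed.

End PrimePowerRing.

(** * Stacking phi and psi into one matrix *)

Section Block.
Variables (p : nat) (r k n : nat) (ex : 'I_r -> nat) (Gam : 'I_r -> 'I_r -> int) (E : graph n).
Local Notation L := (laplacian E).

Definition exb (c : 'I_(r + k)) : nat := if fintype.split c is inl a then ex a else 1%N.

(** The modulus is that of the row, except that nothing is imposed on the block [psi U^T]. This
    exception is the source of the factor [p ^ (k + 'C(k, 2))] in [prod_exb_wxb]. *)
Definition wxb (c a : 'I_(r + k)) : nat :=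
  if (fintype.split c, fintype.split a) is (inr _, inr _) then 0%N else exb c.

Definition Gamz : 'M[int]_(r + k) := block_mx (\matrix_(c, a) Gam c a) 0 0 0.

Lemma exb_l a : exb (lshift k a) = ex a.
Proof. by rewrite /exb (unsplitK (inl a)). Qed.

Lemma exb_r c : exb (rshift r c) = 1%N.
Proof. by rewrite /exb (unsplitK (inr c)). Qed.

Lemma wxb_l a d : wxb (lshift k a) d = ex a.
Proof. by rewrite /wxb (unsplitK (inl a)) exb_l. Qed.

Lemma wxb_rl c a : wxb (rshift r c) (lshift k a) = 1%N.
Proof. by rewrite /wxb (unsplitK (inl a)) (unsplitK (inr c)) exb_r. Qed.

Lemma wxb_rr c a : wxb (rshift r c) (rshift r a) = 0%N.
Proof. by rewrite /wxb !(unsplitK (inr _)). Qed.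

Definition block_data (M T : 'M[int]_(r + k, n)) : Prop :=
  (forall c j, (M *m L) c j = (p ^ exb c)%N%:Z * T c j) /\
  (forall c a, ((p ^ wxb c a)%N%:Z %| ((M *m T^T) c a - Gamz c a)%R)%Z).

Lemma block_lattice phi psi T U : block_data (col_mx phi psi) (col_mx T U) <->
  lattice_data p ex Gam E phi psi T U.
Proof.
rewrite /block_data tr_col_mx mul_col_row mul_col_mx; split.
  case=> h1 h2; split.
  - by move=> a j; have := h1 (lshift k a) j; rewrite !col_mxEu exb_l.
  - by move=> a j; have := h1 (rshift r a) j; rewrite !col_mxEd exb_r expn1.
  - by move=> c a; have := h2 (lshift k c) (lshift k a); rewrite wxb_l !block_mxEul [in X in X -> _]mxE.
  - by move=> c a; have := h2 (rshift r c) (lshift k a); rewrite wxb_rl expn1 !block_mxEdl [X in _ - X]mxE subr0.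
  - by move=> c a; have := h2 (lshift k c) (rshift r a); rewrite wxb_l !block_mxEur [X in _ - X]mxE subr0.
case=> h1 h2 h3 h4 h5; split=> [c j|c a].
  by case: (split_ordP c) => c' ->; rewrite ?col_mxEu ?col_mxEd ?exb_l ?exb_r ?expn1 ?h1 ?h2.
case: (split_ordP c) => c' ->; case: (split_ordP a) => a' ->.
- by rewrite wxb_l !block_mxEul [X in _ - X]mxE.
- by rewrite wxb_l !block_mxEur [X in _ - X]mxE subr0.
- by rewrite wxb_rl expn1 !block_mxEdl [X in _ - X]mxE subr0.
- by rewrite wxb_rr expn0 dvd1z.
Qed.

Lemma block_dataP M : (exists T, block_data M T) <->
  exists T U, lattice_data p ex Gam E (usubmx M) (dsubmx M) T U.
Proof.
split=> [[T]|[T [U]]].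
  rewrite -{1}[M]vsubmxK -{1}[T]vsubmxK => /block_lattice h.
  by exists (usubmx T), (dsubmx T).
by move=> /block_lattice; rewrite vsubmxK; exists (col_mx T U).
Qed.

Variable N : nat.
Hypotheses (p_pr : prime p) (N0 : (0 < N)%N).
Hypotheses (ex_le : forall a, (ex a < N)%N) (exD_le : forall c a, (ex c + ex a <= N)%N).
Local Notation A := 'Z_(p ^ N).
Let Gamb : 'M[A]_(r + k) := map_mx intr Gamz.

Lemma exb_le c : (exb c <= N)%N.
Proof. by case: (split_ordP c) => a ->; rewrite ?exb_l ?exb_r // ltnW. Qed.

Lemma mub_le c a : (wxb c a + exb a <= N)%N.
Proof.
case: (split_ordP c) => c' ->; case: (split_ordP a) => a' ->;
  rewrite ?wxb_l ?wxb_rl ?wxb_rr ?exb_l ?exb_r //.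
  by rewrite addn1.
Qed.

Lemma mubC c a : (wxb c a + exb a = wxb a c + exb c)%N.
Proof.
by case: (split_ordP c) => c' ->; case: (split_ordP a) => a' ->;
  rewrite ?wxb_l ?wxb_rl ?wxb_rr ?exb_l ?exb_r // addnC.
Qed.

Lemma valuesP (F : 'M[A]_(r + k, n)) :
  F *m lapmx A E \in values exb wxb Gamb F <-> exists T, block_data (liftz F) T.
Proof.
have FL : F *m lapmx A E = map_mx intr (liftz F *m L) by rewrite map_mxM liftz_ZpN.
have FT T : map_mx intr (liftz F *m T^T) = F *m (map_mx intr T)^T :> 'M[A]_(r + k).
  by rewrite map_mxM liftz_ZpN map_trmx.
have pN j : (j <= N)%N -> (p ^ N)%N%:Z = (p ^ j)%N%:Z * (p ^ (N - j))%N%:Z.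
  by move=> jN; rewrite -PoszM -expnD subnKC.
have pk0 j : (p ^ j)%N%:Z != 0 by rewrite -lt0n expn_gt0 prime_gt0.
split=> [/imsetP[T]|[T [h1 h2]]].
  rewrite inE => /andP[/forallP sh _] sc.
  have dv c j : ((p ^ N)%N%:Z %| ((liftz F *m L) c j - (p ^ exb c)%N%:Z * liftz T c j)%R)%Z.
    rewrite -ZpN_intr_eq0 // intrB subr_eq0 intrM -ppow_intr; apply/eqP.
    have := congr1 (fun M : 'M[A]_(r + k, n) => M c j) sc.
    rewrite FL mxE => ->; rewrite [LHS]mxE; congr (_ * _).
    by rewrite [liftz T c j]mxE -pmulrn natr_Zp.
  have d1 c j : ((p ^ exb c)%N%:Z %| (liftz F *m L)%R c j)%Z.
    rewrite -(subrK ((p ^ exb c)%N%:Z * liftz T c j) ((liftz F *m L) c j)).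
    rewrite rpredD ?dvdz_mulr //; apply: dvdz_trans (dv c j).
    by rewrite (pN _ (exb_le c)) dvdz_mulr.
  pose Tz : 'M[int]_(r + k, n) := \matrix_(c, j) ((liftz F *m L)%R c j %/ (p ^ exb c)%N%:Z)%Z.
  have hT c j : (liftz F *m L) c j = (p ^ exb c)%N%:Z * Tz c j.
    by rewrite [Tz c j]mxE mulrC divzK.
  (* The integral quotient agrees with the given [T] only modulo [p ^ (N - exb c)]; by [mub_le] this
     is fine enough for the moduli [wxb]. *)
  have dT c j : ((p ^ (N - exb c))%N%:Z %| (Tz c j - liftz T c j)%R)%Z.
    by have := dv c j; rewrite hT -mulrBr (pN _ (exb_le c)) dvdz_mul2l.
  exists Tz; split => // c a.
  have -> : (liftz F *m Tz^T) c a - Gamz c a =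
    (liftz F *m (Tz - liftz T)^T) c a + ((liftz F *m (liftz T)^T) c a - Gamz c a).
    have -> : liftz F *m Tz^T = liftz F *m (Tz - liftz T)^T + liftz F *m (liftz T)^T.
      by rewrite -mulmxDr -linearD subrK.
    by rewrite addrA; congr (_ - _); rewrite [LHS]mxE.
  apply: rpredD.
    rewrite mxE rpred_sum // => j _; rewrite dvdz_mull //.
    rewrite [((_)^T)%R j a]mxE; have := dT a j.
    rewrite [X in _ -> (_ %| X)%Z]mxE [X in _ -> (_ %| (_ + X)%R)%Z]mxE.
    apply: dvdz_trans.
    by rewrite dvdzE /= dvdn_exp2l // leq_subRL ?exb_le // addnC mub_le.
  have wN : (wxb c a <= N)%N by apply: leq_trans (mub_le c a); apply: leq_addr.
  rewrite -(in_ppow_intr p_pr N0) // intrB.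
  have /forallP/(_ a) := sh c.
  congr in_ppow; congr (_ - _); last by rewrite mxE.
  have := congr1 (fun M : 'M[A]_(r + k) => M c a) (FT (liftz T)).
  by rewrite liftz_ZpN mxE => ->.
apply/imsetP; exists (map_mx intr T).
  have sc : scale exb (map_mx intr T) = F *m lapmx A E.
    by rewrite FL; apply/matrixP => c j; rewrite [LHS]mxE [RHS]mxE h1 intrM ppow_intr mxE.
  rewrite inE -FT sc lap_in_range andbT; apply/forallP => c; apply/forallP => a.
  have wN : (wxb c a <= N)%N by apply: leq_trans (mub_le c a); apply: leq_addr.
  by rewrite mxE [Gamb c a]mxE -intrB in_ppow_intr.
by rewrite FL; apply/matrixP => c j; rewrite [RHS]mxE [LHS]mxE h1 intrM ppow_intr mxE.
Qed.

Hypothesis ex_gt0 : forall a, (0 < ex a)%N.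

(* A relation among the rows of [augment F], scaled to be killed by [p], gives
   a vector killed by the Laplacian; on a good graph it is not sparse. *)
Lemma good_code d (F : 'M[A]_(r + k, n)) : good_graph A d E -> code 0 F ->
  F *m lapmx A E \in values exb wxb Gamb F -> code d F.
Proof.
move=> /forallP gE c0 /imsetP[T _ FL]; apply/forallP => l; apply/implyP => l0.
have [s [l'0 pl']] := exists_torsion_multiple p_pr N0 l0.
set l' := ppow p N s *: l in l'0 pl'.
have v0 : l' *m augment F != 0.
  by apply/eqP => /(code_inj_rows c0)/eqP; rewrite (negPf l'0).
have vL : l' *m augment F *m lapmx A E = 0.
  rewrite -mulmxA /augment mul_col_mx FL.
  have -> : const_mx 1 *m lapmx A E = 0 :> 'rV[A]_n.
    by have := const_lapmx (1%:M : 'cV[A]_1) E; rewrite mul1mx.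
  rewrite -[l']hsubmxK mul_row_col mulmx0 addr0; apply/rowP => j; rewrite mxE [RHS]mxE.
  apply: big1 => c _; rewrite [scale _ _ _ _]mxE [lsubmx _ _ _]mxE.
  have e1 : (1 <= exb c)%N by case: (split_ordP c) => a ->; rewrite ?exb_l ?exb_r.
  rewrite -(subnKC e1) ppowD mulrA [l' _ _ * _]mulrA.
  have := congr1 (fun v : 'rV[A]_(r + k + 1) => v 0 (lshift 1 c)) pl'.
  by rewrite mxE [RHS]mxE [l' _ _ * _]mulrC => ->; rewrite !mul0r.
rewrite ltnNge; apply/negP => small; have := gE (l' *m augment F).
rewrite v0 vL eqxx implybF /= => /negP[]; apply: leq_trans small.
apply: subset_leq_card; apply/fintype.subsetP => i; rewrite !inE; apply: contra => /eqP h.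
by rewrite -scalemxAl mxE h mulr0.
Qed.

End Block.

Lemma code0P (A : finComNzRingType) m n (F : 'M[A]_(m, n)) :
  reflect (inj_rows (augment F)) (code 0 F).
Proof.
apply: (iffP idP) => [|inj]; first exact: code_inj_rows.
apply/forallP => l; apply/implyP => l0; rewrite lt0n cards_eq0.
apply/negP => /eqP/setP h; case/negP: l0; apply/eqP/inj/rowP => i.
by have := h i; rewrite !inE => /negbFE/eqP->; rewrite mxE.
Qed.

Lemma card_uniform (X : finZmodType) (Y : finType) (f : X -> Y) (K : {set X}) (W : {set Y}) :
  (forall y, exists x, f x = y) -> (forall x x', f x = f x' <-> x - x' \in K) ->
  (#|f @^-1: W| * #|Y| = #|W| * #|X|)%N.
Proof.
move=> surj fK.
have fib y : #|[set x | f x == y]| = #|K|.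
  have [x0 <-] := surj y; rewrite -[RHS](card_imset _ (addIr x0)).
  apply: eq_card => x; rewrite inE; apply/eqP/imsetP => [/fK h|[z zK ->]].
    by exists (x - x0) => //; rewrite subrK.
  by apply/fK; rewrite addrK.
have pre (V : {set Y}) : #|f @^-1: V| = (#|V| * #|K|)%N.
  rewrite -sum1_card (partition_big f (mem V)) /=; last by move=> x; rewrite inE.
  rewrite -sum_nat_const; apply: eq_bigr => y yV; rewrite sum1dep_card -(fib y).
  by apply: eq_card => x; rewrite !inE; case: eqP => [->|]; rewrite ?yV ?andbF.
rewrite pre; have := pre [set: Y]; rewrite preimsetT !cardsT => ->.
by rewrite mulnAC mulnA.
Qed.

(** * Tuples independent modulo constants *)

Section Frames.
Variables (p n : nat).
Hypotheses (p_pr : prime p) (n_gt0 : (0 < n)%N).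
Variable U : {set 'rV['F_p]_n}.
Hypothesis U1 : const_mx 1 \in U.
Hypothesis UD : forall u v, u \in U -> v \in U -> u + v \in U.

Definition frames k : {set 'M['F_p]_(k, n)} :=
  [set X | [forall c, row c X \in U] && code 0 X].

Definition aff_span k (X : 'M['F_p]_(k, n)) : {set 'rV['F_p]_n} :=
  [set l *m augment X | l : 'rV['F_p]_(k + 1)].

Lemma U_scale (a : 'F_p) u : u \in U -> a *: u \in U.
Proof.
move=> uU; rewrite -[a]natr_Zp scaler_nat; move: (a : nat); elim=> [|j IH]; last by rewrite mulrS UD.
rewrite mulr0n; suff : u *+ p \in U by rewrite -scaler_nat pchar_Fp_0 // scale0r.
have Um j : u *+ j.+1 \in U by elim: j => [|j IH]; rewrite ?mulr1n // mulrS UD.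
by have := Um p.-1; rewrite prednK ?prime_gt0.
Qed.

Lemma aff_span_sub k (X : 'M['F_p]_(k, n)) : (forall c, row c X \in U) -> aff_span X \subset U.
Proof.
move=> h; apply/fintype.subsetP => _ /imsetP[l _ ->].
have U0 : 0 \in U by rewrite -(scale0r (const_mx 1)) U_scale.
rewrite mulmx_sum_row; elim/big_ind: _ => // c _; apply: U_scale.
case: (split_ordP c) => a ->; rewrite /augment ?rowKu ?rowKd //.
by rewrite (_ : row a _ = const_mx 1) //; apply/rowP => i; rewrite !mxE.
Qed.

Lemma card_aff_span k (X : 'M['F_p]_(k, n)) : code 0 X -> #|aff_span X| = (p ^ (k + 1))%N.
Proof.
move=> /code0P inj; rewrite card_imset ?card_mx ?card_Fp ?mul1n //.
move=> l l' h; apply/eqP; rewrite -subr_eq0; apply/eqP/inj.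
by rewrite mulmxBl h subrr.
Qed.

Lemma code0_col k (X : 'M['F_p]_(k, n)) (v : 'rV['F_p]_n) :
  code 0 (col_mx X v) = code 0 X && (v \notin aff_span X).
Proof.
apply/code0P/andP => [inj|[/code0P inj nv]].
  split.
    apply/code0P => l; rewrite -[l]hsubmxK /augment mul_row_col => h.
    have := inj (row_mx (row_mx (lsubmx l) 0) (rsubmx l)).
    rewrite /augment !mul_row_col mul0mx addr0 h => /(_ erefl)/eqP.
    by rewrite !row_mx_eq0 => /andP[/andP[/eqP-> _] /eqP->]; rewrite row_mx0.
  apply/negP => /imsetP[l _ vE].
  have := inj (row_mx (row_mx (lsubmx l) (- 1%:M)) (rsubmx l)).
  have vE' : v = lsubmx l *m X + rsubmx l *m const_mx 1.
    by rewrite vE -{1}[l]hsubmxK /augment mul_row_col.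
  rewrite /augment !mul_row_col mulNmx mul1mx vE' opprD addrA subrr add0r addNr => /(_ erefl)/eqP.
  rewrite !row_mx_eq0 => /andP[/andP[_ +] _].
  by rewrite oppr_eq0 -scalemx1 scale1r => /eqP/matrixP/(_ 0 0)/eqP; rewrite !mxE oner_eq0.
move=> l; rewrite -[l]hsubmxK -[lsubmx l]hsubmxK /augment !mul_row_col.
set l1 := lsubmx (lsubmx l); set l2 := rsubmx (lsubmx l); set l3 := rsubmx l => h.
have l2E : l2 = (l2 0 0)%:M by rewrite [LHS]mx11_scalar.
have [l20|l20] := eqVneq (l2 0 0) 0; last first.
  case/negP: nv; apply/imsetP; exists (- (l2 0 0)^-1 *: row_mx l1 l3) => //.
  rewrite -scalemxAl /augment mul_row_col; apply: (scalerI l20).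
  rewrite scalerA mulrN mulfV // scaleN1r; apply/eqP.
  have -> : l2 0 0 *: v = l2 *m v by rewrite {2}l2E mul_scalar_mx.
  by rewrite -addr_eq0 addrC -addrA [_ + l2 *m v]addrC addrA h.
move: h; rewrite l2E l20 -scalemx1 scale0r mul0mx addr0 => h.
have := inj (row_mx l1 l3); rewrite /augment mul_row_col h => /(_ erefl)/eqP.
by rewrite row_mx_eq0 => /andP[/eqP-> /eqP->]; rewrite !row_mx0.
Qed.

(** The next row must avoid the span of the earlier ones and of the ones vector, which has
    [p ^ i.+1] elements, all in [U]. As a cardinal, the product is nonnegative; this is used later
    without knowing that [#|U|] is a power of [p]. *)
Lemma card_frames (R : realType) k :
  #|frames k|%:R = \prod_(i < k) (#|U|%:R - (p ^ i.+1)%:R) :> R.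
Proof.
elim: k => [|k IH].
  rewrite big_ord0 -[RHS]/(1%:R); congr (_%:R).
  transitivity #|{: 'M['F_p]_(0, n)}|; last by rewrite card_mx mul0n expn0.
  apply: eq_card => X; rewrite !inE; apply/andP; split; first by apply/forallP => -[].
  apply/code0P => l; rewrite -[l]hsubmxK /augment mul_row_col.
  rewrite [lsubmx l *m X](_ : _ = 0) ?add0r; last by apply/rowP => i; rewrite mxE big_ord0 mxE.
  move=> /rowP/(_ (Ordinal n_gt0)); rewrite !mxE big_ord1 !mxE mulr1 => h.
  apply/rowP => i; rewrite [RHS]mxE -h hsubmxK.
  by congr (l _ _); apply: val_inj; case: i => -[].
rewrite big_ord_recr -IH /=.
have -> : #|frames k.+1| = #|frames (k + 1)| by rewrite [(k + 1)%N]addn1.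
pose D := [set u : 'M['F_p]_(k, n) * 'rV['F_p]_n | (u.1 \in frames k) && (u.2 \in U :\: aff_span u.1)].
have -> : frames (k + 1) = [set col_mx u.1 u.2 | u in D].
  apply/setP => X; rewrite inE; apply/andP/imsetP => [[/forallP rX cX]|[[X' v]]].
    exists (usubmx X, dsubmx X); last by rewrite vsubmxK.
    move: cX; rewrite -{1}[X]vsubmxK code0_col => /andP[cu cv].
    rewrite !inE cu cv andbT /=; apply/andP; split.
      by apply/forallP => c; have := rX (lshift 1 c); rewrite -{1}[X]vsubmxK rowKu.
    have := rX (rshift k 0); rewrite -{1}[X]vsubmxK rowKd.
    by rewrite (_ : row 0 (dsubmx X) = dsubmx X) //; apply/rowP => i; rewrite mxE.
  rewrite !inE /= => /andP[/andP[/forallP rX' cX'] /andP[nv vU]] ->; split; last by rewrite code0_col cX'.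
  apply/forallP => c; case: (split_ordP c) => a ->; rewrite ?rowKu ?rowKd //.
  by rewrite (_ : row a v = v) //; apply/rowP => i; rewrite mxE (ord1 a).
rewrite card_in_imset; last by move=> [X v] [X' v'] _ _ /= /eq_col_mx[-> ->].
have -> : #|D| = (\sum_(X in frames k) #|U :\: aff_span X|)%N.
  rewrite -sum1_card (partition_big fst (mem (frames k))) /=; last by move=> u; rewrite inE => /andP[].
  apply: eq_bigr => X XF; rewrite -[RHS](card_imset _ (f := fun v => (X, v))); last by move=> v v' [].
  rewrite sum1dep_card; apply: eq_card => -[X' v]; rewrite inE /=.
  apply/andP/imsetP => [[h /eqP e]|[v' v'U [-> ->]]].
    by move: h; rewrite inE e /= => /andP[_ vU]; exists v.
  by rewrite !inE in XF v'U *; rewrite XF /= v'U.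
rewrite natr_sum (eq_bigr (fun _ => #|U|%:R - (p ^ k.+1)%:R)); last first.
  move=> X; rewrite inE => /andP[/forallP rX cX].
  rewrite cardsD (finset.setIidPr (aff_span_sub rX)) natrB ?subset_leq_card ?aff_span_sub //.
  by rewrite card_aff_span // addn1.
by rewrite sumr_const [RHS]mulr_natl.
Qed.

End Frames.

(** * From matrices modulo p^N to embeddings with frames *)

Section Reduction.
Variables (p : nat) (G : finZmodType) (pairG : G -> G -> QZ).
Hypotheses (p_pr : prime p) (dG : duality_pairing pairG).
Variables (r : nat) (g : 'I_r -> G) (ex : 'I_r -> nat).
Hypothesis ex_gt0 : forall a, (0 < ex a)%N.
Hypothesis g_ord : forall a, g a *+ (p ^ ex a) = 0.
Hypothesis g_free : forall z : 'I_r -> int, \sum_a g a *~ z a = 0 ->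
  forall a, ((p ^ ex a)%N%:Z %| z a)%Z.
Hypothesis g_span : forall b, exists z : 'I_r -> int, b = \sum_a g a *~ z a.
Variable gs : 'I_r -> G.
Hypothesis gsP : forall a c, pairG (gs a) (g c) = modZ ((a == c)%:R / (p ^ ex a)%:R).
Variable Gam : 'I_r -> 'I_r -> int.
Hypothesis gs_Gam : forall a, gs a = \sum_c g c *~ Gam c a.
Variables (n k : nat) (E : graph n).
Local Notation L := (laplacian E).

(** Pair a relation among all rows with the rows of [T]: the [psi] part gives 0 modulo [p], the ones
    row gives 0 since [T] has row sums 0, and the coefficients of [phi] get multiplied by [Gam],
    invertible modulo [p]. So the coefficients of [phi] in a relation vanish modulo [p]. *)
Lemma lattice_indep phi psi T U : lattice_data (k := k) p ex Gam E phi psi T U ->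
  indep_mod p (augment (col_mx phi psi)) <-> indep_mod p (augment psi).
Proof.
case=> hT _ hG hp _; split=> ind u.
  rewrite -[u]hsubmxK => hu c.
  have h := ind (row_mx (row_mx 0 (lsubmx u)) (rsubmx u)).
  have {}h : forall c, (p%:Z %| (row_mx (row_mx 0 (lsubmx u)) (rsubmx u) : 'rV[int]_(r + k + 1)) 0%R c)%Z.
    apply: h => i; have := hu i.
    by rewrite /augment !mul_row_col mul0mx add0r.
  case: (split_ordP c) => a ->; rewrite ?row_mxEl ?row_mxEr.
    by have := h (lshift 1 (rshift r a)); rewrite row_mxEl row_mxEr.
  by have := h (rshift (r + k) a); rewrite row_mxEr.
rewrite -[u]hsubmxK -[lsubmx u]hsubmxK /augment !mul_row_col.
set u1 := lsubmx (lsubmx u); set u2 := rsubmx (lsubmx u); set u3 := rsubmx u => hu.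
have T0 a : \sum_i T a i = 0.
  have pk0 : (p ^ ex a)%N%:Z != 0 by rewrite -lt0n expn_gt0 prime_gt0.
  apply: (mulfI pk0); rewrite mulr0 mulr_sumr; under eq_bigr do rewrite -hT.
  have h0 := lap_sum0 E (row a phi)^T; rewrite lap_row in h0; rewrite -[RHS]h0.
  by apply: eq_bigr => i _; rewrite [RHS]mxE [RHS]mxE.
have du1 c : (p%:Z %| u1 0%R c)%Z.
  apply: (Gam_inj p_pr dG ex_gt0 g_ord g_free g_span gsP gs_Gam (u := fun c => u1 0 c)) => a.
  have -> : \sum_c u1 0 c * Gam c a =
     ((u1 *m phi + u2 *m psi + u3 *m const_mx 1) *m (row a T)^T) 0 0
     - (u2 *m (psi *m (row a T)^T)) 0 0
     - \sum_c u1 0 c * ((phi *m T^T) c a - Gam c a).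
    have e1 : ((u1 *m phi + u2 *m psi + u3 *m const_mx 1) *m (row a T)^T) 0 0 =
        \sum_c u1 0 c * (phi *m T^T) c a + (u2 *m (psi *m (row a T)^T)) 0 0.
      rewrite !mulmxDl -!mulmxA [LHS]mxE [X in X + _ = _]mxE.
      rewrite [X in _ + _ + X](_ : _ = 0) ?addr0; last first.
        rewrite mxE big_ord1 [X in _ * X]mxE.
        under [X in _ * X]eq_bigr do rewrite !mxE mul1r.
        by rewrite T0 mulr0.
      congr (_ + _); rewrite mxE; apply: eq_bigr => c' _; congr (_ * _).
      by rewrite !mxE; apply: eq_bigr => i _; rewrite !mxE.
    rewrite e1 addrK; under [X in _ - X]eq_bigr do rewrite mulrBr.
    by rewrite sumrB opprB addrCA subrr addr0.
  rewrite !rpredB //.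
  - by rewrite mxE rpred_sum // => i _; rewrite dvdz_mulr.
  - rewrite mxE rpred_sum // => c' _; rewrite dvdz_mull //.
    have := hp c' a; rewrite (_ : (psi *m T^T) c' a = (psi *m (row a T)^T) c' 0) //.
    by rewrite !mxE; apply: eq_bigr => i _; rewrite !mxE.
  - rewrite rpred_sum // => c' _; rewrite dvdz_mull //; apply: dvdz_trans (hG c' a).
    by rewrite -(prednK (ex_gt0 c')) expnS PoszM dvdz_mulr.
have hv : forall c, (p%:Z %| (row_mx u2 u3 : 'rV[int]_(k + 1)) 0%R c)%Z.
  apply: ind => i; rewrite /augment mul_row_col.
  have -> : (u2 *m psi + u3 *m const_mx 1) 0 i =
    (u1 *m phi + u2 *m psi + u3 *m const_mx 1) 0 i - (u1 *m phi) 0 i.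
    rewrite -addrA [in RHS]mxE addrC addKr //.
  by rewrite rpredB // mxE rpred_sum // => c _; rewrite dvdz_mulr.
move=> c; case: (split_ordP c) => a ->; rewrite ?row_mxEl ?row_mxEr.
  case: (split_ordP a) => b ->; rewrite ?row_mxEl ?row_mxEr //.
  by have := hv (lshift 1 b); rewrite row_mxEl.
by have := hv (rshift k a); rewrite row_mxEr.
Qed.

Lemma kills_congr F (psi psi' : 'cV[int]_n) :
  (forall i, (p%:Z %| (psi i 0 - psi' i 0)%R)%Z) ->
  kills p pairG E F psi -> kills p pairG E F psi'.
Proof.
move=> h [h1 h2]; split=> [j|b x T ad].
  rewrite (_ : (L *m psi') j 0 = (L *m psi) j 0 - \sum_i L j i * (psi i 0 - psi' i 0)).
    by rewrite rpredB // rpred_sum // => i _; rewrite dvdz_mull.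
  rewrite [LHS]mxE [X in _ = X - _]mxE -sumrB; apply: eq_bigr => i _.
  by rewrite mulrBr opprB addrCA subrr addr0.
rewrite (_ : dot psi' T = dot psi T - \sum_i (psi i 0 - psi' i 0) * T i 0).
  by rewrite rpredB ?(h2 _ _ _ ad) // rpred_sum // => i _; rewrite dvdz_mulr.
rewrite /dot -sumrB; apply: eq_bigr => i _.
by rewrite mulrBl opprB addrCA subrr addr0.
Qed.

Definition killed (F : {ffun 'I_n -> G}) : {set 'rV['F_p]_n} :=
  [set v | `[< kills p pairG E F (liftz v)^T >] ].

Lemma killedP F m (psi : 'M[int]_(m, n)) c :
  row c (map_mx intr psi) \in killed F <-> kills p pairG E F (row c psi)^T.
Proof.
rewrite inE; set u := liftz _.
have h i : (p%:Z %| (u^T i 0 - (row c psi)^T i 0)%R)%Z.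
  rewrite -Fp_intr_eq0 // intrB subr_eq0; apply/eqP.
  by rewrite !mxE -pmulrn natr_Zp.
split=> [/asboolP|ki]; first exact: kills_congr.
by apply/asboolP; apply: kills_congr ki => i; rewrite -opprB rpredN.
Qed.

Lemma killed1 F : const_mx 1 \in killed F.
Proof.
rewrite inE; apply/asboolP.
apply: (@kills_congr F (const_mx 1)) => [i|].
  rewrite -Fp_intr_eq0 // intrB subr_eq0; apply/eqP.
  by rewrite !mxE -pmulrn natr_Zp.
split=> [j|b x T ad]; first by rewrite lap_const mxE dvdz0.
have -> : dot (const_mx 1) T = \sum_i T i 0 by apply: eq_bigr => i _; rewrite mxE mul1r.
by rewrite (adjoint_sum0 ad) dvdz0.
Qed.

Lemma killedD F u v : u \in killed F -> v \in killed F -> u + v \in killed F.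
Proof.
rewrite inE => /asboolP hu; rewrite inE => /asboolP hv; rewrite inE; apply/asboolP.
case: hu hv => [h1 h2] [h3 h4].
apply: (@kills_congr F ((liftz u)^T + (liftz v)^T)) => [i|].
  rewrite -Fp_intr_eq0 // intrB subr_eq0; apply/eqP.
  by rewrite !mxE intrD -!pmulrn !natr_Zp.
split=> [j|b x T ad]; first by rewrite mulmxDr mxE rpredD.
by rewrite dotDl rpredD ?(h2 _ _ _ ad) ?(h4 _ _ _ ad).
Qed.

(** [killed F] contains the constants, [p] in number when [n > 0], so the bound forces equality. *)
Lemma fullE F : full p pairG E F <-> embedding pairG E F /\ (#|killed F| <= p)%N.
Proof.
have cC : #|[set (const_mx a : 'rV['F_p]_n) | a : 'F_p]| = if (0 < n)%N then p else 1%N.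
  case: ifP => n0.
    rewrite card_imset ?card_Fp // => a b /rowP/(_ (Ordinal n0)).
    by rewrite !mxE.
  apply/eqP/cards1P; exists 0; apply/setP => v; rewrite !inE.
  have -> : v = 0 by apply/rowP => i; have := leq_ltn_trans (leq0n i) (ltn_ord i); rewrite n0.
  by rewrite eqxx; apply/imsetP; exists 0 => //; apply/rowP => i; rewrite !mxE.
have sub : [set (const_mx a : 'rV['F_p]_n) | a : 'F_p] \subset killed F.
  apply/fintype.subsetP => _ /imsetP[a _ ->].
  rewrite (_ : const_mx a = a *: const_mx 1); last by apply/rowP => i; rewrite !mxE mulr1.
  by rewrite (U_scale p_pr (@killedD F)) ?killed1.
split=> -[em h]; split => //.
  have -> : killed F = [set (const_mx a : 'rV['F_p]_n) | a : 'F_p].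
    apply/eqP; rewrite finset.eqEsubset sub andbT; apply/fintype.subsetP => v.
    rewrite inE => /asboolP/h hv.
    case: (posnP n) => [n0|n0].
      by apply/imsetP; exists 0 => //; apply/rowP => i; have := ltn_ord i; rewrite {2}n0.
    apply/imsetP; exists (v 0 (Ordinal n0)) => //; apply/rowP => i; rewrite [RHS]mxE.
    have := hv i (Ordinal n0); rewrite -Fp_intr_eq0 // intrB subr_eq0 => /eqP.
    by rewrite !mxE -!pmulrn !natr_Zp.
  by rewrite cC; case: ifP => // _; apply: prime_gt0.
move=> psi ki i j.
have n0 : (0 < n)%N by apply: leq_ltn_trans (ltn_ord i).
have /eqP eqU : [set (const_mx a : 'rV['F_p]_n) | a : 'F_p] == killed F.
  by rewrite eqEcard sub cC n0.
have /killedP : kills p pairG E F (row 0 psi^T)^T.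
  by rewrite (_ : (row 0 psi^T)^T = psi) //; apply/colP => x; rewrite !mxE.
rewrite -eqU => /imsetP[a _ /rowP ha].
rewrite -Fp_intr_eq0 // intrB subr_eq0; apply/eqP.
by have := ha i; have := ha j; rewrite !mxE => -> ->.
Qed.

Variable N : nat.
Hypotheses (N0 : (0 < N)%N) (ex_le : forall a, (ex a < N)%N).
Hypothesis exD_le : forall c a, (ex c + ex a <= N)%N.
Local Notation A := 'Z_(p ^ N).
Local Notation Y := ({ffun 'I_n -> G} * 'M['F_p]_(k, n))%type.

(** Forgets each row beyond its modulus [p ^ exb c]. The map is onto and its fibres are the cosets
    of one subgroup, so counting matrices amounts to counting pairs. *)
Definition reduce (M : 'M[A]_(r + k, n)) : Y :=
  (basis_fun g (usubmx (liftz M)), map_mx intr (dsubmx (liftz M))).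

Lemma reduce_eqP (X X' : 'M[int]_(r + k, n)) :
  ((basis_fun g (usubmx X), map_mx intr (dsubmx X)) : Y) =
    (basis_fun g (usubmx X'), map_mx intr (dsubmx X')) <->
  forall c i, ((p ^ exb ex c)%N%:Z %| (X c i - X' c i)%R)%Z.
Proof.
split=> [[/ffunP h1 /matrixP h2] c i|h].
  case: (split_ordP c) => a ->; rewrite ?exb_l ?exb_r ?expn1.
    have := h1 i; rewrite !ffunE => /(g_inj g_free)/(_ a).
    by rewrite !mxE.
  by rewrite -Fp_intr_eq0 // intrB subr_eq0; apply/eqP; have := h2 a i; rewrite !mxE.
congr pair.
  apply/ffunP => i; rewrite !ffunE; apply: (g_congr g_ord) => a.
  by have := h (lshift k a) i; rewrite exb_l !mxE.
apply/matrixP => a i; apply/eqP; rewrite [X in X == _]mxE [X in _ == X]mxE -subr_eq0 -intrB Fp_intr_eq0 //.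
by have := h (rshift r a) i; rewrite exb_r expn1 !mxE.
Qed.

Lemma reduce_surj (y : Y) : exists M, reduce M = y.
Proof.
case: y => F Psi; have [z hz] := choice (fun i => g_span (F i)).
pose X : 'M[int]_(r + k, n) := col_mx (\matrix_(a, i) z i a) (liftz Psi).
exists (map_mx intr X); transitivity ((basis_fun g (usubmx X), map_mx intr (dsubmx X)) : Y).
  apply/reduce_eqP => c i; rewrite -(in_ppow_intr p_pr N0) ?exb_le // intrB.
  apply/in_ppowP; exists 0; rewrite mulr0; apply/eqP; rewrite subr_eq0; apply/eqP.
  by rewrite [liftz _ _ _]mxE -pmulrn natr_Zp mxE.
rewrite /X col_mxKu col_mxKd liftz_Fp; congr pair; apply/ffunP => i.
by rewrite ffunE hz; apply: eq_bigr => a _; rewrite mxE.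
Qed.

Lemma reduce_ker (M M' : 'M[A]_(r + k, n)) : reduce M = reduce M' <->
  M - M' \in [set D : 'M[A]_(r + k, n) | [forall c, forall i, in_ppow (exb ex c) (D c i)]].
Proof.
rewrite inE; split=> [/reduce_eqP h|h].
  apply/forallP => c; apply/forallP => i; have := h c i.
  rewrite -(in_ppow_intr p_pr N0) ?exb_le // intrB; congr in_ppow.
  by rewrite !mxE -!pmulrn !natr_Zp.
apply/reduce_eqP => c i; rewrite -(in_ppow_intr p_pr N0) ?exb_le // intrB.
have /forallP/(_ i) := forallP h c; congr in_ppow.
by rewrite !mxE -!pmulrn !natr_Zp.
Qed.

Definition embedding_frames : {set Y} :=
  [set y | `[< embedding pairG E y.1 >] && (y.2 \in frames (killed y.1) k)].

(** On a good graph [code d] follows from mere independence of the rows by [good_code], so the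
    right-hand side is free of [d]. *)
Lemma code_valuesE d : good_graph A d E ->
  [set M : 'M[A]_(r + k, n) | code d M &&
     (M *m lapmx A E \in values (exb ex) (wxb ex) (map_mx intr (Gamz k Gam)) M)] =
  reduce @^-1: embedding_frames.
Proof.
move=> gE; apply/setP => M; rewrite !inE.
pose phi := usubmx (liftz M); pose psi := dsubmx (liftz M).
have ind0 T U : lattice_data p ex Gam E phi psi T U -> code 0 M <-> code 0 (reduce M).2.
  move=> ld; have := lattice_indep ld; rewrite vsubmxK => h.
  have e1 : map_mx intr (augment (liftz M)) = augment M :> 'M[A]__.
    by rewrite map_augment liftz_ZpN.
  have := indep_modA p_pr N0 (augment (liftz M)); rewrite e1 => h1.
  have := indep_modF p_pr (augment psi); rewrite map_augment => h2.
  split=> /code0P inj; apply/code0P; first by apply/h2/h/h1.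
  by apply/h1/h/h2.
apply/andP/andP => [[cM vM]|[/asboolP em /andP[/forallP kM cM]]].
  have c0 := code_leq (leq0n d) cM.
  have /(valuesP Gam E p_pr N0 ex_le exD_le)/block_dataP[T [U ld]] := vM.
  have [em ki] := (lattice_dataP p_pr dG g_ord g_free g_span gsP gs_Gam E phi psi).1 (ex_intro _ T (ex_intro _ U ld)).
  split; first exact/asboolP.
  apply/andP; split; last exact/(ind0 _ _ ld).
  by apply/forallP => c; apply/killedP.
have ki c : kills p pairG E (basis_fun g phi) (row c psi)^T.
  by apply/killedP; apply: kM.
have [T [U ld]] := (lattice_dataP p_pr dG g_ord g_free g_span gsP gs_Gam E phi psi).2 (conj em ki).
have c0 : code 0 M by apply/(ind0 _ _ ld).
have vM : M *m lapmx A E \in values (exb ex) (wxb ex) (map_mx intr (Gamz k Gam)) M.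
  by apply/(valuesP Gam E p_pr N0 ex_le exD_le)/block_dataP; exists T, U.
by split => //; apply: (good_code p_pr N0 ex_gt0 gE c0 vM).
Qed.

Lemma card_code_values d : (0 < n)%N -> good_graph A d E ->
  (#|[set M : 'M[A]_(r + k, n) | code d M &&
     (M *m lapmx A E \in values (exb ex) (wxb ex) (map_mx intr (Gamz k Gam)) M)]|
   * (#|G| * p ^ k) ^ n =
   (\sum_(F | `[< embedding pairG E F >]) #|frames (killed F) k|) * p ^ (N * ((r + k) * n)))%N.
Proof.
move=> n0 gE; rewrite (code_valuesE gE).
have := @card_uniform _ _ reduce _ embedding_frames reduce_surj reduce_ker.
rewrite card_prod card_ffun !card_mx card_ord card_Fp // card_ZpN // -expnM.
rewrite expnMn -expnM => ->; congr (_ * _)%N.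
rewrite -sum1_card (partition_big fst (fun F => `[< embedding pairG E F >])) /=; last first.
  by move=> y; rewrite inE => /andP[].
apply: eq_bigr => F emF; rewrite -[RHS](card_imset _ (f := fun X => (F, X))); last by move=> ? ? [].
rewrite sum1dep_card; apply: eq_card => -[F' X]; rewrite [LHS]inE /= [in LHS]inE /=.
apply/andP/imsetP => [[/andP[_ h] /eqP <-]|[X' h [-> ->]]]; first by exists X.
by rewrite emF h.
Qed.

End Reduction.

(** * Moments *)

Lemma sum_square (n : nat) (f : 'I_n -> 'I_n -> nat) :
  (\sum_c \sum_a f c a = \sum_c f c c + \sum_(c < n) \sum_(a < n | a < c) (f c a + f a c))%N.
Proof.
have -> : (\sum_(c < n) \sum_(a < n | a < c) (f c a + f a c) =
   \sum_(c < n) \sum_(a < n | a < c) f c a + \sum_(c < n) \sum_(a < n | c < a) f c a)%N.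
  under eq_bigr do rewrite big_split /=.
  rewrite big_split /=; congr addn.
  by rewrite (exchange_big_dep predT).
rewrite -!big_split /=; apply: eq_bigr => c _.
rewrite (bigD1 c) //= (bigID (fun a : 'I_n => a < c)%N) /=; congr (_ + (_ + _))%N.
  by apply: eq_bigl => a; rewrite -val_eqE /=; case: ltngtP.
by apply: eq_bigl => a; rewrite -val_eqE /=; case: ltngtP.
Qed.

Lemma square_bin2 k : (k * k = k + 2 * 'C(k, 2))%N.
Proof. by elim: k => // k IH; rewrite binS bin1; move: IH; lia. Qed.

Lemma sum_exb_wxb r k (ex : 'I_r -> nat) :
  (\sum_c exb (k := k) ex c +
     \sum_(c < r + k) \sum_(a < r + k | a < c) (wxb (k := k) ex c a + exb ex a) =
   \sum_c \sum_a wxb (k := k) ex c a + (k + 'C(k, 2)))%N.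
Proof.
(* [b] marks the [psi] rows: [wxb] falls short of [exb] exactly where two of them meet, which
   accounts for [k * k = k + 2 * 'C(k, 2)]. *)
pose b (c : 'I_(r + k)) : nat := (r <= c)%N.
have bl a : b (lshift k a) = 0%N by rewrite /b /= leqNgt ltn_ord.
have br a : b (rshift r a) = 1%N by rewrite /b /= leq_addr.
have wb c a : (exb ex c = wxb ex c a + b c * b a)%N.
  by case: (split_ordP c) => c' ->; case: (split_ordP a) => a' ->;
    rewrite ?wxb_l ?wxb_rl ?wxb_rr ?exb_l ?exb_r ?bl ?br ?muln0 ?addn0.
have sb : (\sum_c b c = k)%N.
  rewrite big_split_ord /= big1 ?add0n => [|a _]; last exact: bl.
  by under eq_bigr do rewrite br; rewrite sum1_card card_ord.
have e1 := sum_square (fun c a : 'I_(r + k) => exb ex c).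
have e2 := sum_square (fun c a : 'I_(r + k) => b c * b a)%N.
have e3 : (\sum_(c < r + k) \sum_(a < r + k) exb (k := k) ex c = \sum_c \sum_a wxb (k := k) ex c a + k * k)%N.
  have -> : (k * k = (\sum_c b c) * (\sum_c b c))%N by rewrite !sb.
  rewrite big_distrlr /= -big_split /=; apply: eq_bigr => c _.
  by rewrite -big_split /=; apply: eq_bigr => a _; rewrite -wb.
have e4 : (\sum_(c < r + k) \sum_(a < r + k) b c * b a = k * k)%N by rewrite -big_distrlr /= sb.
have e5 : (\sum_(c < r + k) b c * b c = k)%N.
  by rewrite -[RHS]sb; apply: eq_bigr => c _; rewrite /b; case: (_ <= _)%N.
have e6 : (\sum_(c < r + k) \sum_(a < r + k | a < c) (exb ex c + exb ex a) =
   \sum_(c < r + k) \sum_(a < r + k | a < c) (wxb (k := k) ex c a + exb ex a) +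
   \sum_(c < r + k) \sum_(a < r + k | a < c) b c * b a)%N.
  rewrite -big_split /=; apply: eq_bigr => c _; rewrite -big_split /=; apply: eq_bigr => a _.
  by rewrite (wb c a) addnAC.
have e7 : (\sum_(c < r + k) \sum_(a < r + k | a < c) (b c * b a + b a * b c) =
    2 * \sum_(c < r + k) \sum_(a < r + k | a < c) b c * b a)%N.
  rewrite big_distrr; apply: eq_bigr => c _ /=; rewrite big_distrr; apply: eq_bigr => a _ /=.
  by rewrite [(b a * _)%N]mulnC mul2n addnn.
have arith s1 s2 s3 s4 s5 s6 s7 s8 s9 kk j c : (s1 = s2 + s3 -> s4 = s5 + s6 -> s1 = s7 + kk ->
    s4 = kk -> s5 = j -> s3 = s8 + s9 -> s6 = 2 * s9 -> kk = j + 2 * c -> s2 + s8 = s7 + (j + c))%N.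
  by clear; lia.
exact: (arith _ _ _ _ _ _ _ _ _ _ _ _ e1 e2 e3 e4 e5 e6 e7 (square_bin2 k)).
Qed.

Lemma prod_exb_wxb p r k (ex : 'I_r -> nat) :
  ((\prod_c p ^ exb (k := k) ex c) *
     \prod_(c < r + k) \prod_(a < r + k) (if a < c then p ^ (wxb (k := k) ex c a + exb ex a) else 1) =
   (\prod_c \prod_a p ^ wxb (k := k) ex c a) * (p ^ k * p ^ 'C(k, 2)))%N.
Proof.
have e1 : (\prod_(c < r + k) \prod_(a < r + k) (if a < c then p ^ (wxb (k := k) ex c a + exb ex a) else 1) =
   p ^ (\sum_(c < r + k) \sum_(a < r + k | a < c) (wxb (k := k) ex c a + exb ex a)))%N.
  rewrite expn_sum; apply: eq_bigr => c _; rewrite expn_sum [RHS]big_mkcond; by [].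
have e2 : (\prod_c \prod_a p ^ wxb (k := k) ex c a = p ^ (\sum_c \sum_a wxb (k := k) ex c a))%N.
  by rewrite expn_sum; apply: eq_bigr => c _; rewrite expn_sum.
by rewrite e1 e2 -expn_sum -!expnD sum_exb_wxb.
Qed.

Lemma noncode0_small (A : finComNzRingType) (R : realType) m :
  vanishing (fun n => 1 - #|[set F : 'M[A]_(m, n) | code 0 F]|%:R / (#|A| ^ (n * m))%:R : R).
Proof.
have h2 : 0 < 2^-1 :> R by rewrite invr_gt0.
have [sA hA] := sparse_small A 1 h2.
pose s2 := maxn sA 2.
have s20 : (1 < s2)%N by rewrite /s2 leq_max orbT.
have hs n : (sparse_card A n 1 (n %/ s2))%:R <= (1 + 2^-1) ^+ n :> R.
  by apply: (hA s2); [rewrite leq_maxl|rewrite mulnC leq_trunc_div].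
apply: (vanishing_le (k := 1) (noncode_small m s20 hs)) => n n1.
have a0 : (0 < #|A|)%N by apply/card_gt0P; exists 0.
have an0 : 0 < (#|A| ^ (n * m))%:R :> R by rewrite ltr0n expn_gt0 a0.
have cU : (#|[set F : 'M[A]_(m, n) | code 0 F]| + #|[set F : 'M[A]_(m, n) | ~~ code 0 F]| = #|A| ^ (n * m))%N.
  rewrite [(n * m)%N]mulnC -card_mx -(cardsC [set F : 'M[A]_(m, n) | code 0 F]); congr addn.
  by apply: eq_card => F; rewrite !inE.
have -> : 1 - #|[set F : 'M[A]_(m, n) | code 0 F]|%:R / (#|A| ^ (n * m))%:R =
   #|[set F : 'M[A]_(m, n) | ~~ code 0 F]|%:R / (#|A| ^ (n * m))%:R :> R.
  by rewrite -{1}(mulfV (lt0r_neq0 an0)) -mulrBl -{1}cU natrD addrAC subrr add0r.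
rewrite ger0_norm ?divr_ge0 // ler_wpM2r ?invr_ge0 // ler_nat subset_leq_card //.
apply/fintype.subsetP => F; rewrite !inE; apply: contra; exact: code_leq.
Qed.

Section Moments.
Variables (p : nat) (G : finZmodType) (pairG : G -> G -> QZ).
Hypotheses (p_pr : prime p) (dG : duality_pairing pairG).
Variables (r : nat) (g : 'I_r -> G) (ex : 'I_r -> nat).
Hypothesis ex_gt0 : forall a, (0 < ex a)%N.
Hypothesis g_ord : forall a, g a *+ (p ^ ex a) = 0.
Hypothesis g_free : forall z : 'I_r -> int, \sum_a g a *~ z a = 0 ->
  forall a, ((p ^ ex a)%N%:Z %| z a)%Z.
Hypothesis g_span : forall b, exists z : 'I_r -> int, b = \sum_a g a *~ z a.
Hypothesis card_G : (\prod_a p ^ ex a)%N = #|G|.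
Variable gs : 'I_r -> G.
Hypothesis gsP : forall a c, pairG (gs a) (g c) = modZ ((a == c)%:R / (p ^ ex a)%:R).
Variable Gam : 'I_r -> 'I_r -> int.
Hypothesis gs_Gam : forall a, gs a = \sum_c g c *~ Gam c a.
Hypothesis Gam_sym : forall c a, (p ^ ex a)%N%:Z * Gam c a = (p ^ ex c)%N%:Z * Gam a c.
Variable N : nat.
Hypotheses (N0 : (0 < N)%N) (ex_le : forall a, (ex a < N)%N).
Hypothesis exD_le : forall c a, (ex c + ex a <= N)%N.
Local Notation A := 'Z_(p ^ N).
Variables (R : realType) (e : A -> R[i]) (q rho : R).
Hypothesis fs : fourier_setup e q rho.

Lemma Gamz_sym k c a : ppow p N (exb ex a) * (map_mx intr (Gamz k Gam) : 'M[A]_(r + k)) c a =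
  ppow p N (exb ex c) * (map_mx intr (Gamz k Gam) : 'M[A]_(r + k)) a c.
Proof.
rewrite !ppow_intr [map_mx _ _ c a]mxE [map_mx _ _ a c]mxE -!intrM; congr (_%:~R).
case: (split_ordP c) => c' ->; case: (split_ordP a) => a' ->;
  rewrite ?block_mxEul ?block_mxEur ?block_mxEdl ?block_mxEdr ?exb_l ?exb_r.
- by rewrite !mxE.
- by rewrite !mxE !mulr0.
- by rewrite !mxE !mulr0.
- by rewrite !mxE !mulr0.
Qed.

Lemma prod_exb k : (\prod_c p ^ exb (k := k) ex c = #|G| * p ^ k)%N.
Proof.
rewrite big_split_ord /= -card_G; congr (_ * _)%N.
  by apply: eq_bigr => a _; rewrite exb_l.
under eq_bigr do rewrite exb_r expn1.
by rewrite prod_nat_const card_ord.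
Qed.

Definition moment k n (E : graph n) : R :=
  \sum_(F : {ffun 'I_n -> G} | `[< embedding pairG E F >])
     \prod_(i < k) (#|killed p pairG E F|%:R / p%:R - (p ^ i)%:R).

Lemma moment_vanishing k : exists s0 : nat, forall s, (s0 <= s)%N ->
  vanishing (fun n => \sum_(E : graph n | good_graph A (n %/ s) E) graph_weight q E * moment k E
                      - (p ^ 'C(k, 2))%:R).
Proof.
have [s0 hs0] := core_asymptotic fs (r + k); exists s0 => s /hs0[eps veps heps].
have p0 : 0 < (p%:R : R) by rewrite ltr0n prime_gt0.
(* [V] is the limiting mean number, over good graphs, of embeddings with a frame. Frames contribute
   [p ^ k] times the product in [moment], which leaves [p ^ 'C(k, 2)]. [C] serves to bound [#|K F|]
   uniformly in [F]. *)
pose m := (r + k)%N; pose V : R := (p ^ k * p ^ 'C(k, 2))%:R.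
pose C : R := #|symmetric_mxs A m|%:R * V.
have pk0 : 0 < (p ^ k)%:R :> R by rewrite ltr0n expn_gt0 prime_gt0.
have V0 : 0 <= V by [].
have vu := vanishingZ ((p ^ k)%:R^-1 : R) (vanishingD (vanishingZ C (vanishing_norm veps))
     (vanishingZ V (vanishing_norm (@noncode0_small A R m)))).
refine (@vanishing_le _ _ _ 1 vu _) => n n1.
pose an : R := (#|A| ^ (n * m))%:R; pose Hn : R := ((#|G| * p ^ k) ^ n)%:R.
have A0 : (0 < #|A|)%N by apply/card_gt0P; exists 0.
have an0 : 0 < an by rewrite ltr0n expn_gt0 A0.
have G0 : (0 < #|G|)%N by apply/card_gt0P; exists 0.
have Hn0 : 0 < Hn by rewrite ltr0n expn_gt0 muln_gt0 G0 expn_gt0 prime_gt0.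
pose K := fun F : 'M[A]_(m, n) => values (exb ex) (wxb ex) (map_mx intr (Gamz k Gam)) F.
have KE F : code 0 F -> #|K F|%:R * Hn = #|lap_range F|%:R * V.
  move=> /code0P inj; rewrite -!natrM; congr (_%:R).
  have := card_values_range p_pr N0 (exb_le N0 ex_le) (mubC ex) (mub_le N0 ex_le exD_le) (@Gamz_sym k) fs inj.
  rewrite -[X in _ = X]mulnA prod_exb_wxb prod_exb mulnAC mulnA [(_ * \prod_c \prod_a _)%N]mulnC -mulnA.
  rewrite [in X in _ = X]mulnAC [in X in _ = X]mulnC => /eqP.
  by rewrite eqn_pmul2l ?prodn_gt0 // => [/eqP//|c]; rewrite prodn_gt0 // => a; rewrite expn_gt0 prime_gt0.
have O0 F : code 0 F -> 0 < #|lap_range F|%:R :> R.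
  move=> _; rewrite ltr0n; apply/card_gt0P; exists 0.
  by rewrite inE !mul0mx trmx0 !eqxx.
have Ksub F : code 0 F -> K F \subset lap_range F by move=> _; apply: values_sub.
have kap0 : 0 <= C * an / Hn by rewrite divr_ge0 ?mulr_ge0 // ltW.
have Kle F : code 0 F -> #|K F|%:R <= C * an / Hn.
  move=> cF; rewrite ler_pdivlMr // KE // /C mulrAC ler_wpM2r //.
  rewrite -natrM ler_nat -(card_lap_range fs (code_inj_rows cF)).
  by rewrite leq_pmulr // expn_gt0 A0.
have := heps n K _ Ksub kap0 Kle.
pose Z (E : graph n) : R := \sum_(F | `[< embedding pairG E F >]) #|frames (killed p pairG E F) k|%:R.
have -> : \sum_(E | good_graph A (n %/ s) E) graph_weight q E *
     #|[set F | code (n %/ s) F && (F *m lapmx A E \in K F)]|%:R =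
   an / Hn * \sum_(E | good_graph A (n %/ s) E) graph_weight q E * Z E.
  rewrite mulr_sumr; apply: eq_bigr => E gE; rewrite mulrCA; congr (_ * _).
  apply: (mulIf (lt0r_neq0 Hn0)); rewrite -natrM.
  rewrite (card_code_values p_pr dG ex_gt0 g_ord g_free g_span gsP gs_Gam k N0 ex_le exD_le n1 gE).
  rewrite natrM natr_sum /Z mulrAC divfK ?lt0r_neq0 // mulrC; congr (_ * _).
  by rewrite /an card_ZpN // -expnM [(n * m)%N]mulnC.
have -> : \sum_(F : 'M[A]_(m, n) | code 0 F) #|K F|%:R / #|lap_range F|%:R =
   an / Hn * (#|[set F : 'M[A]_(m, n) | code 0 F]|%:R / an * V).
  rewrite (eq_bigr (fun _ => V / Hn)) => [|F cF]; last first.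
    apply/eqP; rewrite eqr_div ?lt0r_neq0 ?O0 // KE // mulrC //.
  have -> : \sum_(F : 'M[A]_(m, n) | code 0 F) V / Hn = #|[set F : 'M[A]_(m, n) | code 0 F]|%:R * (V / Hn).
    by rewrite [RHS]mulr_natl -sumr_const; apply: eq_bigl => F; rewrite inE.
  by field; rewrite !lt0r_neq0.
rewrite -mulrBr normrM (gtr0_norm (divr_gt0 an0 Hn0)).
set X := \sum_(E | _) _; set c := (_%:R / an) => hX.
have {}hX : `|X - c * V| <= C * eps n.
  rewrite -(ler_pM2l (divr_gt0 an0 Hn0)); apply: (le_trans hX).
  by rewrite le_eqVlt; apply/orP; left; apply/eqP; ring.
have ZE E : Z E = (p ^ k)%:R * moment k E.
  rewrite /Z mulr_sumr; apply: eq_bigr => F _.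
  rewrite (card_frames p_pr n1 (killed1 pairG p_pr E F) (@killedD _ _ _ p_pr _ E F)).
  have -> : (p ^ k)%:R = \prod_(i < k) (p%:R : R) by rewrite prodr_const card_ord natrX.
  rewrite -big_split /=; apply: eq_bigr => i _.
  by rewrite mulrBr [p%:R * (_ / _)]mulrC divfK ?lt0r_neq0 // -natrM -expnS.
have XE : X = (p ^ k)%:R * \sum_(E : graph n | good_graph A (n %/ s) E) graph_weight q E * moment k E.
  by rewrite mulr_sumr; apply: eq_bigr => E _; rewrite ZE mulrCA.
set Y := \sum_(E | _) _ in XE *.
have -> : Y - (p ^ 'C(k, 2))%:R = (p ^ k)%:R^-1 * (X - V).
  by rewrite XE /V natrM -mulrBr mulKf // lt0r_neq0.
have ip : 0 <= (p ^ k)%:R^-1 :> R by rewrite invr_ge0 ltW.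
rewrite normrM (ger0_norm ip) ler_wpM2l //.
have -> : X - V = (X - c * V) - V * (1 - c) by ring.
apply: (le_trans (ler_normB _ _)); apply: lerD.
  by apply: (le_trans hX); rewrite ler_wpM2l ?mulr_ge0 // ler_norm.
by rewrite normrM (ger0_norm V0).
Qed.

End Moments.

(** * Alternating sums and Euler products *)

Section Bonferroni.
Variables (R : realType) (b : R).
Hypothesis b_gt1 : 1 < b.

Definition qden k : R := \prod_(i < k) (b ^+ i.+1 - 1).

Lemma qden_gt0 k : 0 < qden k.
Proof. by apply: prodr_gt0 => i _; rewrite subr_gt0 exprn_egt1. Qed.

(** With [y = b ^ x], the q-analogue of [sum_(k <= m) (-1)^k C(x, k) = (-1)^m C(x - 1, m)]. *)
Lemma bonferroni_sum (y : R) m :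
  \sum_(k < m.+1) (-1) ^+ k * (\prod_(i < k) (y - b ^+ i)) / qden k =
  (-1) ^+ m * (\prod_(i < m) (y - b ^+ i.+1)) / qden m.
Proof.
elim: m => [|m IH]; first by rewrite big_ord_recr /= !big_ord0 add0r /qden big_ord0.
rewrite big_ord_recr /= IH [\prod_(i < m.+1) (y - b ^+ i)]big_ord_recl.
rewrite [\prod_(i < m.+1) (y - b ^+ i.+1)]big_ord_recr /=.
have -> : qden m.+1 = qden m * (b ^+ m.+1 - 1) by rewrite /qden big_ord_recr.
have d0 := lt0r_neq0 (qden_gt0 m).
have d1 : b ^+ m.+1 - 1 != 0 by rewrite lt0r_neq0 // subr_gt0 exprn_egt1.
rewrite (eq_bigr (fun i : 'I_m => y - b ^+ i.+1)) // expr0.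
set P := \prod_(i < m) _; rewrite exprS; set e := (-1) ^+ m.
move: (b ^+ m.+1) d1 => x d1; clearbody P e; field.
by rewrite d0 d1.
Qed.

Lemma bonferroni_one m :
  \sum_(k < m.+1) (-1) ^+ k * (\prod_(i < k) (1 - b ^+ i)) / qden k = 1.
Proof.
rewrite bonferroni_sum.
have -> : \prod_(i < m) (1 - b ^+ i.+1) = (-1) ^+ m * qden m.
  have -> : (-1) ^+ m = \prod_(i < m) (-1 : R) by rewrite prodr_const card_ord.
  rewrite /qden -big_split /=.
  by apply: eq_bigr => i _; rewrite mulN1r opprB.
by rewrite mulrA -expr2 sqrr_sign mul1r mulfV // lt0r_neq0 ?qden_gt0.
Qed.

(** The product in the closed form, multiplied by [y - 1 > 0], is the product assumed
    nonnegative. *)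
Lemma bonferroni_sign (y : R) m : 1 < y -> 0 <= \prod_(i < m.+1) (y - b ^+ i) ->
  0 <= (-1) ^+ m * \sum_(k < m.+1) (-1) ^+ k * (\prod_(i < k) (y - b ^+ i)) / qden k.
Proof.
move=> y1; rewrite bonferroni_sum big_ord_recl expr0 pmulr_rge0 ?subr_gt0 // => h.
rewrite !mulrA -expr2 sqrr_sign mul1r divr_ge0 // ?ltW ?qden_gt0 //.
Qed.

End Bonferroni.

(** * Evaluation of the q-series *)

Section Euler.
Variables (R : realType) (t : R).
Hypotheses (t_gt0 : 0 < t) (t_le : t <= 2^-1).

Definition qpoch k : R := \prod_(i < k) (1 - t ^+ i.+1).

Let t_ge0 : 0 <= t. Proof. exact: ltW. Qed.

Let t_lt1 : t < 1. Proof. by apply: (le_lt_trans t_le); lra. Qed.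

Lemma qpochS k : qpoch k.+1 = qpoch k * (1 - t ^+ k.+1).
Proof. by rewrite /qpoch big_ord_recr. Qed.

Lemma qpoch_ge k : 4^-1 <= qpoch k.
Proof.
case: k => [|k]; first by rewrite /qpoch big_ord0; lra.
(* Strengthened for the induction: the surplus absorbs the loss from the next factor, as
   [t <= 1/2]. *)
suff : 4^-1 + t ^+ k.+1 / 2 <= qpoch k.+1.
  by apply: le_trans; rewrite lerDl divr_ge0 ?exprn_ge0 // ltW.
elim: k => [|k IH]; first by rewrite /qpoch big_ord_recr big_ord0 /= expr1; move: t_le; lra.
rewrite qpochS.
have x0 : 0 <= t ^+ k.+1 by rewrite exprn_ge0 // ltW.
have x1 : t ^+ k.+1 <= 2^-1.
  apply: (le_trans _ t_le); rewrite exprS ger_pMr // exprn_ile1 // ltW //.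
have y0 : 0 <= t ^+ k.+2 by rewrite exprn_ge0 // ltW.
have y1 : t ^+ k.+2 <= t ^+ k.+1 / 2 by rewrite exprS mulrC ler_wpM2l.
have z0 : 0 <= 1 - t ^+ k.+2 by move: y1 x1; lra.
apply: (le_trans _ (ler_wpM2r z0 IH)).
move: (t ^+ k.+1) (t ^+ k.+2) x0 x1 y0 y1 => x y x0 x1 y0 y1; nra.
Qed.

Lemma qpoch_gt0 k : 0 < qpoch k.
Proof. by apply: lt_le_trans (qpoch_ge k); rewrite invr_gt0. Qed.

(** Truncation of Euler's series [sum_k (-x)^k / (t; t)_k = 1 / prod_(i >= 0) (1 + x t^i)] at
    [x = t^j]. *)
Definition qser m j : R := \sum_(k < m) (-1) ^+ k * t ^+ (j * k) / qpoch k.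

(** The functional equation [f(x t) = f(x) + x f(x)] of Euler's series at [x = t^j]; truncation
    shortens the last summand by one term. *)
Lemma qserS m j : qser m.+1 j.+1 = qser m.+1 j + t ^+ j * qser m j.
Proof.
rewrite /qser big_ord_recl [X in _ = X + _]big_ord_recl /= !muln0 -addrA; congr (_ + _).
rewrite mulr_sumr -big_split /=; apply: eq_bigr => k _; rewrite /bump /= add1n.
rewrite qpochS mulSn exprD mulnS exprD exprS.
have := lt0r_neq0 (qpoch_gt0 k); have := lt0r_neq0 (qpoch_gt0 k.+1); rewrite qpochS.
rewrite mulf_eq0 negb_or => /andP[_ h2] h1.
set e := (-1) ^+ k; set x := t ^+ k.+1 in h2 *; set u := t ^+ (j * k); set v := t ^+ j; field.
by rewrite h1 h2.
Qed.

Lemma qser_step m j : (0 < j)%N ->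
  `|qser m.+1 j - qser m.+1 j.+1 / (1 + t ^+ j)| <= 4 * t ^+ m.
Proof.
move=> j0; have d0 : 0 < 1 + t ^+ j by rewrite ltr_pwDl // exprn_ge0 // ltW.
have -> : qser m.+1 j - qser m.+1 j.+1 / (1 + t ^+ j) =
   t ^+ j * ((-1) ^+ m * t ^+ (j * m) / qpoch m) / (1 + t ^+ j).
  have -> : (-1) ^+ m * t ^+ (j * m) / qpoch m = qser m.+1 j - qser m j.
    by rewrite [in RHS]/qser big_ord_recr /= addrAC subrr add0r.
  by rewrite qserS; field; rewrite lt0r_neq0.
rewrite normrM [`|_^-1|]gtr0_norm ?invr_gt0 // ler_pdivrMr //.
rewrite !normrM normr_sign mul1r normfV !gtr0_norm ?exprn_gt0 ?qpoch_gt0 //.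
have tj1 : t ^+ j <= 1 by rewrite exprn_ile1 // ltW.
have tj0 : 0 <= t ^+ j by rewrite exprn_ge0 // ltW.
have tm0 : 0 <= t ^+ m by rewrite exprn_ge0 // ltW.
have a1 : t ^+ (j * m) <= t ^+ m.
  by rewrite -(prednK j0) mulSn exprD ger_pMr ?exprn_gt0 // exprn_ile1 // ltW.
have a2 : t ^+ (j * m) / qpoch m <= 4 * t ^+ m.
  rewrite ler_pdivrMr ?qpoch_gt0 // mulrAC; apply: (le_trans a1).
  by rewrite ler_peMl // -ler_pdivrMl // mulr1 qpoch_ge.
have a3 : 0 <= t ^+ (j * m) / qpoch m by rewrite divr_ge0 ?exprn_ge0 // ltW // qpoch_gt0.
apply: (@le_trans _ _ (1 * (4 * t ^+ m))); first exact: ler_pM.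
by rewrite mul1r ler_peMr ?mulr_ge0 // lerDl.
Qed.

Lemma qser_iter m J :
  `|qser m.+1 1 - qser m.+1 J.+1 / \prod_(i < J) (1 + t ^+ i.+1)| <= J%:R * (4 * t ^+ m).
Proof.
elim: J => [|J IH]; first by rewrite big_ord0 divr1 subrr normr0 mul0r.
have P1 k : 1 <= \prod_(i < k) (1 + t ^+ i.+1) :> R.
  elim: k => [|k IHk]; first by rewrite big_ord0.
  by rewrite big_ord_recr /= mulr_ege1 // lerDl exprn_ge0 // ltW.
have P0 k : 0 < \prod_(i < k) (1 + t ^+ i.+1) :> R by apply: lt_le_trans (P1 k).
have d0 : 0 < 1 + t ^+ J.+1 by rewrite ltr_pwDl // exprn_ge0 // ltW.
rewrite -[qser m.+1 1](subrK (qser m.+1 J.+1 / \prod_(i < J) (1 + t ^+ i.+1))) -addrA.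
apply: (le_trans (ler_normD _ _)); rewrite -[J.+1%:R]natr1 mulrDl mul1r; apply: lerD => //.
rewrite big_ord_recr /= invfM mulrA mulrAC -mulrBl normrM [`|_^-1|]gtr0_norm ?invr_gt0 ?P0 //.
apply: (le_trans _ (qser_step m (ltn0Sn J))); apply: ler_piMr => //; rewrite invf_le1 ?P0 //.
  exact: P1.
Qed.

Lemma qser_tail m J : `|qser m.+1 J - 1| <= m%:R * (4 * t ^+ J).
Proof.
rewrite /qser big_ord_recl /= muln0 !expr0 mulr1 /qpoch big_ord0 invr1 mulr1 addrC addKr.
apply: (le_trans (ler_norm_sum _ _ _)).
apply: (@le_trans _ _ (\sum_(k < m) 4 * t ^+ J)); last first.
  by rewrite sumr_const card_ord -[_ *+ m]mulr_natl.
apply: ler_sum => k _; rewrite /bump /= add1n -/(qpoch k.+1).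
rewrite !normrM normrX normrN1 expr1n mul1r normfV !gtr0_norm ?exprn_gt0 ?qpoch_gt0 //.
rewrite ler_pdivrMr ?qpoch_gt0 //.
have a1 : t ^+ (J * k.+1) <= t ^+ J.
  by rewrite mulnS exprD ger_pMr ?exprn_gt0 // exprn_ile1 // ltW.
apply: (le_trans a1); rewrite mulrAC ler_peMl ?exprn_ge0 //.
by have := qpoch_ge k.+1; lra.
Qed.

(* Euler's identity between odd and distinct parts, truncated. *)
Lemma qpoch_odd m :
  (\prod_(i < m) (1 + t ^+ i.+1)) * \prod_(i < m) (1 - t ^+ (2 * i).+1) =
  \prod_(i < m) (1 - t ^+ (m + i).+1).
Proof.
apply: (mulfI (lt0r_neq0 (qpoch_gt0 m))).
have -> : qpoch m * \prod_(i < m) (1 - t ^+ (m + i).+1) = qpoch (m + m).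
  by rewrite /qpoch big_split_ord.
rewrite mulrA /qpoch -big_split /= -big_split /=.
elim: m => [|m IH]; first by rewrite !big_ord0.
rewrite big_ord_recr /= IH addnS addSn !big_ord_recr /=.
have -> : (2 * m = m + m)%N by rewrite mul2n addnn.
have e : t ^+ (m + m).+2 = t ^+ m.+1 * t ^+ m.+1 by rewrite -exprD addnS addSn.
by rewrite e; ring.
Qed.

Lemma prod_le1 k (f : nat -> R) : (forall i, 0 <= f i <= 1) ->
  0 <= \prod_(i < k) f i <= 1.
Proof.
move=> h; elim: k => [|k /andP[P0 P1]]; first by rewrite big_ord0 ler01 lexx.
have /andP[f0 f1] := h k; rewrite big_ord_recr /= mulr_ge0 //=.
by rewrite mulr_ile1.
Qed.

Lemma tail_le1 m k : 0 <= \prod_(i < k) (1 - t ^+ (m + i).+1) <= 1.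
Proof.
apply: (@prod_le1 k (fun i => 1 - t ^+ (m + i).+1)) => i.
by rewrite subr_ge0 gerBl exprn_ge0 // exprn_ile1 // ltW.
Qed.

Lemma qpoch_tail m : 1 - m%:R * t ^+ m <= \prod_(i < m) (1 - t ^+ (m + i).+1).
Proof.
have g k : (k <= m)%N -> 1 - k%:R * t ^+ m <= \prod_(i < k) (1 - t ^+ (m + i).+1).
  elim: k => [|k IH] km; first by rewrite big_ord0 mul0r subr0.
  rewrite big_ord_recr /=.
  have x0 : 0 <= t ^+ (m + k).+1 by rewrite exprn_ge0 // ltW.
  have x1 : t ^+ (m + k).+1 <= t ^+ m.
    by rewrite -addnS exprD ger_pMr ?exprn_gt0 // exprn_ile1 // ltW.
  have /andP[P0 P1] := tail_le1 m k.
  have := IH (ltnW km); rewrite -natr1 mulrDl mul1r.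
  move: (\prod_(i < k) _) (t ^+ (m + k).+1) x0 x1 P0 P1 => P x x0 x1 P0 P1.
  by move: (k%:R * t ^+ m) (t ^+ m) x1 => u v x1 h; nra.
exact: g.
Qed.

Lemma vanishing_natM_expr : vanishing (fun m => m%:R * t ^+ m).
Proof.
have h0 : 0 <= 3 / 4 :> R by lra.
have h1 : 3 / 4 < 1 :> R by lra.
apply: (vanishing_le (k := 0) (vanishingZ 2 (vanishing_expr h0 h1))) => m _.
rewrite ger0_norm ?mulr_ge0 ?exprn_ge0 //.
have b m' : m'%:R <= 2 * (3 / 2) ^+ m' :> R.
  elim: m' => [|k IH]; first by rewrite mulr_ge0.
  rewrite exprS -natr1.
  have : 1 <= (3 / 2) ^+ k :> R by rewrite exprn_ege1 //; lra.
  by move: IH; lra.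
have -> : 2 * (3 / 4) ^+ m = 2 * (3 / 2) ^+ m * (2^-1) ^+ m :> R.
  by rewrite -mulrA -exprMn; congr (_ * _ ^+ _); lra.
apply: ler_pM => //; rewrite ?exprn_ge0 //.
by apply: lerXn2r => //; rewrite nnegrE invr_ge0.
Qed.

(** Raising [j] from 1 to [m + 1] multiplies the series by [prod (1 + t^i)] and leaves a value near
    1; [qpoch_odd] trades the inverse of that product for the odd one. The constant 9 adds the
    errors 4, 4 and 1 of [qser_iter], [qser_tail] and [qpoch_tail]. *)
Lemma euler_vanishing :
  vanishing (fun m => qser m.+1 1 - \prod_(i < m) (1 - t ^+ (2 * i).+1)).
Proof.
apply: (vanishing_le (k := 0) (vanishingZ 9 vanishing_natM_expr)) => m _.
have P1 k : 1 <= \prod_(i < k) (1 + t ^+ i.+1) :> R.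
  elim: k => [|k IHk]; first by rewrite big_ord0.
  by rewrite big_ord_recr /= mulr_ege1 // lerDl exprn_ge0 // ltW.
have P0 k : 0 < \prod_(i < k) (1 + t ^+ i.+1) :> R by apply: lt_le_trans (P1 k).
set P := \prod_(i < m) (1 + t ^+ i.+1).
have P1' : P^-1 <= 1 by rewrite invf_le1; [exact: P1|exact: P0].
have P0' : 0 <= P^-1 by rewrite invr_ge0; apply: ltW; exact: P0.
have h1 := qser_iter m m; have h2 := qser_tail m m.+1; have h3 := qpoch_tail m; have h4 := qpoch_odd m.
rewrite -/P in h1 h4.
have /andP[_ T1] := tail_le1 m m.
have -> : \prod_(i < m) (1 - t ^+ (2 * i).+1) = P^-1 * \prod_(i < m) (1 - t ^+ (m + i).+1).
  by rewrite -h4 mulKf // lt0r_neq0 //; exact: P0.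
have x0 : 0 <= m%:R * t ^+ m by rewrite mulr_ge0 ?exprn_ge0 // ltW.
have x1 : m%:R * (4 * t ^+ m.+1) <= 4 * (m%:R * t ^+ m).
  by rewrite mulrCA ler_wpM2l // ler_wpM2l // exprS ger_pMl ?exprn_gt0 // ltW.
set T := \prod_(i < m) (1 - t ^+ (m + i).+1) in h3 T1 *.
have -> : qser m.+1 1 - P^-1 * T = (qser m.+1 1 - qser m.+1 m.+1 / P) +
   (P^-1 * (qser m.+1 m.+1 - 1) + P^-1 * (1 - T)) by ring.
apply: (le_trans (ler_normD _ _)).
have -> : 9 * (m%:R * t ^+ m) = 4 * (m%:R * t ^+ m) + (4 * (m%:R * t ^+ m) + m%:R * t ^+ m) by ring.
apply: lerD; first by apply: (le_trans h1); rewrite mulrCA.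
apply: (le_trans (ler_normD _ _)); rewrite !normrM (ger0_norm P0'); apply: lerD.
  apply: (@le_trans _ _ (1 * `|qser m.+1 m.+1 - 1|)); first by rewrite ler_wpM2r.
  by rewrite mul1r; apply: (le_trans h2).
apply: (@le_trans _ _ (1 * `|1 - T|)); first by rewrite ler_wpM2r.
by rewrite mul1r ger0_norm ?subr_ge0 // lerBlDr -lerBlDl.
Qed.

End Euler.

(** The ratio of the limiting moment to the Bonferroni denominator is, up to sign, a term of the
    q-series at [t = b^-1]. *)
Lemma qser_qden (R : realType) (b : R) k : 1 < b ->
  b ^+ 'C(k, 2) / qden b k = (b^-1) ^+ k / qpoch b^-1 k.
Proof.
move=> b1; have b0 : 0 < b by apply: lt_trans b1.
elim: k => [|k IH]; first by rewrite /qden /qpoch !big_ord0.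
have -> : qden b k.+1 = qden b k * (b ^+ k.+1 - 1) by rewrite /qden big_ord_recr.
have -> : qpoch b^-1 k.+1 = qpoch b^-1 k * (1 - b^-1 ^+ k.+1) by rewrite /qpoch big_ord_recr.
rewrite binS bin1 exprD invfM mulrACA IH [(b^-1) ^+ k.+1]exprS.
have d1 : b ^+ k.+1 - 1 != 0 by rewrite lt0r_neq0 // subr_gt0 exprn_egt1.
have -> : b ^+ k / (b ^+ k.+1 - 1) = b^-1 / (1 - b^-1 ^+ k.+1).
  rewrite exprVn; move: d1; rewrite exprS; have := lt0r_neq0 (exprn_gt0 k b0).
  move: (b ^+ k) (lt0r_neq0 b0) => x b00 x0 d1; field.
  by rewrite d1 b00 x0.
by rewrite exprS invfM; ring.
Qed.

(** * Disconnected graphs are rare *)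

Definition cut n (X : {set 'I_n}) (E : graph n) : bool :=
  [forall i, forall j, (i \in X) && (j \notin X) ==> ~~ adjacent E i j].

Lemma lapE n (E : graph n) (u : 'cV[int]_n) i :
  (laplacian E *m u) i 0 = \sum_j (adjacent E i j)%:Z * (u j 0 - u i 0).
Proof.
rewrite mxE (bigD1 i) //= [RHS](bigD1 i) //= [in X in X + _ = _]mxE eqxx subrr mulr0 add0r.
under [RHS]eq_bigr do rewrite mulrBr.
rewrite sumrB [RHS]addrC; congr (_ + _).
  rewrite mulNr -mulr_suml; congr (- (_ * _)).
  have := degreeE int E i; rewrite intz => ->.
  by rewrite (bigD1 i) //= adjacentii add0r; apply: eq_bigr => j _; rewrite natz.
by apply: eq_bigr => j ji; rewrite mxE eq_sym (negPf ji).
Qed.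

(* No edge leaves the set where a function killed by the Laplacian is maximal. *)
Lemma exists_cut n (E : graph n) : ~ lap_ker_const E ->
  exists X : {set 'I_n}, [/\ X != finset.set0, X != finset.setT & cut X E].
Proof.
move=> /existsNP[u /not_implyP[Lu /existsNP[i0 /existsNP[j0 uij]]]].
have [i1 _ hmax] := @arg_maxP _ _ _ i0 predT (fun i => u i 0) isT.
exists [set i | u i 0 == u i1 0]; split.
- by apply/set0Pn; exists i1; rewrite inE.
- apply/eqP => /setP h; apply: uij.
  by have := h i0; have := h j0; rewrite !inE => /eqP-> /eqP->.
apply/forallP => i; apply/forallP => j; apply/implyP; rewrite !inE => /andP[/eqP ui uj].
have := lapE E u i; rewrite Lu mxE => /esym h.
have le0 k : true -> 0 <= (adjacent E i k)%:Z * (u i 0 - u k 0).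
  by move=> _; rewrite mulr_ge0 // subr_ge0 ui; apply: hmax.
have : \sum_k (adjacent E i k)%:Z * (u i 0 - u k 0) = 0.
  rewrite -[RHS]oppr0 -[in RHS]h -sumrN; apply: eq_bigr => k _.
  by rewrite -mulrN opprB.
move=> /eqP; rewrite psumr_eq0 // => /allP/(_ j (mem_index_enum _))/=.
rewrite mulf_eq0 subr_eq0 ui [u i1 0 == _]eq_sym (negPf uj) orbF.
by case: adjacent.
Qed.

Lemma cut_lap (A : comNzRingType) n (X : {set 'I_n}) (E : graph n) : cut X E ->
  (\row_i (i \in X)%:R) *m lapmx A E = 0.
Proof.
move=> /forallP cX.
pose u : 'cV[int]_n := \col_i (i \in X)%:R.
have Lu : laplacian E *m u = 0.
  apply/colP => i; rewrite lapE [RHS]mxE; apply: big1 => j _; rewrite !mxE.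
  have /forallP/(_ j) := cX i; have /forallP/(_ i) := cX j; rewrite adjacentC.
  by case: (i \in X); case: (j \in X); case: (adjacent E i j); rewrite ?subrr ?mulr0 ?mul0r.
have -> : (\row_i (i \in X)%:R) = map_mx intr u^T :> 'rV[A]_n.
  by apply/rowP => i; rewrite !mxE; case: (_ \in _).
rewrite /lapmx -map_mxM -[laplacian E](laplacian_sym E) -trmx_mul Lu.
by apply/rowP => i; rewrite !mxE.
Qed.

Lemma cutC n (X : {set 'I_n}) (E : graph n) : cut X E -> cut (~: X) E.
Proof.
move=> /forallP h; apply/forallP => i; apply/forallP => j; apply/implyP.
rewrite !inE negbK => /andP[iX jX]; have /forallP/(_ i)/implyP := h j.
by rewrite adjacentC iX jX; apply.
Qed.

(** The indicator of one side of a cut is killed by [L], hence cannot be sparse on a good graph. *)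
Lemma good_cut (A : finComNzRingType) d n (X : {set 'I_n}) (E : graph n) :
  good_graph A d E -> cut X E -> X != finset.set0 -> (d < #|X|)%N.
Proof.
move=> /forallP/(_ (\row_i (i \in X)%:R)) gE cX X0; rewrite ltnNge; apply/negP => small.
move: gE; rewrite (cut_lap A cX) eqxx implybF; apply/negP; rewrite negbK; apply/andP; split.
  case/set0Pn: X0 => i iX; apply/eqP => /rowP/(_ i); rewrite !mxE iX => /eqP.
  by rewrite oner_eq0.
apply: leq_trans small; apply: subset_leq_card; apply/fintype.subsetP => i.
by rewrite inE mxE; case: (i \in X); rewrite ?eqxx.
Qed.

Section CutProbability.
Variables (R : realType) (q : R).
Hypotheses (q_gt0 : 0 < q) (q_lt1 : q < 1).

Let c0 : 0 <= 1 - q. Proof. by rewrite subr_ge0 ltW. Qed.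
Let c1 : 1 - q < 1. Proof. by rewrite ltrBlDr ltrDl. Qed.

Lemma prob_cut n (X : {set 'I_n}) t : (2 * t <= #|X| * #|~: X|)%N ->
  prob q (cut X) <= (1 - q) ^+ t.
Proof.
move=> tX; pose b (i j : 'I_n) := (i \in X) (+) (j \in X).
pose h (i j : 'I_n) (e : bool) : R := if b i j && e then 0 else 1.
have h0 i j e : 0 <= h i j e by rewrite /h; case: ifP.
apply: (@le_trans _ _ (\sum_(E : graph n) graph_weight q E *
     \prod_(i < n) \prod_(j < n | (i < j)%N) h i j (adjacent E i j))).
  rewrite /prob big_mkcond; apply: ler_sum => E _.
  have w0 : 0 <= graph_weight q E by apply: graph_weight_ge0; apply: ltW.
  case: ifP => [cX|_]; last by rewrite mulr_ge0 //; do 2 (apply: prodr_ge0 => ? _).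
  rewrite big1 ?mulr1 // => i _; rewrite big1 // => j _; rewrite /h /b.
  have /forallP/(_ j) := forallP cX i; have /forallP/(_ i) := forallP cX j.
  by rewrite adjacentC; case: (i \in X); case: (j \in X); case: (adjacent E i j).
rewrite sum_graph_weight.
have -> : \prod_(i < n) \prod_(j < n | (i < j)%N) (q * h i j true + (1 - q) * h i j false) =
   (1 - q) ^+ (\sum_(i < n) \sum_(j < n | (i < j)%N) b i j).
  rewrite -prodrXr; apply: eq_bigr => i _; rewrite -prodrXr.
  apply: eq_bigr => j _; rewrite /h andbT andbF.
  by case: (b i j); rewrite ?mulr0 ?add0r !mulr1 // addrC subrK.
suff le : (t <= \sum_(i < n) \sum_(j < n | (i < j)%N) b i j)%N.
  by rewrite -(subnKC le) exprD ler_piMr ?exprn_ge0 // exprn_ile1 // ltW.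
have := sum_ordered_pairs (fun i j : 'I_n => (b i j : nat)).
have -> : \sum_(i < n) (b i i : nat) = 0%N by apply: big1 => i _; rewrite /b addbb.
have -> : \sum_(i < n) \sum_(j < n | (i < j)%N) ((b i j : nat) + (b j i : nat)) =
    (2 * \sum_(i < n) \sum_(j < n | (i < j)%N) b i j)%N.
  rewrite big_distrr; apply: eq_bigr => i _ /=; rewrite big_distrr; apply: eq_bigr => j _ /=.
  by rewrite /b [(j \in X) (+) _]addbC mul2n -addnn.
move=> e; have : (#|X| * #|~: X| <= \sum_(i < n) \sum_(j < n) b i j)%N.
  rewrite -sum1_card big_distrl /= [leqRHS](bigID (mem X)) /=.
  apply: leq_trans (leq_addr _ _); apply: leq_sum => i iX; rewrite mul1n -sum1_card.
  rewrite [leqRHS](bigID (mem (~: X))) /=; apply: leq_trans (leq_addr _ _).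
  by apply: leq_sum => j; rewrite inE /b iX => /negPf->.
move=> h2; have := leq_trans tX h2.
have -> : (\sum_(i < n) \sum_(j < n) b i j = 2 * \sum_(i < n) \sum_(j < n | (i < j)%N) b i j)%N.
  by rewrite -[LHS]/(\sum_(i < n) \sum_(j < n) (b i j : nat)) e add0r.
by rewrite leq_mul2l.
Qed.

(** Goodness excludes the cuts with a small side. Each remaining cut leaves quadratically many pairs
    without an edge, which beats a union bound over all [2 ^ n] sets. *)
Lemma prob_disconnected (A : finComNzRingType) s : (0 < s)%N ->
  vanishing (fun n => prob q (fun E : graph n => ~~ good_graph A (n %/ s) E)) ->
  vanishing (fun n => prob q (fun E : graph n => ~~ `[< lap_ker_const E >])).
Proof.
move=> s0 vg.
have ss0 : (0 < 2 * (s * s))%N by rewrite !muln_gt0 s0.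
have two1 : (1 : R) <= 2 by rewrite ler1n.
have vc := @vanishing_expr_square R 2 (1 - q) (2 * (s * s)) two1 c0 c1 ss0.
apply: (vanishing_le (k := 0) (vanishingD vg vc)) => n _.
have pg P : 0 <= prob q (P : pred (graph n)).
  by apply: sumr_ge0 => E _; apply: graph_weight_ge0; apply: ltW.
rewrite ger0_norm //.
pose D := [pred X : {set 'I_n} | (n %/ s < #|X|)%N && (n %/ s < #|~: X|)%N].
pose Q (o : option {set 'I_n}) : pred (graph n) :=
  if o is Some X then cut X else (fun E => ~~ good_graph A (n %/ s) E).
pose D' (o : option {set 'I_n}) := if o is Some X then D X else true.
apply: (le_trans (@prob_or_le R q n _ D' _ Q q_gt0 q_lt1 _)).
  move=> E /asboolP/exists_cut[X [X0 XT cX]]; apply/existsP.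
  case: (boolP (good_graph A (n %/ s) E)) => gE; last by exists None.
  exists (Some X); rewrite /= cX andbT (good_cut gE cX X0) (good_cut gE (cutC cX)) //.
  by apply: contra XT => /eqP h; rewrite -(finset.setCK X) h finset.setC0.
have -> : \sum_(o | D' o) prob q (Q o) = prob q (Q None) + \sum_(X | D X) prob q (cut X).
  rewrite (bigD1 None) //=; congr (_ + _).
  rewrite (reindex_omap Some id) /=; last by case.
  by apply: eq_bigl => X; rewrite eqxx !andbT.
rewrite lerD2l.
apply: (@le_trans _ _ (\sum_(X : {set 'I_n}) (1 - q) ^+ ((n * n) %/ (2 * (s * s))))).
  rewrite big_mkcond; apply: ler_sum => X _; case: ifP => [/andP[d1 d2]|_]; last exact: exprn_ge0.
  apply: prob_cut.
  have e1 : (n <= s * #|X|)%N.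
    by apply: ltnW; rewrite mulnC; move: d1; rewrite ltn_divLR.
  have e2 : (n <= s * #|~: X|)%N by apply: ltnW; rewrite mulnC; move: d2; rewrite ltn_divLR.
  have ss1 : (0 < s * s)%N by rewrite muln_gt0 s0.
  rewrite -(leq_pmul2l ss1) mulnA [(s * s * 2)%N]mulnC mulnC.
  apply: leq_trans (leq_trunc_div _ _) _.
  by rewrite mulnACA leq_mul.
have -> : 2 ^+ n = #|{: {set 'I_n}}|%:R :> R.
  by rewrite -cardsT -powersetT card_powerset cardsT card_ord natrX.
by rewrite sumr_const mulr_natl.
Qed.

End CutProbability.

(** * The limit *)

Lemma vanishing_sum (R : realType) m (u : nat -> nat -> R) :
  (forall k, (k < m)%N -> vanishing (u k)) -> vanishing (fun n => \sum_(k < m) u k n).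
Proof.
elim: m => [|m IH] h.
  by move=> eps e0; exists 0%N => n _; rewrite big_ord0 normr0 ltW.
have v1 := vanishingD (IH (fun k km => h k (ltnW km))) (h m (ltnSn m)).
by move=> eps /v1[n0 hn]; exists n0 => n /hn; rewrite big_ord_recr.
Qed.

Section FullCount.
Variables (R : realType) (p : nat) (G : finZmodType) (pairG : G -> G -> QZ).
Hypothesis p_pr : prime p.
Local Notation b := (p%:R : R).

Let b_gt1 : 1 < b. Proof. by rewrite ltr1n prime_gt1. Qed.

Definition full_count n (E : graph n) : R := #|[set F | `[< full p pairG E F >]]|%:R.

Lemma full_countE n (E : graph n) : full_count E =
  \sum_(F : {ffun 'I_n -> G} | `[< embedding pairG E F >]) (#|killed p pairG E F| <= p)%N%:R.
Proof.
rewrite /full_count -sum1_card natr_sum big_mkcond [RHS]big_mkcond /=.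
apply: eq_bigr => F _; rewrite inE.
case: asboolP => [/(fullE pairG p_pr)[em ->]|nf]; first by rewrite asboolT.
case: asboolP => // em; case: leqP => // h; case: nf.
by apply/(fullE pairG p_pr).
Qed.

(** Up to the positive factor [b ^ k], the product counts frames. *)
Lemma killed_prod_ge0 n (E : graph n) F k : (0 < n)%N ->
  0 <= \prod_(i < k) (#|killed p pairG E F|%:R / b - (p ^ i)%:R).
Proof.
move=> n0; have b0 : 0 < b by apply: lt_trans b_gt1.
have := card_frames p_pr n0 (killed1 pairG p_pr E F) (@killedD _ _ _ p_pr _ E F) R k.
rewrite (eq_bigr (fun i : 'I_k => b * (#|killed p pairG E F|%:R / b - (p ^ i)%:R))).
  rewrite big_split /= prodr_const => h.
  have : 0 <= b ^+ #|'I_k| * \prod_(i < k) (#|killed p pairG E F|%:R / b - (p ^ i)%:R).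
    by rewrite -h.
  by rewrite pmulr_rge0 ?exprn_gt0.
by move=> i _; rewrite mulrBr [b * (_ / _)]mulrC divfK ?lt0r_neq0 // -natrM -expnS.
Qed.

Lemma full_count_bound m n (E : graph n) : (0 < n)%N ->
  0 <= (-1) ^+ m * (\sum_(k < m.+1) (-1) ^+ k / qden b k * moment p pairG R k E - full_count E).
Proof.
move=> n0; have b0 : 0 < b by apply: lt_trans b_gt1.
rewrite full_countE.
have -> : \sum_(k < m.+1) (-1) ^+ k / qden b k * moment p pairG R k E =
   \sum_(F : {ffun 'I_n -> G} | `[< embedding pairG E F >]) \sum_(k < m.+1) (-1) ^+ k *
     (\prod_(i < k) (#|killed p pairG E F|%:R / b - b ^+ i)) / qden b k.
  rewrite exchange_big /=; apply: eq_bigr => k _; rewrite /moment mulr_sumr.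
  apply: eq_bigr => F _; rewrite mulrAC; congr (_ * _ / _).
  by apply: eq_bigr => i _; rewrite natrX.
rewrite -sumrB mulr_sumr; apply: sumr_ge0 => F _.
have y1 : 1 <= #|killed p pairG E F|%:R / b.
  by have := @killed_prod_ge0 n E F 1 n0; rewrite big_ord_recr big_ord0 /= mul1r subr_ge0.
have yp : (#|killed p pairG E F| <= p)%N = (#|killed p pairG E F|%:R / b <= 1).
  by rewrite ler_pdivrMr // mul1r ler_nat.
rewrite yp; case: (leP _ 1) => y2.
  have -> : #|killed p pairG E F|%:R / b = 1 by apply/eqP; rewrite eq_le y1 y2.
  by rewrite bonferroni_one // subrr mulr0.
rewrite subr0; apply: bonferroni_sign => //.
have := @killed_prod_ge0 n E F m.+1 n0.
by rewrite (eq_bigr (fun i : 'I_m.+1 => #|killed p pairG E F|%:R / b - b ^+ i)) // => i _; rewrite natrX.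
Qed.

End FullCount.

Lemma pairing_Aut_gt0 (G : finZmodType) (pairG : G -> G -> QZ) : (0 < #|pairing_Aut pairG|)%N.
Proof.
apply/card_gt0P; exists 1%g; rewrite inE group1 /=.
by apply/forallP => x; apply/forallP => y; rewrite !perm1.
Qed.

Lemma odd_prodE (R : realType) p m : prime p ->
  \prod_(1 <= k < m.+1) (1 - (p%:R : R) ^ (1 - 2 * k%:Z)) =
  \prod_(i < m) (1 - (p%:R^-1 : R) ^+ (2 * i).+1).
Proof.
move=> p_pr; rewrite big_add1 big_mkord; apply: eq_bigr => i _.
have -> : 1 - 2 * i.+1%:Z = - ((2 * i).+1)%N%:Z by lia.
by rewrite -invr_expz -exprnP exprVn.
Qed.

Section Limit.
Variables (R : realType) (q : R) (p : nat) (G : finZmodType) (pairG : G -> G -> QZ).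
Hypotheses (q_gt0 : 0 < q) (q_lt1 : q < 1) (p_pr : prime p).
Hypotheses (pG : (p.-group [set: G])%g) (dG : duality_pairing pairG).
Local Notation b := (p%:R : R).
Local Notation aut := ((#|G| * #|pairing_Aut pairG|)%:R : R).
Local Notation limit := (limn (fun m : nat =>
   \prod_(1 <= k < m.+1) (1 - b ^ (1 - 2 * k%:Z)))).

Let b_gt1 : 1 < b. Proof. by rewrite ltr1n prime_gt1. Qed.

Let b_inv : 0 < b^-1 /\ b^-1 <= 2^-1.
Proof.
have b0 : 0 < b by apply: lt_trans b_gt1.
by split; rewrite ?invr_gt0 // lef_pV2 ?posrE // ler_nat prime_gt1.
Qed.

Let aut_gt0 : 0 < aut.
Proof. by rewrite ltr0n muln_gt0 pairing_Aut_gt0 andbT; apply/card_gt0P; exists 0. Qed.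

Let w_ge0 n (E : graph n) : 0 <= graph_weight q E.
Proof. by apply: graph_weight_ge0; apply: ltW. Qed.

Definition mean_full n : R := \sum_(E : graph n) graph_weight q E * full_count R p pairG E.

Lemma full_count_le n (E : graph n) : (0 < n)%N -> 0 <= full_count R p pairG E <= aut.
Proof.
by move=> n0; rewrite /full_count (card_full E p_pr pG dG n0); case: ifP => _; rewrite ?ler0n ?lexx.
Qed.

Lemma moments_and_good : exists (A : finComNzRingType) (s0 : nat -> nat) (s1 : nat),
  (forall k s, (s0 k <= s)%N ->
    vanishing (fun n => \sum_(E : graph n | good_graph A (n %/ s) E)
       graph_weight q E * moment p pairG R k E - (p ^ 'C(k, 2))%:R)) /\
  (forall s, (s1 <= s)%N ->
    vanishing (fun n => prob q (fun E : graph n => ~~ good_graph A (n %/ s) E))).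
Proof.
have [r [g [ex [ex_gt0 g_ord g_free g_span card_G]]]] := exists_basis p_pr pG.
have [gs gsP] := exists_dual p_pr dG g_free g_span.
have [Gam [Gam_sym gs_Gam _]] := exists_dual_gram p_pr dG g_ord g_span gsP.
(* Large enough to exceed every [ex a] and to bound every sum [ex c + ex a]. *)
pose N := (2 * (\sum_a ex a).+1)%N.
have exS a : (ex a <= \sum_a ex a)%N by rewrite (bigD1 a) //= leq_addr.
have N0 : (0 < N)%N by [].
have ex_le a : (ex a < N)%N by rewrite /N mul2n -addnn addSn ltnS (leq_trans (exS a)) // leq_addr.
have exD_le c a : (ex c + ex a <= N)%N.
  by rewrite /N mul2n -addnn leq_add // (leq_trans (exS _)).
have [e [rho fs]] := exists_fourier_setup q_gt0 q_lt1 (pN_gt1 p_pr N0).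
have hm k := moment_vanishing p_pr dG ex_gt0 g_ord g_free g_span card_G gsP gs_Gam Gam_sym N0 ex_le exD_le fs k.
have [s0 hs0] := choice hm; have [s1 hs1] := prob_not_good fs.
by exists 'Z_(p ^ N), s0, s1; split.
Qed.

Lemma mean_full_bound m (eps : R) : 0 < eps -> exists n0 : nat, forall n, (n0 <= n)%N ->
  - eps <= (-1) ^+ m * (qser b^-1 m.+1 1 - mean_full n).
Proof.
have [A [s0 [s1 [hs0 hs1]]]] := moments_and_good.
(* Only moments of order at most [m] occur, so one [s] serves them all. *)
pose s := maxn s1 (\max_(k < m.+1) s0 k).
have s0s (k : nat) : (k < m.+1)%N -> (s0 k <= s)%N.
  move=> km; apply: leq_trans (leq_maxr _ _).
  by have := @leq_bigmax _ (fun k : 'I_m.+1 => s0 k) (Ordinal km).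
have good_v := hs1 s (leq_maxl _ _).
pose X k n := \sum_(E : graph n | good_graph A (n %/ s) E) graph_weight q E * moment p pairG R k E.
have uv : vanishing (fun n => \sum_(k < m.+1) ((-1) ^+ k / qden b k * (X k n - (p ^ 'C(k, 2))%:R))).
  apply: (@vanishing_sum R m.+1 (fun k n => (-1) ^+ k / qden b k * (X k n - (p ^ 'C(k, 2))%:R))) => k km.
  by apply: vanishingZ; apply: hs0; apply: s0s.
have vv := vanishingD (vanishing_norm uv) (vanishingZ aut good_v).
move=> /vv[n0 hn0]; exists (maxn n0 1) => n; rewrite geq_max => /andP[/hn0 hn n1].
pose Z : R := \sum_(E : graph n | good_graph A (n %/ s) E) graph_weight q E * full_count R p pairG E.
set U := \sum_(k < m.+1) _ in hn.
have YZ : mean_full n = Z + \sum_(E : graph n | ~~ good_graph A (n %/ s) E) graph_weight q E * full_count R p pairG E.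
  by rewrite /mean_full (bigID (fun E : graph n => good_graph A (n %/ s) E)).
set W := \sum_(E | ~~ _) _ in YZ.
have W0 : 0 <= W by apply: sumr_ge0 => E _; rewrite mulr_ge0 //; case/andP: (full_count_le E n1).
(* There are at most [aut] full functions on any graph, so restoring the discarded graphs costs at
   most [aut] times their probability. *)
have W1 : W <= aut * prob q (fun E : graph n => ~~ good_graph A (n %/ s) E).
  rewrite /prob mulr_sumr; apply: ler_sum => E _; rewrite mulrC ler_wpM2r //.
  by case/andP: (full_count_le E n1).
have S0 : 0 <= (-1) ^+ m * (\sum_(k < m.+1) (-1) ^+ k / qden b k * X k n - Z).
  have -> : \sum_(k < m.+1) (-1) ^+ k / qden b k * X k n - Z =
     \sum_(E : graph n | good_graph A (n %/ s) E) graph_weight q E *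
       (\sum_(k < m.+1) (-1) ^+ k / qden b k * moment p pairG R k E - full_count R p pairG E).
    under [RHS]eq_bigr do rewrite mulrBr mulr_sumr.
    rewrite sumrB; congr (_ - _); rewrite exchange_big /=; apply: eq_bigr => k _.
    by rewrite mulr_sumr; apply: eq_bigr => E _; rewrite mulrCA.
  rewrite mulr_sumr; apply: sumr_ge0 => E _; rewrite mulrCA mulr_ge0 //.
  exact: full_count_bound.
have TE : qser b^-1 m.+1 1 = \sum_(k < m.+1) (-1) ^+ k / qden b k * X k n - U.
  rewrite /U -sumrB; apply: eq_bigr => k _.
  rewrite -mulrBr opprB addrCA subrr addr0 mul1n -mulrA -(qser_qden _ b_gt1) natrX.
  by rewrite [RHS]mulrAC -mulrA.
have sgn (x : R) : `|(-1) ^+ m * x| = `|x| by rewrite normrM normr_sign mul1r.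
have -> : (-1) ^+ m * (qser b^-1 m.+1 1 - mean_full n) =
  (-1) ^+ m * (\sum_(k < m.+1) (-1) ^+ k / qden b k * X k n - Z) - ((-1) ^+ m * U + (-1) ^+ m * W).
  by rewrite TE YZ; ring.
have le1 : (-1) ^+ m * U <= `|U| by rewrite -(sgn U) ler_norm.
have le2 : (-1) ^+ m * W <= W by rewrite -[leRHS](ger0_norm W0) -(sgn W) ler_norm.
have le3 : `|U| + aut * prob q (fun E : graph n => ~~ good_graph A (n %/ s) E) <= eps.
  exact: le_trans (ler_norm _) hn.
rewrite lerBrDr; apply: le_trans S0; rewrite addrC subr_le0.
by apply: le_trans le3; apply: lerD => //; apply: le_trans W1.
Qed.

Lemma qser_limit : vanishing (fun m => qser b^-1 m.+1 1 - limit).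
Proof.
have [b0 b2] := b_inv; have vE := euler_vanishing b0 b2.
have vQ : vanishing (fun m => \prod_(i < m) (1 - (b^-1) ^+ (2 * i).+1) - limit).
  move=> eps e0; have /cvgrPdist_le/(_ _ e0)[n0 _ h] := @sandpile_prod_cvg R p p_pr.
  by exists n0 => n /h /=; rewrite distrC odd_prodE.
move=> eps /(vanishingD vE vQ)[n0 hn]; exists n0 => n /hn.
by rewrite addrA subrK.
Qed.

Lemma mean_full_limit : vanishing (fun n => mean_full n - limit).
Proof.
move=> eps e0; have e2 : 0 < eps / 2 by rewrite divr_gt0.
have [m0 hm] := qser_limit e2.
(* The even truncation bounds the mean from above, the odd one from below. *)
have [n0 h0] := mean_full_bound (2 * m0) e2; have [n1 h1] := mean_full_bound (2 * m0).+1 e2.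
exists (maxn n0 n1) => n; rewrite geq_max => /andP[/h0 a0 /h1 a1].
have m00 : (m0 <= 2 * m0)%N by rewrite leq_pmull.
have c0 := hm _ m00; have c1 := hm _ (leqW m00).
have sg : (-1) ^+ (2 * m0) = 1 :> R by rewrite exprM sqrrN !expr1n.
move: a0 a1 c0 c1; rewrite [(-1) ^+ (2 * m0).+1]exprS sg mulr1 mul1r mulN1r.
rewrite !ler_norml => a0 a1 /andP[c0 c0'] /andP[c1 c1'].
by apply/andP; split; lra.
Qed.

(** The mean number of full functions divided by [aut] is the probability of an isometry on a
    connected graph; the remaining probability is carried by disconnected graphs. *)
Lemma prob_iso_limit : vanishing (fun n =>
  ER_prob q (fun E : graph n => pairing_iso (@sandpile_Sylow_pairing p n E) pairG) - limit / aut).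
Proof.
have [A [_ [s1 [_ hs1]]]] := moments_and_good.
have vd := prob_disconnected q_gt0 q_lt1 (ltn0Sn s1) (hs1 _ (leqnSn s1)).
have vv := vanishingD vd (vanishing_norm (vanishingZ aut^-1 mean_full_limit)).
refine (@vanishing_le _ _ _ 1 vv _) => n n1.
have -> : ER_prob q (fun E : graph n => pairing_iso (@sandpile_Sylow_pairing p n E) pairG) - limit / aut =
  (ER_prob q (fun E : graph n => pairing_iso (@sandpile_Sylow_pairing p n E) pairG) - mean_full n / aut)
  + aut^-1 * (mean_full n - limit) by ring.
apply: (le_trans (ler_normD _ _)); rewrite lerD2r.
pose P (E : graph n) := `[< pairing_iso (@sandpile_Sylow_pairing p n E) pairG >].
pose C (E : graph n) := `[< lap_ker_const E >].
have -> : mean_full n / aut = \sum_(E : graph n | P E && C E) graph_weight q E.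
  rewrite /mean_full mulr_suml [RHS]big_mkcond; apply: eq_bigr => E _.
  rewrite /full_count (card_full E p_pr pG dG n1) asbool_and andbC -/(P E) -/(C E).
  by case: ifP => _; rewrite ?mulr0 ?mul0r // mulfK // lt0r_neq0.
have -> : ER_prob q (fun E : graph n => pairing_iso (@sandpile_Sylow_pairing p n E) pairG) =
   \sum_(E : graph n | P E && C E) graph_weight q E + \sum_(E : graph n | P E && ~~ C E) graph_weight q E.
  by rewrite ER_probE (bigID C).
rewrite addrAC subrr add0r ger0_norm ?sumr_ge0 //.
by apply: (prob_le (P := fun E => P E && ~~ C E)) => // E /andP[].
Qed.

End Limit.

Theorem theorem1p1 (R : realType) (q : R) (p : nat)
    (G : finZmodType) (pairG : G -> G -> QZ) :
  0 < q -> q < 1 ->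
  prime p ->
  (p.-group [set: G])%g ->
  duality_pairing pairG ->
  ((fun n : nat =>
      ER_prob q (fun E : graph n =>
        pairing_iso (@sandpile_Sylow_pairing p n E) pairG)) @ \oo -->
   limn (fun m : nat =>
           \prod_(1 <= k < m.+1) (1 - (p%:R : R) ^ (1 - 2 * k%:Z)))
     / (#|G|%:R * #|pairing_Aut pairG|%:R))%classic.
Proof.
move=> q_gt0 q_lt1 p_pr pG dG; apply: vanishing_cvg.
by rewrite -natrM; apply: prob_iso_limit.
Qed.
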